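(* Let $R$ be the ring of integers in a number field $K$ and let $\Lambda$ be a maximal $R$-order in a finite dimensional semisimple $K$-algebra $H$. For each maximal ideal $P$ of $R$ and positive integers $n,r$ let $M(n,r,P)$ be the number of simple factors of the semisimple algebra $(\Lambda/P\Lambda)/J(\Lambda/P\Lambda)$ which are isomorphic to $\mathrm{M}_n(\mathbb{F}_{q^r})$, where $q=\mathrm{N}(P)$. Let $h$ be the smallest positive integer such that \[ M(n,r,P)\leq \frac{\mathrm{g}_h(n,q,r)}{r\,|\mathrm{PGL}_n(\mathbb{F}_{q^r})|}, \qquad q=\mathrm{N}(P), \] for every maximal ideal $P$ of $R$ and any positive integers $n,r$. Then: (1) if $h\geq 3$, then $h$ is the smallest number of generators of $\Lambda$ as an $R$-algebra; (2) if $h=2$, then the smallest number of generators of $\Lambda$ as an $R$-algebra is $2$ or $3$; (3) if $h=1$, then $\Lambda$ is commutative and the smallest number of generators of $\Lambda$ as an $R$-algebra is $1$ or $2$.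
   Context: All algebras are associative with identity and subalgebras contain the identity. Elements $a_1,\dots,a_k$ of an $R$-algebra $A$ generate $A$ as an $R$-algebra if the smallest (unital) $R$-subalgebra of $A$ containing them is $A$. The smallest number of generators of $A$ is the smallest positive integer $k$ such that $A$ can be generated by $k$ elements as an $R$-algebra. $J(S)$ denotes the Jacobson radical of a ring $S$. $\mathrm{N}(P)=|R/P|$ is the number of elements of the finite field $R/P$. $\mathbb{F}_q$ is the field with $q$ elements and $\mathrm{M}_n(F)$ is the ring of $n\times n$ matrices over $F$. For a prime power $q$ and positive integers $k,n,r$, $\mathrm{g}_k(n,q,r)$ denotes the number of $k$-tuples of elements of $\mathrm{M}_n(\mathbb{F}_{q^r})$ which generate $\mathrm{M}_n(\mathbb{F}_{q^r})$ as an $\mathbb{F}_q$-algebra. An $R$-order in $H$ is a subring of $H$ (with the same identity) that is a finitely generated $R$-module spanning $H$ over $K$; it is maximal if it is not properly contained in another $R$-order in $H$. *)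

(* Defs.v *)
From HB Require Import structures.
From mathcomp Require Import all_boot all_order all_algebra all_fingroup.
From mathcomp Require Import all_solvable all_field generic_quotient ring_quotient.
From mathcomp Require Import finmap boolp classical_sets cardinality.

Set Implicit Arguments.
Unset Strict Implicit.
Unset Printing Implicit Defensive.

Import GRing.Theory.
Local Open Scope ring_scope.
Local Open Scope quotient_scope.
Local Open Scope classical_set_scope.

(* For infinite [A], [fset_set A] is empty, so that [ncard A = 0]. *)
Definition ncard (T : choiceType) (A : set T) : nat := #|` fset_set A|%fset.

Definition smallest_positive (Q : nat -> Prop) (k : nat) : Prop :=
  [/\ (0 < k)%N, Q k & forall j, (0 < j)%N -> Q j -> (k <= j)%N].

Section Ideals.
Variable A : pzRingType.

Definition is_left_ideal (I : set A) : Prop :=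
  [/\ I 0, forall x y, I x -> I y -> I (x - y) & forall a x, I x -> I (a * x)].

Definition is_ideal (I : set A) : Prop :=
  is_left_ideal I /\ (forall a x, I x -> I (x * a)).

Definition is_maximal_left_ideal (m : set A) : Prop :=
  [/\ is_left_ideal m, m <> setT &
      forall I, is_left_ideal I -> m `<=` I -> I = m \/ I = setT].

Definition is_maximal_ideal (m : set A) : Prop :=
  [/\ is_ideal m, m <> setT &
      forall I, is_ideal I -> m `<=` I -> I = m \/ I = setT].

Definition is_minimal_left_ideal (I : set A) : Prop :=
  [/\ is_left_ideal I, I <> [set 0] &
      forall J, is_left_ideal J -> J `<=` I -> J = [set 0] \/ J = I].

(* The left regular module is a finite direct sum of simple modules; the
   simple submodules of this module are the minimal left ideals. *)
Definition semisimple : Prop :=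
  exists (m : nat) (I : 'I_m -> set A),
    (forall i, is_minimal_left_ideal (I i)) /\
    (forall x, exists! t : {ffun 'I_m -> A},
        (forall i, I i (t i)) /\ x = \sum_i t i).

Record ideal := Ideal { ideal_set : set A; idealP : is_ideal ideal_set }.

Lemma left_idealD (I : set A) x y : is_left_ideal I -> I x -> I y -> I (x + y).
Proof.
move=> [I0 IB _] Ix Iy; rewrite -[y]opprK; apply: (IB) => //.
by rewrite -sub0r; apply: IB.
Qed.

Definition jacobson_set : set A :=
  [set x | forall m, is_maximal_left_ideal m -> m x].

Lemma jacobson_is_ideal : is_ideal jacobson_set.
Proof.
split; first split.
- by move=> m [[]].
- by move=> x y Jx Jy m mm; case: (mm) => [[_ mB _] _ _]; apply: mB; [exact: Jx|exact: Jy].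
- by move=> a x Jx m mm; case: (mm) => [[_ _ mM] _ _]; apply: mM; exact: Jx.
move=> a x Jx m mm; case: (mm) => lm mT mmax; case: (lm) => m0 mB mM.
pose m' : set A := [set b | m (b * a)].
have lm' : is_left_ideal m'.
  split=> [|b c mb mc|b c mc]; rewrite /m' /=.
  - by rewrite mul0r.
  - by rewrite mulrBl; apply: mB.
  - by rewrite -mulrA; apply: mM.
have [m'T|m'T] := pselect (m' = setT).
  by have : m' x by rewrite m'T.
apply: (Jx m'); split=> // N lN m'N.
have [Nm'|] := pselect (N `<=` m'); first by left; apply/seteqP.
move=> /existsNP[b /not_implyP[Nb m'b]]; right.
pose L : set A := [set z | exists y c, m y /\ z = y + c * (b * a)].
have lL : is_left_ideal L.
  split.
  - by exists 0, 0; rewrite mul0r addr0.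
  - move=> _ _ [y [c [my ->]]] [y' [c' [my' ->]]]; exists (y - y'), (c - c').
    by split; [exact: mB|rewrite mulrBl opprD addrACA].
  - move=> d _ [y [c [my ->]]]; exists (d * y), (d * c).
    by split; [exact: mM|rewrite mulrDr mulrA].
have mL : m `<=` L by move=> y my; exists y, 0; rewrite mul0r addr0.
have [Lm|LT] := mmax _ lL mL.
  by case: m'b; rewrite /m' /= -Lm; exists 0, 1; rewrite mul1r add0r.
have [y [c [my aE]]] : L a by rewrite LT.
have N1 : N 1.
  have : N (1 - c * b).
    by apply: m'N; rewrite /m' /= mulrBl mul1r -mulrA {1}aE addrK.
  move=> N1; rewrite -[1](subrK (c * b)); apply: left_idealD => //.
  by case: lN => _ _; apply.
apply/seteqP; split=> // z _; rewrite -[z]mulr1.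
by case: lN => _ _; apply.
Qed.

Definition jacobson : ideal := Ideal jacobson_is_ideal.

End Ideals.

Section QuotientRing.
Variables (A : pzRingType) (I : ideal A).

Definition ideal_pred : {pred A} := [pred x | `[< ideal_set I x >]].

Fact ideal_pred_zmod_closed : zmod_closed ideal_pred.
Proof.
have [[I0 IB _] _] := idealP I; split; first exact/asboolP.
by move=> x y /asboolP Ix /asboolP Iy; apply/asboolP/IB.
Qed.
HB.instance Definition _ :=
  GRing.isZmodClosed.Build A ideal_pred ideal_pred_zmod_closed.

Definition quot_ring : Type := {ideal_quot ideal_pred}.
HB.instance Definition _ := GRing.Zmodule.on quot_ring.

Definition to_quot (x : A) : quot_ring := \pi_{ideal_quot ideal_pred} x.
Let rep (x : quot_ring) : A := repr (x : {ideal_quot ideal_pred}).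

Lemma to_quotP x y : to_quot x = to_quot y <-> ideal_set I (x - y).
Proof.
have -> : (to_quot x = to_quot y) <-> (x - y \in ideal_pred).
  by rewrite (Quotient.idealrBE ideal_pred); split=> /eqP.
by split=> /asboolP.
Qed.

Lemma to_quotK x : to_quot (rep x) = x.
Proof. exact: reprK. Qed.

Lemma to_quotB x y : to_quot (x - y) = to_quot x - to_quot y.
Proof. by rewrite /to_quot !piE. Qed.

Lemma to_quotD x y : to_quot (x + y) = to_quot x + to_quot y.
Proof. by rewrite /to_quot !piE. Qed.

Let qmul (x y : quot_ring) : quot_ring := to_quot (rep x * rep y).

Lemma qmulE x y : qmul (to_quot x) (to_quot y) = to_quot (x * y).
Proof.
have [lI Ir] := idealP I; have [_ _ IM] := lI.
apply/to_quotP.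
set x' := rep _; set y' := rep _.
have hx : ideal_set I (x' - x) by apply/to_quotP; rewrite to_quotK.
have hy : ideal_set I (y' - y) by apply/to_quotP; rewrite to_quotK.
have -> : x' * y' - x * y = (x' - x) * y' + x * (y' - y).
  by rewrite mulrBl mulrBr addrA subrK.
by apply: left_idealD => //; [apply: Ir|apply: IM].
Qed.

Fact qmulA : associative qmul.
Proof.
move=> x y z; rewrite -[x]to_quotK -[y]to_quotK -[z]to_quotK.
by rewrite !qmulE mulrA.
Qed.
Fact qmul1 : left_id (to_quot 1) qmul.
Proof. by move=> x; rewrite -[x]to_quotK qmulE mul1r. Qed.
Fact qmulr1 : right_id (to_quot 1) qmul.
Proof. by move=> x; rewrite -[x]to_quotK qmulE mulr1. Qed.
Fact qmulDl : left_distributive qmul +%R.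
Proof.
move=> x y z; rewrite -[x]to_quotK -[y]to_quotK -[z]to_quotK.
by rewrite -to_quotD !qmulE -to_quotD mulrDl.
Qed.
Fact qmulDr : right_distributive qmul +%R.
Proof.
move=> x y z; rewrite -[x]to_quotK -[y]to_quotK -[z]to_quotK.
by rewrite -to_quotD !qmulE -to_quotD mulrDr.
Qed.

HB.instance Definition _ := GRing.Zmodule_isPzRing.Build quot_ring
  qmulA qmul1 qmulr1 qmulDl qmulDr.

End QuotientRing.

Section SimpleFactors.
Variable A : pzRingType.

(* [I] is one of the factors of a decomposition of [A] as a product of two
   rings, i.e. [A] is the direct sum of [I] and of another two-sided ideal. *)
Definition is_factor (I : set A) : Prop :=
  is_ideal I /\ exists J : set A, [/\ is_ideal J,
    I `&` J = [set 0] & forall x, exists y z, [/\ I y, J z & x = y + z]].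

(* The two-sided ideals of the ring [I], a factor of [A], are exactly the
   two-sided ideals of [A] contained in [I]. *)
Definition is_simple_factor (I : set A) : Prop :=
  [/\ is_factor I, I <> [set 0] &
      forall J, is_ideal J -> J `<=` I -> J = [set 0] \/ J = I].

Definition iso_matrix_ring (I : set A) (n : nat) (F : fieldType) : Prop :=
  exists f : 'M[F]_n -> A,
    [/\ injective f, range f = I, {morph f : x y / x + y} &
        {morph f : x y / x *m y >-> x * y}].

Definition num_simple_factors (n : nat) (F : fieldType) : nat :=
  ncard [set I : set A | is_simple_factor I /\ iso_matrix_ring I n F].

End SimpleFactors.

Section Generation.
(* [scale] is explicit because ['M[F]_n] carries no [lalgType] structure for
   arbitrary [n]; it is always [*:%R] below. *)
Variables (K A : pzRingType) (scale : K -> A -> A) (R : {pred K}).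

Definition is_subalgebra (S : set A) : Prop :=
  [/\ S 1, forall x y, S x -> S y -> S (x - y),
      forall x y, S x -> S y -> S (x * y) &
      forall c x, c \in R -> S x -> S (scale c x)].

(* [smallest C G] is the intersection of the sets in [C] which contain [G]. *)
Definition generates (B : set A) (s : seq A) : Prop :=
  smallest is_subalgebra [set` s] = B.

Definition generated_by_num (B : set A) (k : nat) : Prop :=
  exists a : k.-tuple A, generates B a.

End Generation.

Section MatricesOverFiniteFields.

Lemma finite_field_exists (q : nat) : {F : finFieldType |
  (exists p k, [/\ prime p, (0 < k)%N & q = (p ^ k)%N]) -> #|F| = q}.
Proof.
have [h|h] := pselect (exists p k, [/\ prime p, (0 < k)%N & q = (p ^ k)%N]);
  last by exists 'F_2.
have [p /cid[k [pp k0 qE]]] := cid h.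
have [F _ cF] := pPrimePowerField pp k0.
by exists F => _; rewrite cF qE.
Qed.

(* The field with [q] elements when [q] is a prime power; junk otherwise. *)
Definition GF (q : nat) : finFieldType := sval (finite_field_exists q).

(* The subfield F_q of F_(q ^ r) consists of the roots of X^q - X. *)
Definition subGF (q r : nat) : {pred GF (q ^ r)} := [pred c | c ^+ q == c].

Definition num_generating_tuples (k n q r : nat) : nat :=
  #|[set t : k.-tuple 'M[GF (q ^ r)]_n |
      `[< generates (A := 'M[GF (q ^ r)]_n) *:%R (@subGF q r) setT t >]]%SET|.

Definition PGL_card (n : nat) (F : finFieldType) : nat :=
  #|('GL_n[F] / 'Z('GL_n[F]))%g|.

End MatricesOverFiniteFields.

Section Subring.
Variables (A : nzRingType) (S : subringClosed A).

Definition subring_type : Type := {x : A | x \in S}.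
HB.instance Definition _ := SubChoice.on subring_type.
HB.instance Definition _ := [SubChoice_isSubNzRing of subring_type by <:].

Definition subring_val (x : subring_type) : A := val x.
HB.instance Definition _ :=
  GRing.RMorphism.copy subring_val (val : subring_type -> A).

End Subring.

Section RingOfIntegers.
Variable K : fieldExtType rat.

Definition integers : {pred K} :=
  [pred x | `[< integralOver (intr : int -> K) x >]].

Fact integers_subring_closed : subring_closed integers.
Proof.
split=> [|x y /asboolP hx /asboolP hy|x y /asboolP hx /asboolP hy]; apply/asboolP.
- exact: integral1.
- exact: integral_sub.
- exact: integral_mul.
Qed.
HB.instance Definition _ :=
  GRing.isSubringClosed.Build K integers integers_subring_closed.

Definition ring_of_integers : nzRingType := subring_type integers.

Definition ideal_norm (P : ideal ring_of_integers) : nat :=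
  ncard [set: quot_ring P].

End RingOfIntegers.
Arguments integers K : clear implicits.

Section Orders.
Variables (K : fieldExtType rat) (H : falgType K).

(* L = R s_0 + ... + R s_m for R the ring of integers, and the K-subspace of H
   spanned by L is H. *)
Definition is_order (L : subringClosed H) : Prop :=
  (exists s : seq H, forall x, x \in L <->
     exists2 c : 'I_(size s) -> K, forall i, c i \in integers K &
       x = \sum_(i < size s) c i *: s`_i) /\
  (forall V : {vspace H}, {subset L <= V} -> V = fullv).

Definition is_maximal_order (L : subringClosed H) : Prop :=
  is_order L /\
  forall G : subringClosed H, is_order G -> {subset L <= G} -> G =i L.

Section Extension.
Variables (L : subringClosed H) (P : ideal (ring_of_integers K)).

(* The ideal P L of L: finite sums of products of elements of P and L. *)
Definition extended_set : set (subring_type L) :=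
  [set x | exists s : seq (ring_of_integers K * subring_type L),
    (forall u, u \in s -> ideal_set P u.1) /\
    subring_val x = \sum_(u <- s) subring_val u.1 *: subring_val u.2].

Lemma extended_is_ideal : is_ideal extended_set.
Proof.
have [[P0 PB _] _] := idealP P.
split; first split.
- by exists [::]; rewrite big_nil rmorph0.
- move=> x y [s [Ps xE]] [t [Pt yE]].
  exists (s ++ [seq (- u.1, u.2) | u <- t]); split.
    move=> u; rewrite mem_cat => /orP[/Ps//|/mapP[v /Pt Pv ->]] /=.
    by rewrite -sub0r; apply: PB.
  rewrite rmorphB /= xE yE big_cat big_map /= -sumrN.
  by congr (_ + _); apply: eq_bigr => u _; rewrite rmorphN scaleNr.
- move=> a x [s [Ps xE]]; exists [seq (u.1, a * u.2) | u <- s]; split.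
    by move=> u /mapP[v /Ps Pv ->].
  rewrite rmorphM /= xE big_map mulr_sumr; apply: eq_bigr => u _ /=.
  by rewrite scalerAr.
move=> a x [s [Ps xE]]; exists [seq (u.1, u.2 * a) | u <- s]; split.
  by move=> u /mapP[v /Ps Pv ->].
rewrite rmorphM /= xE big_map mulr_suml; apply: eq_bigr => u _ /=.
by rewrite scalerAl.
Qed.

Definition extended_ideal : ideal (subring_type L) := Ideal extended_is_ideal.

Definition residue_ring : pzRingType := quot_ring extended_ideal.

Definition semisimple_residue_ring : pzRingType :=
  quot_ring (jacobson residue_ring).

Definition residue_multiplicity (n r : nat) : nat :=
  num_simple_factors semisimple_residue_ring n (GF (ideal_norm P ^ r)).

End Extension.

Definition multiplicity_bound (L : subringClosed H) (k : nat) : Prop :=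
  forall P : ideal (ring_of_integers K), is_maximal_ideal (ideal_set P) ->
  forall n r : nat, (0 < n)%N -> (0 < r)%N ->
  let q := ideal_norm P in
  ((residue_multiplicity L P n r)%:R <=
     (num_generating_tuples k n q r)%:R /
       (r%:R * (PGL_card n (GF (q ^ r)))%:R) :> rat)%R.

(* As L is an R-subalgebra of H, a tuple of elements of L has the same smallest
   R-subalgebra containing it in H as in L. *)
Definition order_generated_by (L : subringClosed H) (k : nat) : Prop :=
  generated_by_num *:%R (integers K) [set` L] k.

End Orders.

(* Main.v *)
(* Let B be the semisimple residue ring of Lambda at P, J the kernel of
   Lambda -> B and q = N(P).  By Wedderburn's theorem B is a product of matrix
   rings M_n(F_(q^r)), and by Goursat's lemma a k-tuple generates B over F_q if
   and only if its components generate the factors and no isomorphism between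
   two factors carries one component to the other.  The F_q-automorphisms of
   M_n(F_(q^r)) are r |PGL_n(F_(q^r))| in number by the Skolem-Noether theorem
   and act freely on generating tuples, so the inequalities at P say exactly
   that k elements generate B.  In particular Lambda needs h generators.

   Conversely, as Lambda is maximal, J is invertible.  This allows one to lift
   k >= 2 generators of B (k >= 1 if Lambda is commutative) to generators of
   Lambda modulo P Lambda.  If N(P) is large, two generators (one if Lambda is
   commutative) suffice at P.  Approximating local generators at finitely many P
   at a time, one finds k >= 3 (resp. k >= 2) elements which generate modulo
   every P, and these generate Lambda by Nakayama's lemma.

   If h = 1, then all rings B are commutative, and commutators in Lambda lie in
   the intersection of the ideals J for all P.  Since H is semisimple, this
   intersection, if nonzero, would contain z with z^2 = m z <> 0 for an integer
   m > 0; then z would be in P Lambda for almost all P, which is absurd. *)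
From HB Require Import structures.
From mathcomp Require Import all_boot all_order all_algebra all_fingroup.
From mathcomp Require Import all_solvable all_field.
From mathcomp Require Import finmap boolp classical_sets cardinality.
Require Import Defs.

Set Implicit Arguments.
Unset Strict Implicit.
Unset Printing Implicit Defensive.

Import GRing.Theory.
Local Open Scope ring_scope.
Local Open Scope classical_set_scope.

(** * Ideals and generated subrings *)

(** Generators of B need not generate Lambda modulo P Lambda: a lifted tuple must also fill J / J^2.
    Let M be the kernel of Lambda onto one simple factor of B. If for every lift of the tuple the
    generated subalgebra met J only inside JM, each lift would give a ring section of Lambda / JM ->
    B. As B is separable, all sections are conjugate under 1 + J/JM, so at most |J/JM| of them
    exist, against |J/JM|^k lifts. Since J/JM is nonzero by invertibility of J, this is absurd for k
    >= 2; if Lambda is commutative, conjugation is trivial and k = 1 is already absurd.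
    Invertibility serves again to combine the factors: the ideal generated by J^2 and the part of
    the subalgebra in J is a product J I, and good lifts keep I out of every M.

    Globally the method spends one generator more than the number t that suffices at almost all P:
    the surplus leaves each new generator free at all but finitely many P. As t = 2, or t = 1 for
    commutative Lambda, the cases h = 2 and h = 1 stay undecided between h and h + 1. *)

Section AdditiveSubgroups.
Variable A : zmodType.
Implicit Types (X Y : set A).

Definition add_group X := X 0 /\ forall x y, X x -> X y -> X (x - y).

Lemma add_groupN X x : add_group X -> X x -> X (- x).
Proof. by move=> [X0 XB] Xx; rewrite -sub0r; apply: XB. Qed.

Lemma add_groupD X x y : add_group X -> X x -> X y -> X (x + y).
Proof.
by move=> gX Xx Xy; rewrite -[y]opprK; apply: (gX.2) => //; exact: add_groupN.
Qed.

Lemma add_group_sum X (I : Type) (r : seq I) (Q : pred I) (F : I -> A) :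
  add_group X -> (forall i, Q i -> X (F i)) -> X (\sum_(i <- r | Q i) F i).
Proof.
move=> gX XF; elim/big_ind : _ => //; first by case: gX.
by move=> x y; apply: add_groupD.
Qed.

End AdditiveSubgroups.

Section Ideals.
Variable A : pzRingType.
Implicit Types (I J X Y Z : set A).

Lemma left_ideal_add_group I : is_left_ideal I -> add_group I.
Proof. by case. Qed.

Lemma ideal_add_group I : is_ideal I -> add_group I.
Proof. by case=> /left_ideal_add_group. Qed.

Lemma ideal_mull I a x : is_ideal I -> I x -> I (a * x).
Proof. by case=> [[_ _ H]] _ Ix; apply: H. Qed.

Lemma ideal_mulr I a x : is_ideal I -> I x -> I (x * a).
Proof. by case=> _ H Ix; apply: H. Qed.

Lemma ideal_full I : is_ideal I -> I 1 -> I = setT.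
Proof.
by move=> iI I1; apply/seteqP; split=> // x _; rewrite -[x]mulr1; apply: ideal_mull.
Qed.

Lemma ideal_mul_congr I x x' y y' :
  is_ideal I -> I (x - x') -> I (y - y') -> I (x * y - x' * y').
Proof.
move=> iI hx hy.
have -> : x * y - x' * y' = (x - x') * y + x' * (y - y').
  by rewrite mulrBl mulrBr addrA subrK.
by apply: add_groupD; [exact: ideal_add_group|exact: ideal_mulr|exact: ideal_mull].
Qed.

(** The additive group spanned by the products, encoded impredicatively so that an inclusion is
    checked on products alone. *)
Definition ideal_prod X Y : set A :=
  [set z | forall Z, add_group Z -> (forall x y, X x -> Y y -> Z (x * y)) -> Z z].

Lemma ideal_prod_group X Y : add_group (ideal_prod X Y).
Proof.
split=> [Z [] //|x y Hx Hy Z gZ HZ].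
by apply: gZ.2; [exact: Hx|exact: Hy].
Qed.

Lemma mem_ideal_prod X Y x y : X x -> Y y -> ideal_prod X Y (x * y).
Proof. by move=> Xx Yy Z _; apply. Qed.

Lemma ideal_prod_sub X Y Z : add_group Z ->
  (forall x y, X x -> Y y -> Z (x * y)) -> ideal_prod X Y `<=` Z.
Proof. by move=> gZ HZ z; apply. Qed.

Lemma ideal_prodS X X' Y Y' :
  X `<=` X' -> Y `<=` Y' -> ideal_prod X Y `<=` ideal_prod X' Y'.
Proof.
move=> XX YY; apply: ideal_prod_sub; first exact: ideal_prod_group.
by move=> x y /XX Xx /YY Yy; apply: mem_ideal_prod.
Qed.

Lemma add_group_preml X a : add_group X -> add_group [set z | X (a * z)].
Proof.
move=> gX; split=> /=; first by rewrite mulr0; case: gX.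
by move=> x y Hx Hy; rewrite mulrBr; apply: gX.2.
Qed.

Lemma add_group_premr X a : add_group X -> add_group [set z | X (z * a)].
Proof.
move=> gX; split=> /=; first by rewrite mul0r; case: gX.
by move=> x y Hx Hy; rewrite mulrBl; apply: gX.2.
Qed.

Lemma ideal_prod_left X Y a : (forall x, X x -> X (a * x)) ->
  forall z, ideal_prod X Y z -> ideal_prod X Y (a * z).
Proof.
move=> Xa z; apply: (ideal_prod_sub (Z := [set z | ideal_prod X Y (a * z)])).
  exact/add_group_preml/ideal_prod_group.
by move=> x y Xx Yy /=; rewrite mulrA; apply: mem_ideal_prod => //; exact: Xa.
Qed.

Lemma ideal_prod_right X Y a : (forall y, Y y -> Y (y * a)) ->
  forall z, ideal_prod X Y z -> ideal_prod X Y (z * a).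
Proof.
move=> Ya z; apply: (ideal_prod_sub (Z := [set z | ideal_prod X Y (z * a)])).
  exact/add_group_premr/ideal_prod_group.
by move=> x y Xx Yy /=; rewrite -mulrA; apply: mem_ideal_prod => //; exact: Ya.
Qed.

Lemma ideal_prod_ideal X Y : (forall a x, X x -> X (a * x)) ->
  (forall a y, Y y -> Y (y * a)) -> is_ideal (ideal_prod X Y).
Proof.
move=> Xl Yr; have [h0 hB] := ideal_prod_group X Y.
split; first split=> //.
  by move=> a z; apply: ideal_prod_left => x; exact: Xl.
by move=> a z; apply: ideal_prod_right => x; exact: Yr.
Qed.

Lemma ideal_prodA X Y Z :
  ideal_prod X (ideal_prod Y Z) = ideal_prod (ideal_prod X Y) Z.
Proof.
apply/seteqP; split; apply: ideal_prod_sub; try exact: ideal_prod_group.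
  move=> x w Xx; apply: (ideal_prod_sub (Z := [set w |
    ideal_prod (ideal_prod X Y) Z (x * w)])).
    exact/add_group_preml/ideal_prod_group.
  move=> y z Yy Zz /=; rewrite mulrA; apply: mem_ideal_prod => //.
  exact: mem_ideal_prod.
move=> w z Hw Zz; move: w Hw; apply: (ideal_prod_sub (Z := [set w |
  ideal_prod X (ideal_prod Y Z) (w * z)])).
  exact/add_group_premr/ideal_prod_group.
move=> x y Xx Yy /=; rewrite -mulrA; apply: mem_ideal_prod => //.
exact: mem_ideal_prod.
Qed.

End Ideals.

Section GeneratedSubring.
Variable A : pzRingType.

(** Subalgebras over a base ring are treated as subrings throughout, by adjoining the image of the
    base ring to [Z]. *)
Inductive subring_gen (Z : set A) : A -> Prop :=
| subring_gen_in x of Z x : subring_gen Z x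
| subring_gen1 : subring_gen Z 1
| subring_genB x y of subring_gen Z x & subring_gen Z y : subring_gen Z (x - y)
| subring_genM x y of subring_gen Z x & subring_gen Z y : subring_gen Z (x * y).

Lemma subring_gen_group Z : add_group (subring_gen Z).
Proof.
split; last exact: subring_genB.
by rewrite -(subrr 1); apply: subring_genB; exact: subring_gen1.
Qed.

Lemma subring_genS Z Z' : Z `<=` Z' -> subring_gen Z `<=` subring_gen Z'.
Proof.
move=> ZZ x; elim=> [y /ZZ|||]; [exact: subring_gen_in|exact: subring_gen1| |].
- by move=> ? ? _ ? _ ?; apply: subring_genB.
- by move=> ? ? _ ? _ ?; apply: subring_genM.
Qed.

Lemma subring_gen_congr I Z Z' : is_ideal I ->
  (forall x, Z x -> exists2 y, subring_gen Z' y & I (x - y)) ->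
  forall x, subring_gen Z x -> exists2 y, subring_gen Z' y & I (x - y).
Proof.
move=> iI ZZ x; have gI := ideal_add_group iI; elim=> {x}.
- exact: ZZ.
- by exists 1; [exact: subring_gen1|rewrite subrr; case: gI].
- move=> x y _ [x' gx hx] _ [y' gy hy]; exists (x' - y').
    exact: subring_genB.
  have -> : x - y - (x' - y') = (x - x') - (y - y').
    by rewrite opprD opprK addrACA opprB [y' - y]addrC.
  exact: gI.2.
- move=> x y _ [x' gx hx] _ [y' gy hy]; exists (x' * y').
    exact: subring_genM.
  exact: ideal_mul_congr.
Qed.

End GeneratedSubring.

Lemma subring_gen_morph (A B : pzRingType) (f : {rmorphism A -> B}) Z x :
  subring_gen Z x -> subring_gen (f @` Z) (f x).
Proof.
elim=> {x} [x Zx|||]; [|by rewrite rmorph1; exact: subring_gen1| |].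
- by apply: subring_gen_in; exists x.
- by move=> ? ? _ ? _ ?; rewrite rmorphB; apply: subring_genB.
- by move=> ? ? _ ? _ ?; rewrite rmorphM; apply: subring_genM.
Qed.

Lemma subring_gen_morph_lift (A B : pzRingType) (f : {rmorphism A -> B}) Z y :
  subring_gen (f @` Z) y -> exists2 x, subring_gen Z x & f x = y.
Proof.
elim=> {y} [y [x Zx <-]|||].
- by exists x => //; exact: subring_gen_in.
- by exists 1; [exact: subring_gen1|rewrite rmorph1].
- by move=> _ _ _ [x gx <-] _ [y gy <-]; exists (x - y); [exact: subring_genB|rewrite rmorphB].
- by move=> _ _ _ [x gx <-] _ [y gy <-]; exists (x * y); [exact: subring_genM|rewrite rmorphM].
Qed.

Section FiniteTypes.

Lemma finite_set_enum (T : Type) : finite_set [set: T] ->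
  exists n (g : 'I_n -> T), bijective g.
Proof.
move=> fT; have /(@finite_seqP {classic T})[s0 s0T] : finite_set [set: {classic T}].
  exact: fT.
pose s : seq {classic T} := undup s0; have us : uniq s := undup_uniq s0.
have Ts (x : {classic T}) : x \in s.
  by rewrite mem_undup; have : [set: {classic T}] x by []; rewrite s0T.
pose g (i : 'I_(size s)) : {classic T} := tnth (in_tuple s) i.
exists (size s), g.
have sz x : (index (x : {classic T}) s < size s)%N by rewrite index_mem.
exists (fun x => Ordinal (sz x)) => [i|x].
  by apply: val_inj; rewrite /= /g (tnth_nth (g i)) /= index_uniq.
by rewrite /g (tnth_nth (x : {classic T})) /= nth_index.
Qed.

Lemma finite_setT_cover (T : choiceType) (l : seq T) : (forall x, x \in l) ->
  finite_set [set: T].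
Proof.
by move=> Tl; apply/finite_seqP; exists l; apply/seteqP; split=> // x _; exact: Tl.
Qed.

Lemma finite_setT_image (T U : Type) (f : T -> U) : finite_set [set: T] ->
  (forall y, exists x, f x = y) -> finite_set [set: U].
Proof.
move=> fT fs; suff -> : [set: U] = f @` setT by exact: finite_image.
by apply/seteqP; split=> // y _; have [x <-] := fs y; exists x.
Qed.

Lemma finite_setT_inj (T U : Type) (f : T -> U) : finite_set [set: U] ->
  injective f -> finite_set [set: T].
Proof.
move=> fU fi; suff -> : [set: T] = f @^-1` [set: U].
  by apply: finite_preimage => // x y _ _; exact: fi.
by apply/seteqP; split.
Qed.

End FiniteTypes.

Section QuotientMorphism.
Variables (A : pzRingType) (I : ideal A).

Lemma to_quotM : {morph @to_quot A I : x y / x * y}.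
Proof. by move=> x y; rewrite [RHS](@qmulE A I). Qed.

Lemma to_quot_zmod_morphism : zmod_morphism (@to_quot A I).
Proof. by move=> x y; rewrite to_quotB. Qed.
HB.instance Definition _ :=
  GRing.isZmodMorphism.Build A (quot_ring I) (@to_quot A I) to_quot_zmod_morphism.

Lemma to_quot_monoid_morphism : monoid_morphism (@to_quot A I).
Proof. by split=> // x y; rewrite to_quotM. Qed.
HB.instance Definition _ :=
  GRing.isMonoidMorphism.Build A (quot_ring I) (@to_quot A I) to_quot_monoid_morphism.

Lemma to_quot_surj (y : quot_ring I) : exists x, to_quot I x = y.
Proof. by eexists; exact: to_quotK. Qed.

Lemma to_quot_eq0 x : to_quot I x = 0 <-> ideal_set I x.
Proof. by rewrite -(rmorph0 (@to_quot A I)) to_quotP subr0. Qed.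

End QuotientMorphism.

Lemma exists_minimal (T : Type) (Q : T -> Prop) (mu : T -> nat) :
  (exists x, Q x) -> exists2 x, Q x & forall y, Q y -> (mu x <= mu y)%N.
Proof.
move=> [x0 Qx0].
have ex : exists n, `[< exists2 x, Q x & mu x = n >].
  by exists (mu x0); apply/asboolP; exists x0.
case: (ex_minnP ex) => n /asboolP[x Qx mux] nmin; exists x => // y Qy.
by rewrite mux; apply: nmin; apply/asboolP; exists y.
Qed.

(** * Finite semiprime rings and their Wedderburn decomposition *)

Section Semiprime.
Variable A : pzRingType.

Definition semiprime_ring := forall x : A, (forall a, x * a * x = 0) -> x = 0.

(** The left ideal A x is minimal, expressed on its generator. *)
Definition minimal_elt (x : A) :=
  x <> 0 /\ forall a, a * x <> 0 -> exists b, x = b * (a * x).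

(** Brauer's lemma. Write x = b x h x and e = h b x, so that e fixes h x on the left. Then e e - e
    lies in A x and kills h x; were it nonzero, x would be a multiple of it and x h x would
    vanish. *)
Lemma minimal_elt_idempotent x : semiprime_ring -> minimal_elt x ->
  exists e, [/\ minimal_elt e, e * e = e & exists a, e = a * x].
Proof.
move=> sp [x0 xmin].
have [h xhx] : exists h, x * h * x <> 0.
  by apply: contrapT => /forallNP H; apply/x0/sp => a; apply: contrapT; exact: H.
have [b xE] := xmin _ xhx.
pose e := h * b * x.
have ey : e * (h * x) = h * x by rewrite {2}xE /e !mulrA.
have ee : e * e = e.
  apply/eqP; rewrite -subr_eq0; apply/eqP; apply: contrapT => z0.
  have zE : e * e - e = (e * h * b - h * b) * x by rewrite mulrBl /e !mulrA.
  have [|c xc] := xmin (e * h * b - h * b); first by rewrite -zE.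
  apply: xhx; rewrite -mulrA {1}xc -zE -mulrA mulrBl -mulrA !ey subrr.
  by rewrite mulr0.
have e0 : e <> 0.
  by move=> e0; apply: xhx; rewrite -mulrA -ey e0 mul0r mulr0.
exists e; split=> //; last by exists (h * b).
split=> // a ae0.
have [|c xc] := xmin (a * h * b); first by move: ae0; rewrite /e !mulrA.
by exists (h * b * c); rewrite {1}/e {1}xc /e !mulrA.
Qed.

(** The measure [mu x] stands for the size of the left ideal A x: a cardinality for finite rings, a
    dimension for the algebra H. A nonzero element of least measure in [T] is minimal. *)
Lemma left_ideal_idempotent (mu : A -> nat) (T : set A) : semiprime_ring ->
  (forall x a, (mu x <= mu (a * x)%R)%N -> exists b, x = b * (a * x)) ->
  (forall a x, T x -> T (a * x)) -> (exists2 x, T x & x <> 0) ->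
  exists e, [/\ minimal_elt e, e * e = e & T e].
Proof.
move=> sp mumin TM [x0 Tx0 x00].
have [x [Tx nx] xmin] : exists2 x, T x /\ x <> 0 &
    forall y, T y /\ y <> 0 -> (mu x <= mu y)%N.
  by apply: exists_minimal; exists x0.
have [|e [me ee [a eE]]] := @minimal_elt_idempotent x sp.
  split=> // a ax0; apply: mumin; apply: xmin; split=> //; exact: TM.
by exists e; split=> //; rewrite eE; apply: TM.
Qed.

Lemma finite_left_ideal_idempotent (T : set A) : semiprime_ring ->
  finite_set [set: A] ->
  (forall a x, T x -> T (a * x)) -> (exists2 x, T x & x <> 0) ->
  exists e, [/\ minimal_elt e, e * e = e & T e].
Proof.
move=> sp /finite_set_enum[n [g [g' gK g'K]]].
pose S x := [set i : 'I_n | `[< exists a, g i = a * x >]]%SET.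
apply: (left_ideal_idempotent (mu := fun x => #|S x|)) => // x a le.
have SS : S (a * x) = S x.
  apply/eqP; rewrite eqEcard le andbT; apply/fintype.subsetP => i; rewrite !inE.
  by move=> [b gb]; exists (b * a); rewrite gb mulrA.
have : g' x \in S x by rewrite !inE; exists 1; rewrite g'K mul1r.
by rewrite -SS !inE => -[b]; rewrite g'K => xE; exists b.
Qed.

(** Schur's lemma: e A e is a division ring. *)
Lemma minimal_corner_inv e d : e * e = e -> minimal_elt e ->
  e * d * e = d -> d <> 0 -> exists2 d', e * d' * e = d' & d' * d = e.
Proof.
move=> ee [_ emin] ed d0.
have dE : d = (e * d) * e by rewrite ed.
have [|b eb] := emin (e * d); first by rewrite ed.
rewrite ed in eb.
exists (e * b * e); first by rewrite !mulrA ee -!mulrA ee.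
have edd : e * d = d by rewrite -ed !mulrA ee.
by rewrite -mulrA edd -mulrA -eb.
Qed.

Definition dual_system e n (x y : nat -> A) :=
  [/\ forall i, (i < n)%N -> x i * e = x i,
      forall i, (i < n)%N -> e * y i = y i &
      forall i j, (i < n)%N -> (j < n)%N -> y i * x j = if i == j then e else 0].

Lemma dual_system_mul e n x y i : dual_system e n x y -> (i < n)%N ->
  (\sum_(j < n) x j * y j) * x i = x i.
Proof.
move=> [xe ye yx] ilt; rewrite mulr_suml (bigD1 (Ordinal ilt)) //= -mulrA yx //.
rewrite eqxx xe // big1 ?addr0 // => j; rewrite -val_eqE /= => /negPf ji.
by rewrite -mulrA yx // ji mulr0.
Qed.

(* A dual system of maximal length is a pair of dual bases of Ae and eA over
   the division ring eAe. *)
Lemma dual_system_max e : semiprime_ring -> finite_set [set: A] -> e * e = e ->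
  minimal_elt e -> exists n x y, [/\ dual_system e n x y,
    forall z, z * e = z -> (\sum_(i < n) x i * y i) * z = z &
    forall z, e * z = z -> z * (\sum_(i < n) x i * y i) = z].
Proof.
move=> sp fA ee me; have [e0 _] := me.
have [N [g [g' gK g'K]]] := finite_set_enum fA.
have bound n x y : dual_system e n x y -> (n <= N)%N.
  move=> [_ _ yx]; rewrite -(card_ord n) -(card_ord N).
  apply: (@leq_card _ _ (fun i : 'I_n => g' (x i))) => i j /(can_inj g'K) xij.
  apply: contrapT => /eqP ij; apply: e0.
  have := yx _ _ (ltn_ord i) (ltn_ord i); rewrite eqxx => <-.
  by rewrite xij yx // -val_eqE /= in ij *; rewrite (negPf ij).
pose Q n := `[< exists x y, dual_system e n x y >].
have Q0 : exists n, Q n.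
  by exists 0%N; apply/asboolP; exists (fun=> 0), (fun=> 0); split.
have QN n : Q n -> (n <= N)%N by move=> /asboolP[x [y]]; exact: bound.
case: (ex_maxnP Q0 QN) => n /asboolP[x [y sys]] nmax.
exists n, x, y; have [xe ye yx] := sys.
set eps := \sum_(i < n) x i * y i.
have yeps i : (i < n)%N -> y i * eps = y i.
  move=> ilt; rewrite mulr_sumr (bigD1 (Ordinal ilt)) //= mulrA yx //.
  rewrite eqxx ye // big1 ?addr0 // => j; rewrite -val_eqE /= eq_sym => /negPf ji.
  by rewrite mulrA yx // ji mul0r.
have left z : z * e = z -> eps * z = z.
  move=> ze; apply: contrapT => zn.
  (* A Gram-Schmidt step: x' is the part of z killed by every [y i]. Semiprimeness gives a with x' a
     x' nonzero, and inverting e a x' in e A e gives y0 with y0 x' = e. Subtracting y0 eps makes it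
     orthogonal to the old [x j], so the system could be enlarged. *)
  pose x' := z - eps * z.
  have x'0 : x' <> 0 by move=> /eqP; rewrite subr_eq0 => /eqP/esym.
  have yx' i : (i < n)%N -> y i * x' = 0.
    by move=> ilt; rewrite mulrBr mulrA yeps // subrr.
  have x'e : x' * e = x' by rewrite mulrBl -mulrA ze.
  have [a xax] : exists a, x' * a * x' <> 0.
    by apply: contrapT => /forallNP H; apply/x'0/sp => a; apply: contrapT; exact: H.
  pose w := e * a * x'.
  have w0 : w <> 0.
    by move=> w0; apply: xax; rewrite -{1}x'e -2!mulrA [e * _]mulrA -/w w0 mulr0.
  have we : e * w * e = w by rewrite /w !mulrA ee -!mulrA x'e.
  have [d de dw] := minimal_corner_inv ee me we w0.
  pose y0 := d * (e * a).
  have y0x : y0 * x' = e by rewrite /y0 -mulrA -/w.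
  have ey0 : e * y0 = y0.
    by rewrite /y0 mulrA -de !mulrA ee.
  have epsx' : eps * x' = 0.
    by rewrite mulr_suml big1 // => i _; rewrite -mulrA yx' // mulr0.
  pose y' := y0 - y0 * eps.
  have y'x' : y' * x' = e by rewrite mulrBl -(mulrA y0 eps) epsx' mulr0 subr0.
  have y'x j : (j < n)%N -> y' * x j = 0.
    by move=> jlt; rewrite mulrBl -(mulrA y0 eps) (dual_system_mul sys) // subrr.
  have /nmax : Q n.+1.
    apply/asboolP; exists (fun i => if i == n then x' else x i),
      (fun i => if i == n then y' else y i).
    have lt1 i : (i < n.+1)%N -> i = n \/ ((i == n) = false /\ (i < n)%N).
      by rewrite ltnS leq_eqVlt => /predU1P[|ilt]; [left|right; rewrite ltn_eqF].
    split=> [i /lt1[->|[-> ilt]]|i /lt1[->|[-> ilt]]|i j /lt1 hi /lt1 hj].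
    - by rewrite eqxx.
    - exact: xe.
    - by rewrite eqxx mulrBr mulrA ey0.
    - exact: ye.
    - case: hi hj => [->|[-> ilt]] [->|[jn jlt]]; rewrite ?eqxx ?jn.
      + exact: y'x'.
      + by rewrite eq_sym jn y'x.
      + by rewrite (ltn_eqF ilt) yx'.
      + exact: yx.
  by rewrite ltnn.
(* The defect d = z - z eps kills A e by the first part, and d = e d; so d a d = (d a e) d = 0 for
   every a. *)
split=> // z ez; apply/esym/eqP; rewrite -subr_eq0; apply/eqP/sp => a.
have : (z - z * eps) * (a * e) = 0.
  by rewrite mulrBl -[z * eps * _]mulrA left ?subrr // -mulrA ee.
have -> : (z - z * eps) = e * (z - z * eps) by rewrite mulrBr mulrA ez.
by move=> h; rewrite !mulrA -[_ * a * e]mulrA h mul0r.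
Qed.

(** Each b x_i stays in A e and each y_i b in e A, so b eps and eps b are both equal to eps b
    eps. *)
Lemma dual_system_central e n (x y : nat -> A) (eps := \sum_(i < n) x i * y i) :
  dual_system e n x y -> (forall z, z * e = z -> eps * z = z) ->
  (forall z, e * z = z -> z * eps = z) ->
  eps * eps = eps /\ forall b, b * eps = eps * b.
Proof.
move=> [xe ye _] el er.
have H b : b * eps = eps * b * eps.
  rewrite {1 3}/eps !mulr_sumr; apply: eq_bigr => i _.
  by rewrite !mulrA -(mulrA eps) el // -mulrA xe.
have H' b : eps * b = eps * b * eps.
  rewrite {1 2}/eps !mulr_suml; apply: eq_bigr => i _.
  by rewrite -!mulrA (mulrA (y i)) er // mulrA ye.
split; last by move=> b; rewrite H -H'.
by have := H 1; rewrite mul1r mulr1.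
Qed.

Lemma semiprime_central_idempotent (I : set A) : semiprime_ring ->
  finite_set [set: A] -> is_ideal I -> (exists2 x, I x & x <> 0) ->
  exists eps, [/\ I eps, eps <> 0, eps * eps = eps & forall b, b * eps = eps * b].
Proof.
move=> sp fA iI nI.
have [|e [me ee Ie]] := finite_left_ideal_idempotent sp fA _ nI.
  by move=> a x; exact: ideal_mull.
have [n [x [y [sys el er]]]] := dual_system_max sp fA ee me.
have [epsI epsC] := dual_system_central sys el er.
exists (\sum_(i < n) x i * y i); split=> //; last first.
  by move=> eps0; case: me => e0 _; apply: e0; rewrite -(el e) // eps0 mul0r.
apply: add_group_sum => [|i _]; first exact: ideal_add_group.
case: sys => xe _ _; rewrite -(xe _ (ltn_ord i)) -mulrA.
by apply: ideal_mull => //; apply: ideal_mulr.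
Qed.

End Semiprime.

(** * The Jacobson radical of a finite ring *)

Section Jacobson.
Variable A : pzRingType.

(** If x is outside a maximal left ideal m, then 1 = u + b x with u in m. Multiplying by b x on the
    left and using that x b x is in m puts b x, hence 1, in m. *)
Lemma jacobson_quot_semiprime : semiprime_ring (quot_ring (jacobson A)).
Proof.
move=> y; have [x <-] := to_quot_surj y => xax.
apply/to_quot_eq0 => m mm; have [lm mT mmax] := mm; have [m0 mB mM] := lm.
apply: contrapT => mx; apply: mT.
have gm := left_ideal_add_group lm.
pose L : set A := [set z | exists y c, m y /\ z = y + c * x].
have lL : is_left_ideal L.
  split.
  - by exists 0, 0; rewrite mul0r addr0.
  - move=> _ _ [u [c [mu ->]]] [u' [c' [mu' ->]]]; exists (u - u'), (c - c').
    by split; [exact: mB|rewrite mulrBl opprD addrACA].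
  - move=> d _ [u [c [mu ->]]]; exists (d * u), (d * c).
    by split; [exact: mM|rewrite mulrDr mulrA].
have mL : m `<=` L by move=> u mu; exists u, 0; rewrite mul0r addr0.
have [Lm|LT] := mmax _ lL mL.
  by case: mx; rewrite -Lm; exists 0, 1; rewrite mul1r add0r.
have [u [b [mu uE]]] : L 1 by rewrite LT.
have mxbx : m (x * b * x).
  have /to_quot_eq0 : to_quot (jacobson A) (x * b * x) = 0.
    by rewrite -(xax (to_quot _ b)) !to_quotM.
  by apply.
have mbx : m (b * x).
  rewrite -[b * x]mulr1 uE mulrDr; apply: add_groupD => //; first exact: mM.
  by rewrite -mulrA [x * _]mulrA; apply: mM.
have m1 : m 1 by rewrite uE; apply: add_groupD.
by apply/seteqP; split=> // z _; rewrite -[z]mulr1; apply: mM.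
Qed.

Hypothesis fA : finite_set [set: A].

Lemma proper_left_ideal_maximal (I : set A) : is_left_ideal I -> ~ I 1 ->
  exists2 m, is_maximal_left_ideal m & I `<=` m.
Proof.
move=> lI I1; have [n [g [g' gK g'K]]] := finite_set_enum fA.
pose S (X : set A) := [set i : 'I_n | `[< X (g i) >]]%SET.
have [m [lm Im m1] mmax] : exists2 m, [/\ is_left_ideal m, I `<=` m & ~ m 1] &
    forall X, [/\ is_left_ideal X, I `<=` X & ~ X 1] -> (n - #|S m| <= n - #|S X|)%N.
  by apply: (exists_minimal (fun X => (n - #|S X|)%N)); exists I; split.
exists m => //; split=> [//|mT|X lX mX]; first by apply: m1; rewrite mT.
have [X1|X1] := pselect (X 1).
  right; apply/seteqP; split=> // z _; rewrite -[z]mulr1.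
  by case: lX => _ _; apply.
left; have Scard Y : (#|S Y| <= n)%N by rewrite (leq_trans (max_card _)) ?card_ord.
have SmX : S m = S X.
  apply/eqP; rewrite eqEcard; apply/andP; split.
    by apply/fintype.subsetP => i; rewrite !inE; exact: mX.
  have /mmax : [/\ is_left_ideal X, I `<=` X & ~ X 1].
    by split=> //; apply: subset_trans Im mX.
  by rewrite leq_sub2lE.
apply/seteqP; split=> // z Xz.
have : g' z \in S X by rewrite !inE g'K.
by rewrite -SmX !inE g'K.
Qed.

Lemma jacobson_left_inverse (x b : A) : jacobson_set x -> exists u, u * (1 - b * x) = 1.
Proof.
move=> Jx; pose I : set A := [set z | exists u, z = u * (1 - b * x)].
have lI : is_left_ideal I.
  split=> [|_ _ [u ->] [v ->]|a _ [u ->]].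
  - by exists 0; rewrite mul0r.
  - by exists (u - v); rewrite mulrBl.
  - by exists (a * u); rewrite mulrA.
have [[u uE]|I1] := pselect (I 1); first by exists u; rewrite -uE.
have [m mm Im] := proper_left_ideal_maximal lI I1.
have [lm mT _] := mm; case: mT; apply/seteqP; split=> // z _.
have m1 : m 1.
  rewrite -[1](subrK (b * x)); apply: left_idealD => //.
    by apply: Im; exists 1; rewrite mul1r.
  by have := Jx _ mm; case: lm => _ _; apply.
by rewrite -[z]mulr1; case: lm => _ _; apply.
Qed.

(** A left inverse u of 1 - j equals 1 + u j, so it has a left inverse too, which must be 1 - j.
    Thus 1 - j is a unit, and x kills it. *)
Lemma jacobson_left_fixed (x j : A) : jacobson_set j -> x * j = x -> x = 0.
Proof.
have /ideal_add_group gJ := @jacobson_is_ideal A.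
move=> Jj xj; have [u] := jacobson_left_inverse 1 Jj; rewrite mul1r => u1.
have [v] := jacobson_left_inverse (- u) Jj; rewrite mulNr opprK => v1.
have uE : u = 1 + u * j by rewrite -u1 mulrBr mulr1 subrK.
rewrite -uE in v1.
have vE : v = 1 - j by rewrite -[v]mulr1 -[X in v * X]u1 mulrA v1 mul1r.
have ju : (1 - j) * u = 1 by rewrite -vE.
by rewrite -[x]mulr1 -ju mulrA mulrBr mulr1 xj subrr mul0r.
Qed.

(* Two of the partial products coincide, by the pigeonhole principle, and
   [x = x * j] with [j] in the radical forces [x = 0]. *)
Lemma jacobson_nilpotent : exists N, forall l : seq A, size l = N ->
  (forall x, x \in l -> jacobson_set x) -> \prod_(x <- l) x = 0.
Proof.
have [n [g [g' gK g'K]]] := finite_set_enum fA.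
have /ideal_add_group gJ := @jacobson_is_ideal A.
exists n => l sl lJ.
pose p i := \prod_(x <- take i l) x.
have /injectivePn[i [j ij pij]] : ~~ injectiveb (fun i : 'I_n.+1 => g' (p i)).
  apply/negP => /injectiveP inj; have := leq_card _ inj.
  by rewrite !card_ord ltnn.
wlog lt_ij : i j ij pij / (i < j)%N => [H|].
  move: (ij); rewrite -val_eqE neq_ltn => /orP[|] h; first exact: (H i j).
  by apply: (H j i) => //; rewrite eq_sym.
have pE : p j = p i * \prod_(x <- drop i (take j l)) x.
  rewrite /p -big_cat /=; congr bigop.body.
  by rewrite -[LHS](cat_take_drop i) -take_min (minn_idPl (ltnW lt_ij)).
have jle : (j <= size l)%N by rewrite sl -ltnS.
have [x [s sE]] : exists x s, drop i (take j l) = x :: s.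
  case E : (drop _ _) => [|x s]; last by exists x, s.
  have := size_drop i (take j l); rewrite E size_takel //= => /esym/eqP.
  by rewrite subn_eq0 leqNgt lt_ij.
have Jprod : jacobson_set (\prod_(x <- drop i (take j l)) x).
  rewrite sE big_cons; apply: (ideal_mulr _ (@jacobson_is_ideal A)).
  apply: lJ; have : x \in drop i (take j l) by rewrite sE inE eqxx.
  by move/mem_drop/mem_take.
have pi0 : p i = 0.
  by apply: (jacobson_left_fixed Jprod); rewrite -pE -[RHS]g'K pij g'K.
by rewrite -(cat_take_drop i l) big_cat /= -/(p i) pi0 mul0r.
Qed.

End Jacobson.

(** Wedderburn's little theorem: once [A] carries the structures of a finite unit ring without zero
    divisors, [FinDomainFieldType] makes it a field. The left inverses are two-sided because each
    has a left inverse itself. *)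
Lemma finite_division_ring_field (A : pzRingType) : finite_set [set: A] ->
  (1 : A) <> 0 -> (forall x : A, x <> 0 -> exists y, y * x = 1) ->
  exists (F : finFieldType) (psi : {rmorphism A -> F}), bijective psi.
Proof.
move=> fA n10 invA; have [n [g [g' gK g'K]]] := finite_set_enum fA.
pose cm := Choice_isCountable.Build A (pcan_pickleK (can_pcan g'K)).
pose AC : countType := HB.pack (A : Type) (Choice.class A) cm.
pose fm := @CanIsFinite AC 'I_n g' g g'K.
pose nz := GRing.PzSemiRing_isNonZero.Build A (introN eqP n10).
pose R0 : nzRingType := HB.pack (A : Type) (GRing.PzRing.class A) nz.
have invA2 (x : A) : x <> 0 -> exists y, y * x = 1 /\ x * y = 1.
  move=> x0; have [y yx] := invA x x0; exists y; split=> //.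
  have y0 : y <> 0 by move=> y0; apply/n10; rewrite -yx y0 mul0r.
  by have [z zy] := invA y y0; rewrite -[x]mul1r -zy -(mulrA z) yx mulr1.
pose inv (x : A) : A := if pselect (x <> 0) is left h then sval (cid (invA2 x h)) else x.
pose unit : pred A := fun x => x != 0.
have invL : {in unit, left_inverse (1 : A) inv *%R}.
  move=> x; rewrite unfold_in /inv /unit => /eqP x0; case: pselect => // h.
  by have [] := svalP (cid (invA2 x h)).
have invR : {in unit, right_inverse (1 : A) inv *%R}.
  move=> x; rewrite unfold_in /inv /unit => /eqP x0; case: pselect => // h.
  by have [] := svalP (cid (invA2 x h)).
have unitP (x y : A) : y * x = 1 /\ x * y = 1 -> unit x.
  by move=> [yx _]; apply/eqP => x0; apply/n10; rewrite -yx x0 mulr0.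
have inv0 : {in [predC unit], inv =1 id}.
  by move=> x; rewrite inE /= unfold_in /inv negbK => /eqP ->; case: pselect.
pose mI := GRing.NzRing_hasMulInverse.Build R0 invL invR unitP inv0.
pose R1 : finUnitRingType := HB.pack (A : Type) (GRing.PzRing.class A) nz mI cm fm.
have domR : GRing.integral_domain_axiom R1.
  move=> x y xy; apply/norP => -[/eqP x0 /eqP y0].
  by have [z [zx _]] := invA2 _ x0; apply: y0; rewrite -[y]mul1r -zx -mulrA xy mulr0.
pose F := FinDomainFieldType domR.
pose psi (x : A) : F := x.
have psiB : zmod_morphism psi by [].
have psiM : monoid_morphism psi by [].
pose psi' : {rmorphism A -> F} := HB.pack psi (GRing.isZmodMorphism.Build _ _ _ psiB)
  (GRing.isMonoidMorphism.Build _ _ _ psiM).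
by exists F, psi'; exists id.
Qed.

(** * Homomorphisms between finite fields *)

Section FiniteFieldMorphisms.

Lemma finField_generator (F : finFieldType) :
  exists t : F, forall x, x != 0 -> exists i, x = t ^+ i.
Proof.
have /cyclicP[u uE] := field_unit_group_cyclic [set: {unit F}]%G.
exists (val u) => x x0; have ux : x \is a GRing.unit by rewrite unitfE.
have : Sub x ux \in <[u]>%g by rewrite -uE inE.
move=> /cycleP[i xE]; exists i.
by rewrite -FinRing.val_unitX -xE.
Qed.

Lemma card_finField_gt1 (F : finFieldType) : (1 < #|F|)%N.
Proof. exact: finNzRing_gt1. Qed.

Lemma finField_exprX (F : finFieldType) (x : F) n : x ^+ (#|F| ^ n) = x.
Proof. by elim: n => [|n IH]; rewrite ?expr1 // expnS exprM expf_card. Qed.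

Lemma card_field_fixed (F : finFieldType) n :
  (forall x : F, x ^+ n = x) -> (1 < n)%N -> (#|F| <= n)%N.
Proof.
move=> Fn n1; have sz : size ('X^n - 'X : {poly F}) = n.+1.
  by rewrite size_polyDl size_polyXn // size_polyN size_polyX.
have nz : 'X^n - 'X != 0 :> {poly F} by rewrite -size_poly_eq0 sz.
rewrite cardE -ltnS -sz; apply: max_poly_roots => //; last exact: enum_uniq.
by apply/allP => x _; rewrite /root !hornerE Fn subrr.
Qed.

(** With orders p^f and p^m the claim is that f divides m. On k the identity x^(p^m) = x reduces to
    the exponent m mod f, and a nonzero remainder would give X^(p^(m mod f)) - X more roots than its
    degree. *)
Lemma finField_morph_card (k F : finFieldType) (a : {rmorphism k -> F}) :
  exists2 r, (0 < r)%N & #|F| = (#|k| ^ r)%N.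
Proof.
have [p p_pr pk] := finPcharP k; have pF : p \in [pchar F] by rewrite (fmorph_pchar a).
have [f kE] : exists f, #|k| = (p ^ f)%N by exists (logn p #|k|); exact: (card_pprimeChar pk).
have [m FE] : exists m, #|F| = (p ^ m)%N by exists (logn p #|F|); exact: (card_pprimeChar pF).
have fix_r x : x ^+ (p ^ (m %% f)) = x :> k.
  have xm : x ^+ (p ^ m) = x by apply: (fmorph_inj a); rewrite rmorphXn -FE expf_card.
  by rewrite -{2}xm {2}(divn_eq m f) expnD exprM mulnC expnM -kE finField_exprX.
have f0 : (0 < f)%N.
  by case: f kE {fix_r} => // kE; have := card_finField_gt1 k; rewrite kE.
have m0 : (m %% f = 0)%N.
  case: (posnP (m %% f)) => // mf; have := card_field_fixed fix_r.
  rewrite -{1}(exp1n (m %% f)) ltn_exp2r // prime_gt1 // kE leq_exp2l ?prime_gt1 //.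
  by move/(_ isT); rewrite leqNgt ltn_pmod.
exists (m %/ f)%N; last by rewrite kE -expnM mulnC FE {1}(divn_eq m f) m0 addn0.
case: posnP => // mf; have := card_finField_gt1 F.
by rewrite FE (divn_eq m f) mf m0.
Qed.

Lemma finField_dvd_root (F : finFieldType) (p : {poly F}) :
  p %| 'X^#|F| - 'X -> (1 < size p)%N -> exists x, root p x.
Proof.
rewrite finField_genPoly /index_enum => /dvdp_prod_XsubC[m].
case: (mask m _) => [|x s]; last first.
  move=> pE _; exists x; rewrite (eqp_root pE) big_cons rootM root_XsubC eqxx.
  by [].
by rewrite big_nil => /eqp_size ->; rewrite size_poly1.
Qed.

(* The generator of the unit group of [E] is sent to a root in [F] of its
   minimal polynomial over [k]. *)
Lemma finField_extend (k E F : finFieldType) (a : {rmorphism k -> E})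
    (b : {rmorphism k -> F}) r : #|F| = (#|E| ^ r)%N ->
  exists phi : {rmorphism E -> F}, forall c, phi (a c) = b c.
Proof.
move=> FE; have [t tgen] := finField_generator E.
pose ev (g : {poly k}) := (map_poly a g).[t].
have evB g h : ev (g - h) = ev g - ev h by rewrite /ev rmorphB hornerD hornerN.
have evM g h : ev (g * h) = ev g * ev h by rewrite /ev rmorphM hornerM.
have XnE n : ev ('X^n - 'X) = t ^+ n - t.
  by rewrite /ev rmorphB /= map_polyXn map_polyX !hornerE.
have E1 := card_finField_gt1 E.
have [m [m0 evm] mmin] : exists2 m, m != 0 /\ ev m = 0 &
    forall g, g != 0 /\ ev g = 0 -> (size m <= size g)%N.
  apply: (exists_minimal (fun g : {poly k} => size g)).
  exists ('X^#|E| - 'X); split; last by rewrite XnE expf_card subrr.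
  by rewrite -size_poly_eq0 size_polyDl size_polyXn // size_polyN size_polyX.
have dvd g : ev g = 0 -> m %| g.
  move=> evg; apply/modp_eq0P/eqP; apply/negPn/negP => r0.
  have : ev (g %% m) = 0.
    have -> : g %% m = g - g %/ m * m by rewrite {2}(divp_eq g m) addrC addKr.
    by rewrite evB evM evg evm mulr0 subrr.
  move=> evr; have := mmin _ (conj r0 evr).
  by rewrite leqNgt ltn_modp m0.
have [s sroot] : exists s, root (map_poly b m) s.
  apply: finField_dvd_root.
    have : m %| 'X^#|F| - 'X by apply: dvd; rewrite XnE FE finField_exprX subrr.
    by rewrite -(dvdp_map b) rmorphB /= map_polyXn map_polyX.
  rewrite size_map_poly ltnNge; apply/negP => /size1_polyC mE.
  move: evm m0; rewrite mE /ev map_polyC hornerC => /eqP; rewrite fmorph_eq0.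
  by rewrite polyC_eq0 => ->.
pose ev' (g : {poly k}) := (map_poly b g).[s].
have ev0 g : ev g = 0 -> ev' g = 0.
  move=> /dvd/dvdpP[u ->]; rewrite /ev' rmorphM hornerM.
  by move/eqP: sroot => ->; rewrite mulr0.
have surj x : exists g, ev g = x.
  have [->|/tgen[i ->]] := eqVneq x 0.
    by exists 0; rewrite /ev rmorph0 horner0.
  by exists 'X^i; rewrite /ev map_polyXn hornerXn.
pose phi x := ev' (sval (cid (surj x))).
have phiE g : phi (ev g) = ev' g.
  apply/eqP; rewrite -subr_eq0 /phi; case: cid => h /= hE.
  by apply/eqP; rewrite /ev' -hornerN -hornerD -!rmorphB; apply: ev0; rewrite evB hE subrr.
have phiB : zmod_morphism phi.
  move=> x y; have [g <-] := surj x; have [h <-] := surj y.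
  by rewrite -evB !phiE /ev' rmorphB hornerD hornerN.
have phiM : monoid_morphism phi.
  split.
    have -> : 1 = ev 1 by rewrite /ev rmorph1 hornerC.
    by rewrite phiE /ev' rmorph1 hornerC.
  move=> x y; have [g <-] := surj x; have [h <-] := surj y.
  by rewrite -evM !phiE /ev' rmorphM hornerM.
pose phi' : {rmorphism E -> F} := HB.pack phi
  (GRing.isZmodMorphism.Build _ _ _ phiB) (GRing.isMonoidMorphism.Build _ _ _ phiM).
exists phi' => c /=.
have -> : a c = ev c%:P by rewrite /ev map_polyC hornerC.
by rewrite phiE /ev' map_polyC hornerC.
Qed.

End FiniteFieldMorphisms.

Section GaloisFields.

Lemma card_GF (k : finFieldType) r : (0 < r)%N -> #|GF (#|k| ^ r)| = (#|k| ^ r)%N.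
Proof.
move=> r0; rewrite /GF; case: finite_field_exists => F /= ->//.
have [p p_pr pk] := finPcharP k.
have kE : #|k| = (p ^ logn p #|k|)%N := card_pprimeChar pk.
exists p, (logn p #|k| * r)%N; split=> //; last by rewrite {1}kE expnM.
rewrite muln_gt0 r0 andbT lt0n; apply/eqP => l0.
by have := card_finField_gt1 k; rewrite kE l0.
Qed.

(** [GF] is an arbitrarily chosen field of its order, so an embedding of k has to be built: the one
    of the prime field is extended to k. *)
Lemma GF_embedding (k : finFieldType) r : (0 < r)%N ->
  exists b : {rmorphism k -> GF (#|k| ^ r)}, True.
Proof.
move=> r0; have FE := card_GF k r0; set F := GF _ in FE *.
have [p p_pr pk] := finPcharP k.
have kE : #|k| = (p ^ logn p #|k|)%N := card_pprimeChar pk.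
have pF : p \in [pchar F].
  by apply: (@card_finPcharP _ p (logn p #|k| * r)) => //; rewrite FE {1}kE expnM.
pose a : {rmorphism 'F_p -> pPrimeCharType pk} := GRing.in_alg _.
pose b : {rmorphism 'F_p -> pPrimeCharType pF} := GRing.in_alg _.
by have [phi _] := finField_extend (a : {rmorphism 'F_p -> k})
  (b : {rmorphism 'F_p -> F}) FE; exists phi.
Qed.

(** From here on, indices n and r stand for matrices of size n.+1 over an extension of degree r.+1:
    positivity is built in, and the matrices form a nonzero ring. *)
Definition gf_emb (k : finFieldType) r : {rmorphism k -> GF (#|k| ^ r.+1)} :=
  sval (cid (GF_embedding k (ltn0Sn r))).

End GaloisFields.

Section CornerRing.
Variables (A : pzRingType) (e : A).

Definition corner_pred : {pred A} := [pred x | e * x * e == x].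

Fact corner_zmod_closed : zmod_closed corner_pred.
Proof.
split=> [|x y]; rewrite !inE; first by rewrite mulr0 mul0r.
by move=> /eqP xE /eqP yE; rewrite mulrBr mulrBl xE yE.
Qed.
HB.instance Definition _ := GRing.isZmodClosed.Build A corner_pred corner_zmod_closed.

Definition corner of e * e = e : Type := {x : A | x \in corner_pred}.

Variable ee : e * e = e.
HB.instance Definition _ := SubChoice.on (corner ee).
HB.instance Definition _ := [SubChoice_isSubZmodule of corner ee by <:].

Fact corner_subproof x : e * x * e \in corner_pred.
Proof. by rewrite inE !mulrA ee -!mulrA ee. Qed.
Definition to_corner (x : A) : corner ee := Sub (e * x * e) (corner_subproof x).

Lemma val_to_corner x : val (to_corner x) = e * x * e.
Proof. exact: SubK. Qed.

Lemma val_cornerD (x y : corner ee) : val (x + y) = val x + val y.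
Proof. by []. Qed.

Lemma val_cornerB (x y : corner ee) : val (x - y) = val x - val y.
Proof. by []. Qed.

Lemma val_corner_sum n (F : 'I_n -> corner ee) : val (\sum_i F i) = \sum_i val (F i).
Proof. exact: (big_morph _ val_cornerD). Qed.

Lemma cornerE (x : corner ee) : e * val x * e = val x.
Proof. by apply/eqP; have := valP x; rewrite inE. Qed.

Lemma corner_mulel (x : corner ee) : e * val x = val x.
Proof. by rewrite -cornerE !mulrA ee. Qed.

Lemma corner_muler (x : corner ee) : val x * e = val x.
Proof. by rewrite -cornerE -!mulrA ee. Qed.

Definition corner_mul (x y : corner ee) := to_corner (val x * val y).

Lemma val_corner_mul x y : val (corner_mul x y) = val x * val y.
Proof. by rewrite val_to_corner mulrA corner_mulel -mulrA corner_muler. Qed.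

Lemma val_corner1 : val (to_corner e) = e.
Proof. by rewrite val_to_corner !ee. Qed.

Fact corner_mulA : associative corner_mul.
Proof. by move=> x y z; apply: val_inj; rewrite !val_corner_mul mulrA. Qed.
Fact corner_mul1 : left_id (to_corner e) corner_mul.
Proof. by move=> x; apply: val_inj; rewrite val_corner_mul val_corner1 corner_mulel. Qed.
Fact corner_mulr1 : right_id (to_corner e) corner_mul.
Proof. by move=> x; apply: val_inj; rewrite val_corner_mul val_corner1 corner_muler. Qed.
Fact corner_mulDl : left_distributive corner_mul +%R.
Proof.
by move=> x y z; apply: val_inj; rewrite !(val_corner_mul, val_cornerD) mulrDl.
Qed.
Fact corner_mulDr : right_distributive corner_mul +%R.
Proof.
by move=> x y z; apply: val_inj; rewrite !(val_corner_mul, val_cornerD) mulrDr.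
Qed.
HB.instance Definition _ := GRing.Zmodule_isPzRing.Build (corner ee)
  corner_mulA corner_mul1 corner_mulr1 corner_mulDl corner_mulDr.

Lemma val_cornerM (x y : corner ee) : val (x * y) = val x * val y.
Proof. exact: val_corner_mul. Qed.

Lemma val_cornerI : val (1 : corner ee) = e.
Proof. exact: val_corner1. Qed.

Lemma to_cornerM x y : x * e = x -> e * y = y ->
  to_corner x * to_corner y = to_corner (x * y).
Proof.
move=> xe ey; apply: val_inj.
by rewrite val_cornerM !val_to_corner -(mulrA e x) xe ey !mulrA.
Qed.

Lemma to_cornerB x y : to_corner (x - y) = to_corner x - to_corner y.
Proof. by apply: val_inj; rewrite val_cornerB !val_to_corner mulrBr mulrBl. Qed.

Lemma to_corner_val x : to_corner (val x) = x.
Proof. by apply: val_inj; rewrite val_to_corner cornerE. Qed.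

End CornerRing.

(** * The simple factors as matrix algebras over extensions of k *)

Section Blocks.
Variables (k : finFieldType) (B : pzRingType) (rho : {rmorphism k -> B}).
Hypothesis rhoC : forall c b, rho c * b = b * rho c.

(** A simple factor, given by its projection instead of as a subring. The central idempotent
    [blk_unit] cuts it out: by [blk_ker] the projection is injective on the ideal it generates. The
    last field fixes the k-algebra structure. *)
Record block := Block {
  blk_n : nat;
  blk_r : nat;
  blk_proj : {rmorphism B -> 'M[GF (#|k| ^ blk_r.+1)]_blk_n.+1};
  blk_unit : B;
  blk_unitC : forall b, b * blk_unit = blk_unit * b;
  blk_unitK : blk_unit * blk_unit = blk_unit;
  blk_ker : forall b, blk_proj b = 0 <-> blk_unit * b = 0;
  blk_surj : forall X, exists b, blk_proj b = X;
  blk_scalar : forall c, blk_proj (rho c) = (gf_emb k blk_r c)%:M }.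

Lemma blk_proj_unit (z : block) : blk_proj z (blk_unit z) = 1.
Proof.
apply/eqP; rewrite eq_sym -subr_eq0 -(rmorph1 (blk_proj z)) -rmorphB; apply/eqP.
by apply/blk_ker; rewrite mulrBr mulr1 blk_unitK subrr.
Qed.

Lemma blk_unit_neq0 (z : block) : blk_unit z <> 0.
Proof.
move=> u0; have := blk_proj_unit z; rewrite u0 rmorph0 => /esym/eqP.
by rewrite oner_eq0.
Qed.

Hypotheses (fB : finite_set [set: B]) (spB : semiprime_ring B).

(** By Schur and Wedderburn e B e is a finite field over k. It is transported to the chosen field of
    its order in such a way that k embeds by [gf_emb]. *)
Lemma corner_field (e : B) (ee : e * e = e) : minimal_elt e ->
  exists (r : nat) (psi : {rmorphism corner ee -> GF (#|k| ^ r.+1)}),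
    bijective psi /\ forall c, psi (to_corner ee (rho c)) = gf_emb k r c.
Proof.
move=> me; have [e0 _] := me.
have fC : finite_set [set: corner ee].
  exact: (finite_setT_inj (f := fun x => val x)) fB val_inj.
have [|x x0|F0 [psi0 [psi' psiK psi'K]]] := finite_division_ring_field fC.
- by move=> /(congr1 (fun x => val x)); rewrite val_cornerI; exact: e0.
- have vx0 : val x <> 0 by move=> vx0; apply: x0; exact: val_inj.
  have [d de dx] := minimal_corner_inv ee me (cornerE x) vx0.
  exists (to_corner ee d); apply: val_inj.
  by rewrite val_cornerM val_to_corner de dx val_cornerI.
pose a c := psi0 (to_corner ee (rho c)).
have aB : zmod_morphism a by move=> x y; rewrite /a rmorphB to_cornerB rmorphB.
have aM : monoid_morphism a.
  split=> [|x y]; rewrite /a.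
    rewrite !rmorph1 -(rmorph1 psi0); congr (psi0 _); apply: val_inj.
    by rewrite val_to_corner mulr1 ee val_cornerI.
  rewrite -rmorphM; congr (psi0 _); apply: val_inj.
  rewrite val_cornerM !val_to_corner rmorphM.
  by rewrite !mulrA -(rhoC x e) -!mulrA !(mulrA e e, ee).
pose a' : {rmorphism k -> F0} := HB.pack a
  (GRing.isZmodMorphism.Build _ _ _ aB) (GRing.isMonoidMorphism.Build _ _ _ aM).
have [[//|r] _ F0E] := finField_morph_card a'; exists r.
have FE : #|GF (#|k| ^ r.+1)| = (#|F0| ^ 1)%N by rewrite card_GF // F0E expn1.
have [phi phia] := finField_extend a' (gf_emb k r) FE.
exists (phi \o psi0); split; last by move=> c; rewrite /= -phia.
apply: bij_comp; last by exists psi'.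
by apply: inj_card_bij; [exact: fmorph_inj|rewrite FE expn1].
Qed.

(** A maximal dual system gives a basis x_j of B e over the field e B e, and (y_i b x_j) is the
    matrix of left multiplication by b in this basis. The clause on ideals makes it possible to
    place the block inside a prescribed complement. *)
Lemma block_of_idempotent (e : B) : e * e = e -> minimal_elt e ->
  exists z : block, forall I, is_ideal I -> I e -> I (blk_unit z).
Proof.
move=> ee me; have [r [psi [[psi' psiK psi'K] psirho]]] := corner_field ee me.
have [n [x [y [sys el er]]]] := dual_system_max spB fB ee me.
have [epsK epsC] := dual_system_central sys el er.
set eps := \sum_(i < n) x i * y i in el er epsK epsC.
have [xe ye yx] := sys.
case: n => [|n] in sys eps el er epsK epsC xe ye yx.
  by case: me => -[]; rewrite -(el e) // /eps big_ord0 mul0r.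
pose F := GF (#|k| ^ r.+1).
pose p (b : B) : 'M[F]_n.+1 := \matrix_(i, j) psi (to_corner ee (y i * b * x j)).
have pB : zmod_morphism p.
  move=> b b'; apply/matrixP => i j; rewrite !mxE.
  by rewrite mulrBr mulrBl to_cornerB rmorphB.
have p1 : monoid_morphism p.
  split=> [|b b'].
    apply/matrixP => i j; rewrite !mxE mulr1 yx // -val_eqE /=.
    case: eqP => _ /=; last first.
      by rewrite mulr0n -(rmorph0 psi); congr (psi _); apply: val_inj;
         rewrite val_to_corner mulr0 mul0r.
    by rewrite mulr1n -(rmorph1 psi).
  apply/matrixP => i j; rewrite !mxE.
  transitivity (psi (\sum_(l < n.+1) to_corner ee (y i * b * x l) * to_corner ee (y l * b' * x j))).
    congr (psi _); apply: val_inj; rewrite val_corner_sum val_to_corner.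
    under eq_bigr => l _.
      rewrite to_cornerM ?val_to_corner; first over.
        by rewrite -mulrA xe.
      by rewrite !mulrA ye.
    rewrite -mulr_suml -mulr_sumr; congr (_ * _); congr (_ * _).
    transitivity (y i * b * eps * (b' * x j)).
      by rewrite -(mulrA (y i) b eps) epsC (mulrA (y i) eps) er ?ye // !mulrA.
    by rewrite mulr_sumr mulr_suml; apply: eq_bigr => l _; rewrite !mulrA.
  by rewrite rmorph_sum; apply: eq_bigr => l _; rewrite rmorphM !mxE.
pose p' : {rmorphism B -> 'M[F]_n.+1} := HB.pack p
  (GRing.isZmodMorphism.Build _ _ _ pB) (GRing.isMonoidMorphism.Build _ _ _ p1).
have psi0 z : psi z = 0 -> z = 0.
  by move=> h; apply: (can_inj psiK); rewrite h rmorph0.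
have pker b : p' b = 0 <-> eps * b = 0.
  split=> [pb|eb]; last first.
    apply/matrixP => i j; rewrite !mxE -(rmorph0 psi); congr (psi _).
    apply: val_inj; rewrite val_to_corner -(er (y i)) ?ye // -!mulrA (mulrA eps) eb.
    by rewrite mul0r !mulr0.
  have -> : eps * b = \sum_(i < n.+1) \sum_(j < n.+1) x i * (y i * b * x j) * y j.
    rewrite -epsK -mulrA -(epsC b) mulr_suml; apply: eq_bigr => i _.
    by rewrite !mulr_sumr; apply: eq_bigr => j _; rewrite !mulrA.
  rewrite big1 // => i _; rewrite big1 // => j _.
  have /matrixP/(_ i j) := pb; rewrite !mxE => /psi0/(congr1 (fun x => val x)).
  rewrite val_to_corner !mulrA ye // -[LHS]mulrA xe // => h.
  by rewrite -(mulrA (x i)) -(mulrA (x i)) h mulr0 mul0r.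
have psurj (X : 'M[F]_n.+1) : exists b, p' b = X.
  exists (\sum_(i < n.+1) \sum_(j < n.+1) x i * val (psi' (X i j)) * y j).
  apply/matrixP => i j; rewrite !mxE -[RHS]psi'K; congr (psi _).
  rewrite -[RHS]to_corner_val; congr (to_corner ee _).
  have yixl (l : 'I_n.+1) a : y i * (x l * a) = if l == i then e * a else 0.
    by rewrite mulrA yx // eq_sym val_eqE; case: eqP => // _; rewrite mul0r.
  have ylxj (l : 'I_n.+1) a : a * y l * x j = if l == j then a * e else 0.
    by rewrite -mulrA yx // val_eqE; case: eqP => // _; rewrite mulr0.
  rewrite mulr_sumr (bigD1 i) //= [X in _ + X]big1 ?addr0 => [|l li]; last first.
    by rewrite mulr_sumr big1 // => l' _; rewrite -mulrA yixl (negPf li).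
  rewrite mulr_sumr mulr_suml (bigD1 j) //= [X in _ + X]big1 ?addr0 => [|l lj]; last first.
    by rewrite mulrA ylxj (negPf lj).
  by rewrite mulrA ylxj eqxx yixl eqxx cornerE.
have pscal c : p' (rho c) = (gf_emb k r c)%:M.
  apply/matrixP => i j; rewrite !mxE -rhoC -mulrA yx // -val_eqE /=.
  case: eqP => _; last first.
    by rewrite mulr0 mulr0n -(rmorph0 psi); congr (psi _); apply: val_inj;
       rewrite val_to_corner mulr0 mul0r.
  rewrite mulr1n -psirho; congr (psi _); apply: val_inj; rewrite !val_to_corner.
  by rewrite -!mulrA !ee.
exists (Block epsC epsK pker psurj pscal) => I iI Ie /=.
apply: add_group_sum => [|i _]; first exact: ideal_add_group.
by rewrite -(xe _ (ltn_ord i)) -mulrA; apply: ideal_mull => //; apply: ideal_mulr.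
Qed.

Record wedderburn := Wedderburn {
  wed_s : nat;
  wed_blk : 'I_wed_s -> block;
  wed_orth : forall i j, i != j ->
    blk_unit (wed_blk i) * blk_unit (wed_blk j) = 0;
  wed_sum : \sum_i blk_unit (wed_blk i) = 1 }.

(** Take a longest family of orthogonal blocks. If the units do not add up to 1, their complement
    [eta] is a nonzero central idempotent; a minimal idempotent in its ideal gives a further block
    orthogonal to all others. *)
Lemma wedderburn_artin : exists w : wedderburn, True.
Proof.
have [N [g [g' gK g'K]]] := finite_set_enum fB.
pose orth n (z : 'I_n -> block) :=
  forall i j, i != j -> blk_unit (z i) * blk_unit (z j) = 0.
pose Q n := `[< exists z : 'I_n -> block, orth n z >].
have Q0 : exists n, Q n.
  exists 0%N; apply/asboolP.
  have z0 : 'I_0 -> block by case.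
  by exists z0; case.
have QN n : Q n -> (n <= N)%N.
  move=> /asboolP[z zo]; rewrite -(card_ord n) -(card_ord N).
  apply: (@leq_card _ _ (fun i : 'I_n => g' (blk_unit (z i)))) => i j /(can_inj g'K) uij.
  apply: contrapT => /eqP ij; apply: (@blk_unit_neq0 (z j)).
  by rewrite -blk_unitK -{1}uij zo.
case: (ex_maxnP Q0 QN) => n /asboolP[z zo] nmax.
pose eta := 1 - \sum_i blk_unit (z i).
have etaC b : b * eta = eta * b.
  rewrite mulrBr mulrBl mulr1 mul1r mulr_sumr mulr_suml.
  by congr (_ - _); apply: eq_bigr => i _; rewrite blk_unitC.
have etaz i : eta * blk_unit (z i) = 0.
  rewrite mulrBl mul1r mulr_suml (bigD1 i) //= blk_unitK big1 ?addr0 ?subrr //.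
  by move=> j ji; apply: zo.
have [eta0|eta0] := pselect (eta = 0).
  have sum1 : \sum_i blk_unit (z i) = 1.
    by apply/eqP; rewrite eq_sym -subr_eq0; apply/eqP.
  by exists (Wedderburn zo sum1).
have etaK : eta * eta = eta.
  rewrite {2}/eta mulrBr mulr1 mulr_sumr big1 ?subr0 // => i _; exact: etaz.
pose T : set B := [set b | eta * b = b].
have iT : is_ideal T.
  split; first split=> [|a b aT bT|a b bT].
  - by rewrite /T /= mulr0.
  - by rewrite /T /= mulrBr aT bT.
  - by rewrite /T /= mulrA -etaC -mulrA bT.
  - by move=> a b bT; rewrite /T /= mulrA bT.
have [|e [me ee Te]] := finite_left_ideal_idempotent (T := T) spB fB (fun a x => @ideal_mull _ _ a x iT).
  by exists eta.
have [z' z'I] := block_of_idempotent ee me.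
have Tz' : eta * blk_unit z' = blk_unit z' := z'I _ iT Te.
have oz' i : blk_unit z' * blk_unit (z i) = 0.
  by rewrite -Tz' -mulrA -blk_unitC mulrA etaz mul0r.
have /nmax : Q n.+1; last by rewrite ltnn.
apply/asboolP; exists (fun i => if unlift ord_max i is Some j then z j else z').
move=> i j; case: unliftP => [i' ->|->]; case: unliftP => [j' ->|->].
- by rewrite (inj_eq lift_inj); apply: zo.
- by rewrite -blk_unitC => _; apply: oz'.
- by move=> _; apply: oz'.
- by rewrite eqxx.
Qed.

Variable w : wedderburn.
Let z := @wed_blk w.

Lemma wed_proj_unit i j : blk_proj (z i) (blk_unit (z j)) = (i == j)%:R.
Proof.
have [->|ij] := eqVneq; first by rewrite blk_proj_unit.
by apply/blk_ker; rewrite wed_orth.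
Qed.

Lemma wed_inj b b' : (forall i, blk_proj (z i) b = blk_proj (z i) b') -> b = b'.
Proof.
move=> bb; apply/eqP; rewrite -subr_eq0 -[_ - _]mul1r -(wed_sum w) mulr_suml.
by rewrite big1 // => i _; apply/blk_ker; rewrite rmorphB bb subrr.
Qed.

Lemma wed_surj (X : forall i, 'M[GF (#|k| ^ (blk_r (z i)).+1)]_((blk_n (z i)).+1)) :
  exists b, forall i, blk_proj (z i) b = X i.
Proof.
pose b i := sval (cid (blk_surj (X i))).
exists (\sum_i blk_unit (z i) * b i) => i.
rewrite rmorph_sum (bigD1 i) //= big1 ?addr0 => [|j ji].
  by rewrite rmorphM wed_proj_unit eqxx mul1r; exact: (svalP (cid (blk_surj (X i)))).
by rewrite rmorphM wed_proj_unit eq_sym (negPf ji) mul0r.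
Qed.

End Blocks.

(** * Automorphisms and generating tuples of matrix rings over finite fields *)

Section MatrixRing.
Variables (F : fieldType) (n : nat).
Local Notation M := 'M[F]_n.+1.
Implicit Types (X Y : M) (i j l : 'I_n.+1).

Lemma delta_mx_conj X i j l l' :
  delta_mx l i * X * delta_mx j l' = X i j *: delta_mx l l' :> M.
Proof.
rewrite [X in _ * X * _]matrix_sum_delta mulr_sumr mulr_suml (bigD1 i) //=.
rewrite [X in _ + X]big1 ?addr0 => [|i' i'i]; last first.
  rewrite mulr_sumr mulr_suml big1 // => j' _.
  by rewrite -scalerAr -[_ * delta_mx i' j']/(_ *m _) mul_delta_mx_0 1?eq_sym //
    scaler0 mul0r.
rewrite mulr_sumr mulr_suml (bigD1 j) //= [X in _ + X]big1 ?addr0 => [|j' j'j].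
  by rewrite -scalerAr -scalerAl -!mulmxE !mul_delta_mx.
by rewrite -scalerAr -scalerAl -!mulmxE mul_delta_mx mul_delta_mx_0 ?scaler0.
Qed.

Lemma mx_ideal_full (I : set M) X : is_ideal I -> I X -> X <> 0 -> I 1.
Proof.
move=> iI IX X0; have [i [j Xij]] : exists i j, X i j != 0.
  apply: contrapT => /forallNP H; apply: X0; apply/matrixP => i j.
  by rewrite mxE; apply/eqP/negPn/negP => Xij; apply: (H i); exists j.
rewrite -[1]/(1%:M) mx1_sum_delta; apply: add_group_sum => [|l _].
  exact: ideal_add_group.
have -> : delta_mx l l = (X i j)^-1%:M * (delta_mx l i * X * delta_mx j l) :> M.
  by rewrite delta_mx_conj -mulmxE mul_scalar_mx scalerA mulVf // scale1r.
by apply: ideal_mull => //; apply: ideal_mulr => //; apply: ideal_mull.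
Qed.

Lemma mx_center X : (forall i j, X * delta_mx i j = delta_mx i j * X) ->
  X = (X ord0 ord0)%:M.
Proof.
move=> XC; apply/matrixP => i j; rewrite [RHS]mxE.
have : delta_mx ord0 i * X * delta_mx j ord0 * delta_mx ord0 ord0 =
    delta_mx ord0 i * delta_mx j ord0 * X * delta_mx ord0 ord0 :> M.
  by rewrite -(mulrA _ X) XC mulrA.
rewrite delta_mx_conj -[delta_mx ord0 i * _]/(_ *m _) mul_delta_mx_cond.
rewrite -scalerAl -[delta_mx _ _ * delta_mx _ _]/(_ *m _) mul_delta_mx.
case: eqP => _; last first.
  by rewrite !mulr0n !mul0r => /matrixP/(_ ord0 ord0); rewrite !mxE !eqxx mulr1.
rewrite !mulr1n delta_mx_conj => /matrixP/(_ ord0 ord0).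
by rewrite !mxE !eqxx !mulr1.
Qed.

Lemma scalar_mx_comm (a : F) X : a%:M * X = X * a%:M.
Proof. by rewrite -!mulmxE scalar_mxC. Qed.

End MatrixRing.

Section Frobenius.
Variables (k : finFieldType) (r : nat).
Local Notation q := #|k|.
Local Notation F := (GF (q ^ r.+1)).
Local Notation emb := (gf_emb k r).

Lemma gf_card : #|F| = (q ^ r.+1)%N.
Proof. exact: card_GF. Qed.

Lemma gf_exprD i (x y : F) : (x + y) ^+ (q ^ i) = x ^+ (q ^ i) + y ^+ (q ^ i).
Proof.
have [p p_pr pk] := finPcharP k.
have pF : p \in [pchar F] by rewrite (fmorph_pchar emb).
apply: exprDn_pchar; rewrite (eq_pnat _ (pcharf_eq pF)).
have kE : #|k| = (p ^ logn p #|k|)%N := card_pprimeChar pk.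
by rewrite kE -expnM pnatX pnat_id.
Qed.

Definition frob i (x : F) := x ^+ (q ^ i).

Lemma frob_zmod i : zmod_morphism (frob i).
Proof.
move=> x y; have <- : frob i (x - y) + frob i y = frob i x.
  by rewrite /frob -gf_exprD subrK.
by rewrite addrK.
Qed.
HB.instance Definition _ i := GRing.isZmodMorphism.Build F F (frob i) (frob_zmod i).

Lemma frob_monoid i : monoid_morphism (frob i).
Proof. by split=> [|x y]; rewrite /frob ?expr1n ?exprMn. Qed.
HB.instance Definition _ i := GRing.isMonoidMorphism.Build F F (frob i) (frob_monoid i).

Lemma frob_emb i c : frob i (emb c) = emb c.
Proof. by rewrite /frob -rmorphXn finField_exprX. Qed.

Lemma gf_emb_fixed (c : F) : reflect (exists x, emb x = c) (c ^+ q == c).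
Proof.
apply: (iffP eqP) => [cq|[x <-]]; last by rewrite -rmorphXn expf_card.
apply: contrapT => nc; have q1 : (1 < q)%N := card_finField_gt1 k.
have sz : size ('X^q - 'X : {poly F}) = q.+1.
  by rewrite size_polyDl size_polyXn // size_polyN size_polyX.
have nz : 'X^q - 'X != 0 :> {poly F} by rewrite -size_poly_eq0 sz.
have := @max_poly_roots _ _ (c :: [seq emb x | x <- enum k]) nz.
rewrite sz /= size_map -cardE ltnn => H; suff : false by []; apply: H.
  rewrite /root !hornerE cq subrr eqxx /=; apply/allP => _ /mapP[x _ ->].
  by rewrite /root !hornerE -rmorphXn expf_card subrr.
rewrite map_inj_uniq ?enum_uniq ?andbT; last exact: fmorph_inj.
by apply/mapP => -[x _ cE]; apply: nc; exists x.
Qed.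

Lemma frob_inj_index i j : (i <= r)%N -> (j <= r)%N -> frob i =1 frob j -> i = j.
Proof.
wlog ij : i j / (i <= j)%N => [H hi hj e|hi hj e].
  by case: (leqP i j) => [/H|/ltnW/H]; [exact|move=> h; apply/esym/h => // x; rewrite e].
apply/eqP; rewrite eqn_leq ij leqNgt; apply/negP => lt_ij.
have fixd (x : F) : x ^+ (q ^ (j - i)) = x.
  apply: (fmorph_inj (frob i)).
  by change ((x ^+ (q ^ (j - i))) ^+ (q ^ i) = frob i x); rewrite -exprM -expnD subnK // e.
have q1 : (1 < q)%N := card_finField_gt1 k.
have := card_field_fixed fixd; rewrite gf_card leq_exp2l //.
rewrite -[X in (X < _)%N -> _](expn0 q) ltn_exp2l // subn_gt0 => /(_ lt_ij).
by rewrite leqNgt ltnS (leq_trans (leq_subr _ _)).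
Qed.

(* The orbit polynomial of a generator has coefficients fixed by [frob 1]. *)
Lemma gf_automorphism (s : {rmorphism F -> F}) : (forall c, s (emb c) = emb c) ->
  exists2 i, (i <= r)%N & s =1 frob i.
Proof.
move=> sE; have [t tgen] := finField_generator F.
pose g : {poly F} := \prod_(i < r.+1) ('X - (frob i t)%:P).
have frobS i x : frob 1 (frob i x) = frob i.+1 x by rewrite /frob -exprM expn1 -(expnSr q i).
have frobr x : frob r.+1 x = frob 0 x.
  by have := expf_card x; rewrite gf_card /frob expn0 expr1.
have gfix : map_poly (frob 1) g = g.
  rewrite /g rmorph_prod /=.
  under eq_bigr => i _ do rewrite rmorphB /= map_polyX map_polyC /= frobS.
  by rewrite big_ord_recr big_ord_recl /= mulrC frobr.
have gs : map_poly s g = g.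
  apply/polyP => i; rewrite coef_map /=.
  have : (frob 1) g`_i = g`_i by rewrite -[in RHS]gfix coef_map.
  by rewrite /frob expn1 => /eqP/gf_emb_fixed[c <-]; rewrite sE.
have : root (map_poly s g) (s t).
  rewrite /root horner_map /= /g horner_prod big_ord_recl /= hornerXsubC.
  by rewrite /frob expn0 expr1 subrr mul0r rmorph0.
rewrite gs /g /root horner_prod => /prodf_eq0[i _].
rewrite hornerXsubC subr_eq0 => /eqP st.
exists (val i); first by rewrite -ltnS ltn_ord.
move=> x; have [->|/tgen[m ->]] := eqVneq x 0; first by rewrite !rmorph0.
by rewrite !rmorphXn /= st.
Qed.

End Frobenius.

Section MatrixIsomorphisms.
Variable k : finFieldType.
Local Notation q := #|k|.
Local Notation "''MF' ( n , r )" := 'M[GF (q ^ r.+1)]_n.+1 (format "''MF' ( n ,  r )").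

(** The isomorphisms of k-algebras. Source and target may have different shapes, so that blocks can
    be compared before their shapes are known to agree. *)
Record mx_iso n r n' r' (phi : 'MF(n, r) -> 'MF(n', r')) : Prop := MxIso {
  mx_iso_bij : bijective phi;
  mx_isoB : {morph phi : x y / x - y};
  mx_isoM : {morph phi : x y / x * y};
  mx_iso_emb : forall c, phi (gf_emb k r c)%:M = (gf_emb k r' c)%:M }.

Lemma mx_iso_inv n r n' r' (phi : 'MF(n, r) -> 'MF(n', r')) : mx_iso phi ->
  exists psi, [/\ mx_iso psi, cancel phi psi & cancel psi phi].
Proof.
move=> [[psi phiK psiK] phiB phiM phie]; exists psi; split=> //; split.
- by exists phi.
- by move=> x y; apply: (can_inj phiK); rewrite phiB !psiK.
- by move=> x y; apply: (can_inj phiK); rewrite phiM !psiK.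
- by move=> c; apply: (can_inj phiK); rewrite phie psiK.
Qed.

Lemma mx_iso_comp n r n' r' n'' r'' (psi : 'MF(n', r') -> 'MF(n'', r''))
    (phi : 'MF(n, r) -> 'MF(n', r')) : mx_iso psi -> mx_iso phi -> mx_iso (psi \o phi).
Proof.
move=> [bp pB pM pe] [bp' pB' pM' pe']; split=> [|x y|x y|c] /=.
- exact: bij_comp.
- by rewrite pB' pB.
- by rewrite pM' pM.
- by rewrite pe' pe.
Qed.

Lemma mx_iso1 n r n' r' (phi : 'MF(n, r) -> 'MF(n', r')) : mx_iso phi -> phi 1 = 1.
Proof. by move=> hp; have := mx_iso_emb hp 1; rewrite !rmorph1. Qed.

Lemma mx_iso_rmorphism n r n' r' (phi : 'MF(n, r) -> 'MF(n', r')) : mx_iso phi ->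
  exists f : {rmorphism 'MF(n, r) -> 'MF(n', r')}, f =1 phi.
Proof.
move=> hp; have pB : zmod_morphism phi by exact: mx_isoB hp.
have pM : monoid_morphism phi by split; [exact: mx_iso1|exact: mx_isoM hp].
by exists (HB.pack_for {rmorphism 'MF(n, r) -> 'MF(n', r')} phi
  (GRing.isZmodMorphism.Build _ _ _ pB) (GRing.isMonoidMorphism.Build _ _ _ pM)).
Qed.

Lemma mx_mul_bij_scalar n r n' r' (phi : 'MF(n, r) -> 'MF(n', r')) a :
  bijective phi -> {morph phi : x y / x * y} -> phi a%:M = (phi a%:M ord0 ord0)%:M.
Proof.
move=> [psi _ psiK] phiM; apply: mx_center => i j.
by rewrite -(psiK (delta_mx i j)) -!phiM scalar_mx_comm.
Qed.

(** Central elements, that is scalars, correspond in both directions, which gives r = r'; counting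
    all matrices then gives n = n'. *)
Lemma mx_mul_bij_dims n r n' r' (phi : 'MF(n, r) -> 'MF(n', r')) :
  bijective phi -> {morph phi : x y / x * y} -> n = n' /\ r = r'.
Proof.
have q1 : (1 < q)%N := card_finField_gt1 k.
have le n1 r1 n2 r2 (f : 'MF(n1, r1) -> 'MF(n2, r2)) :
    bijective f -> {morph f : x y / x * y} -> (r1 <= r2)%N.
  move=> bf fM; rewrite -ltnS -(leq_exp2l _ _ q1) -(card_GF k (ltn0Sn r1)).
  rewrite -(card_GF k (ltn0Sn r2)).
  apply: (@leq_card _ _ (fun a => f a%:M ord0 ord0)) => a b ab.
  have /(bij_inj bf) /matrixP/(_ ord0 ord0) : f a%:M = f b%:M.
    by rewrite (mx_mul_bij_scalar a bf) // (mx_mul_bij_scalar b bf) // ab.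
  by rewrite !mxE eqxx.
move=> bp phiM; have [psi phiK psiK] := bp.
have bq : bijective psi by exists phi.
have psiM : {morph psi : x y / x * y}.
  by move=> x y; apply: (can_inj phiK); rewrite phiM !psiK.
have rr : r = r' by apply/eqP; rewrite eqn_leq (le _ _ _ _ _ bp) // (le _ _ _ _ _ bq).
split=> //; have := bij_eq_card bp.
rewrite !card_mx !card_GF // -rr -!expnM => /eqP.
by rewrite eqn_exp2l // eqn_pmul2l // !mulnn eqn_sqr => /eqP[].
Qed.

Variables (n r : nat).
Local Notation F := (GF (q ^ r.+1)).
Local Notation M := 'MF(n, r).

(** On scalars phi is a power of Frobenius. Choose v nonzero in the image of phi(E_00) and let U
    have the columns phi(E_b0) v; then phi(X) U = U X', where X' is the entrywise Frobenius image of
    X. If U x = 0, then applying phi(E_0b) gives x_b v = 0, so U is invertible. *)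
Lemma skolem_noether (phi : M -> M) : mx_iso phi ->
  exists U i, [/\ U \is a GRing.unit, (i <= r)%N &
    forall X, phi X = U * map_mx (@frob k r i) X * U^-1].
Proof.
move=> hp; have [f fphi] := mx_iso_rmorphism hp.
pose s a := f a%:M ord0 ord0.
have fs a : f a%:M = (s a)%:M by rewrite /s !fphi; exact: mx_mul_bij_scalar (mx_iso_bij hp) (mx_isoM hp).
have sB : zmod_morphism s by move=> a b; rewrite /s !rmorphB mxE [in X in _ + X]mxE.
have sM : monoid_morphism s.
  split=> [|a b]; first by rewrite /s !rmorph1 mxE eqxx.
  by rewrite {1}/s rmorphM rmorphM /= fs fs -mulmxE -scalar_mxM mxE eqxx mulr1n.
pose s' : {rmorphism F -> F} := HB.pack s
  (GRing.isZmodMorphism.Build _ _ _ sB) (GRing.isMonoidMorphism.Build _ _ _ sM).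
have [|i ir sE] := @gf_automorphism k r s'.
  by move=> c; rewrite /= /s fphi (mx_iso_emb hp) mxE eqxx.
have E00 : f (delta_mx ord0 ord0) <> 0.
  rewrite fphi -[0](rmorph0 f) fphi => /(bij_inj (mx_iso_bij hp))/matrixP/(_ ord0 ord0).
  by rewrite !mxE !eqxx => /eqP; rewrite oner_eq0.
have [j E00j] : exists j, f (delta_mx ord0 ord0) *m delta_mx j (ord0 : 'I_1) <> 0.
  apply: contrapT => /forallNP H; apply: E00; apply/matrixP => l j.
  have := H j => /contrapT/matrixP/(_ l ord0); rewrite -colE !mxE.
  by [].
pose v := f (delta_mx ord0 ord0) *m delta_mx j (ord0 : 'I_1).
pose U : M := \matrix_(a, b) (f (delta_mx b ord0) *m v) a ord0.
have Ucol b : col b U = f (delta_mx b ord0) *m v.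
  by apply/colP => a; rewrite !mxE.
have fdelta a b c d : f (delta_mx a b) *m f (delta_mx c d) = f (delta_mx a d) *+ (b == c).
  by rewrite mulmxE -rmorphM /= -mulmxE mul_delta_mx_cond rmorphMn.
have v0 : f (delta_mx ord0 ord0) *m v = v.
  by rewrite mulmxA fdelta eqxx.
have fU X : f X * U = U * map_mx (@frob k r i) X.
  rewrite {1}(matrix_sum_delta X) rmorph_sum /= mulr_suml.
  apply/matrixP => a c; rewrite mxE.
  transitivity ((\sum_b (frob i (X b c)) *: f (delta_mx b ord0) *m v) a ord0); last first.
    rewrite summxE; apply: eq_bigr => b _; rewrite -scalemxAl mxE mulrC !mxE.
    by congr (_ * _); rewrite mxE.
  have -> : forall A : M, A a c = (col c A) a ord0 by move=> A; rewrite mxE.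
  congr (fun_of_matrix _ a ord0); rewrite colE mulmx_suml.
  apply: eq_bigr => b _; rewrite rmorph_sum /= -mulmxE mulmx_suml mulmx_suml.
  rewrite (bigD1 c) //= [X in _ + X]big1 ?addr0 => [|d dc].
    rewrite -mulmxA -colE Ucol -mul_scalar_mx mulmxE rmorphM /= fs -mulmxE.
    by rewrite mul_scalar_mx mulmxA -scalemxAl fdelta eqxx -sE.
  rewrite -mulmxA -colE Ucol -mul_scalar_mx mulmxE rmorphM /= fs -!mulmxE.
  by rewrite mulmxA -(mulmxA _%:M) fdelta (negPf dc) mulmx0 mul0mx.
have Uu : U \is a GRing.unit.
  change (is_true (U \in unitmx)); rewrite -unitmx_tr -row_free_unit -kermx_eq0.
  apply/rowV0P => w /sub_kermxP wU; pose x := w^T.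
  have Ux : U *m x = 0 by apply: trmx_inj; rewrite trmx_mul trmxK wU trmx0.
  suff x0 : x = 0 by apply: trmx_inj; rewrite -/x x0 trmx0.
  apply/colP => b; rewrite [RHS]mxE.
  have : f (delta_mx ord0 b) *m (U *m x) = 0 by rewrite Ux mulmx0.
  rewrite mulmxA mulmxE fU -mulmxE => h.
  have xb : (x b ord0) *: v = 0.
    rewrite -h -mulmxA.
    have -> : map_mx (@frob k r i) (delta_mx ord0 b) = delta_mx ord0 b :> M.
      by apply/matrixP => c d; rewrite !mxE rmorph_nat.
    have -> : delta_mx ord0 b *m x = (x b ord0) *: delta_mx ord0 ord0 :> 'cV_n.+1.
      apply/colP => c; rewrite !mxE (bigD1 b) //= big1 => [|d db].
        by rewrite !mxE eqxx andbT addr0 mulrC; case: (c == ord0); rewrite ?andbT.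
      by rewrite mxE (negPf db) andbF mul0r.
    by rewrite -scalemxAr -colE Ucol v0.
  by move/eqP: xb; rewrite scaler_eq0 => /orP[/eqP //|/eqP /E00j].
exists U, i; split=> // X; rewrite -fphi -[LHS]mulr1 -(mulrV Uu) mulrA fU.
by [].
Qed.

End MatrixIsomorphisms.

Section AutomorphismCount.
Variables (k : finFieldType) (n r : nat).
Local Notation q := #|k|.
Local Notation F := (GF (q ^ r.+1)).
Local Notation M := 'M[F]_n.+1.

Definition mx_aut : {set {ffun M -> M}} := [set phi : {ffun M -> M} | `[< mx_iso phi >]]%SET.

Definition conj_frob (x : {'GL_n.+1[F]} * 'I_r.+1) : {ffun M -> M} :=
  [ffun X => GLval x.1 * map_mx (@frob k r x.2) X * (GLval x.1)^-1].

Lemma conj_frob_iso x : mx_iso (conj_frob x).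
Proof.
case: x => U i; have Uu := GL_unit U.
have Ui : (GLval U)^-1 \is a GRing.unit by rewrite unitrV.
split=> [|X Y|X Y|c]; rewrite ?ffunE /=.
- apply: injF_bij => X Y; rewrite !ffunE /= => /(mulIr Ui)/(mulrI Uu).
  move=> /matrixP h; apply/matrixP => a b; have := h a b; rewrite !mxE.
  exact: fmorph_inj.
- by rewrite rmorphB mulrBr mulrBl.
- by rewrite rmorphM !mulrA mulrVK.
- by rewrite map_scalar_mx /= frob_emb -scalar_mx_comm -mulrA mulrV // mulr1.
Qed.

Lemma conj_frob_eq U V i j : conj_frob (U, i) = conj_frob (V, j) ->
  i = j /\ (V^-1 * U)%g \in ('Z('GL_n.+1[F]))%g.
Proof.
move=> /ffunP h; have Uu := GL_unit U; have Vu := GL_unit V.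
have Ui : (GLval U)^-1 \is a GRing.unit by rewrite unitrV.
have h' X : GLval U * map_mx (@frob k r i) X * (GLval U)^-1 =
    GLval V * map_mx (@frob k r j) X * (GLval V)^-1.
  by have := h X; rewrite !ffunE.
have ij : i = j.
  apply/val_inj/(@frob_inj_index k r); try by rewrite -ltnS ltn_ord.
  move=> a; have := h' a%:M; rewrite !map_scalar_mx /=.
  rewrite -(scalar_mx_comm (frob i a)) -(scalar_mx_comm (frob j a)).
  rewrite -!mulrA !mulrV // !mulr1 => /matrixP/(_ ord0 ord0).
  by rewrite !mxE eqxx !mulr1n.
split=> //; rewrite -{j}ij in h h' *.
have comm X : GLval (V^-1 * U)%g * X = X * GLval (V^-1 * U)%g.
  have [Y ->] : exists Y, X = map_mx (@frob k r i) Y.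
    have [g _ gK] : bijective (@frob k r i) by apply: injF_bij; exact: fmorph_inj.
    by exists (map_mx g X); apply/matrixP => a b; rewrite !mxE gK.
  rewrite GL_ME GL_VE; apply: (mulrI Vu); apply: (mulIr Ui).
  rewrite !mulrA mulrV // mul1r h' -!mulrA mulrV // mulr1.
  by [].
by apply/centerP; split=> [|W _]; [rewrite inE|apply: val_inj; exact: comm].
Qed.

(** Commuting with the transvections 1 + E_ij means commuting with E_ij for i != j. Each E_ii is a
    product E_il E_li of such units, except in size one, where it is 1. *)
Lemma GL_center_comm Z X : Z \in ('Z('GL_n.+1[F]))%g -> GLval Z * X = X * GLval Z.
Proof.
move=> /centerP[_ ZC].
have ZCu (Y : M) : Y \is a GRing.unit -> GLval Z * Y = Y * GLval Z.
  move=> Yu; pose Y' : {'GL_n.+1[F]} := Sub Y Yu.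
  have := ZC Y'; rewrite inE => /(_ isT)/(congr1 val).
  by rewrite /= -[Y]/(GLval Y').
have ZCoff i j : i != j -> GLval Z * delta_mx i j = delta_mx i j * GLval Z.
  move=> ij; have : 1 + delta_mx i j \is a @GRing.unit M.
    apply/unitrP; exists (1 - delta_mx i j).
    have d2 : delta_mx i j * delta_mx i j = 0 :> M.
      by rewrite -mulmxE mul_delta_mx_0 // eq_sym.
    split; first by rewrite mulrBl mul1r mulrDr mulr1 d2 addr0 addrK.
    by rewrite mulrDl mul1r mulrBr mulr1 d2 subr0 subrK.
  move/ZCu; rewrite mulrDr mulrDl mulr1 mul1r.
  by move/addrI.
have ZCd i j : GLval Z * delta_mx i j = delta_mx i j * GLval Z.
  have [<-|] := eqVneq i j; last exact: ZCoff.
  have [[l il]|noi] := pselect (exists l, i != l).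
    have -> : delta_mx i i = delta_mx i l * delta_mx l i :> M by rewrite -mulmxE mul_delta_mx.
    by rewrite mulrA ZCoff // -mulrA ZCoff 1?eq_sym // mulrA.
  have -> : delta_mx i i = 1 :> M; last by rewrite mulr1 mul1r.
  rewrite -[1]/(1%:M) mx1_sum_delta (bigD1 i) //= big1 ?addr0 // => l li.
  by case: noi; exists l; rewrite eq_sym.
rewrite (matrix_sum_delta X) mulr_sumr mulr_suml; apply: eq_bigr => i _.
rewrite mulr_sumr mulr_suml; apply: eq_bigr => j _.
by rewrite -scalerAr -scalerAl ZCd.
Qed.

(** [conj_frob] maps GL x {0..r} onto the automorphisms by Skolem-Noether, and its fibres are cosets
    of the centre of GL. *)
Lemma card_mx_aut : #|mx_aut| = (r.+1 * PGL_card n.+1 F)%N.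
Proof.
pose Z := ('Z('GL_n.+1[F]))%g.
have cZ : (0 < #|Z|)%N by apply: cardG_gt0.
have -> : PGL_card n.+1 F = (#|('GL_n.+1[F])%g| %/ #|Z|)%N.
  rewrite /PGL_card card_quotient ?divgS ?center_sub //.
  by apply: normal_norm; exact: center_normal.
apply/eqP; rewrite -(eqn_pmul2r cZ) -mulnA divnK ?cardSg ?center_sub //.
have <- : #|[set: {'GL_n.+1[F]} * 'I_r.+1]%SET| = (r.+1 * #|('GL_n.+1[F])%g|)%N.
  by rewrite !cardsT card_prod card_ord mulnC.
rewrite eq_sym -[X in X == _]sum1_card (partition_big conj_frob (mem mx_aut)) /=; last first.
  by move=> x _; rewrite !inE; exact: conj_frob_iso.
rewrite -sum_nat_const; apply/eqP/eq_bigr => phi.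
rewrite inE => /asboolP/skolem_noether[U [i [Uu ir phiE]]].
pose U' : {'GL_n.+1[F]} := Sub U Uu; pose i' : 'I_r.+1 := Ordinal (ir : (i < r.+1)%N).
have phi' : conj_frob (U', i') = phi by apply/ffunP => X; rewrite ffunE /= phiE.
rewrite sum1_card -(card_in_imset (f := fun z => (U' * z, i')%g) (D := mem Z)); last first.
  by move=> z z' _ _ /(congr1 fst) /mulgI.
apply: eq_card => -[V j]; rewrite unfold_in /= finset.in_setT /=.
apply/eqP/imsetP => [e|[z zZ [-> ->]]].
  have [ji VU] := conj_frob_eq (etrans e (esym phi')); exists (U'^-1 * V)%g => //.
  by rewrite ji mulgA mulgV mul1g.
rewrite -phi'; apply/ffunP => X; rewrite !ffunE; set Y := map_mx _ X.
change (GLval (U' * z)%g * Y * (GLval (U' * z)%g)^-1 = GLval U' * Y * (GLval U')^-1).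
rewrite GL_ME.
have zu := GL_unit z; have Vu : GLval U' \is a GRing.unit := Uu.
by rewrite invrM // !mulrA -(mulrA (GLval U')) (GL_center_comm _ zZ) !mulrA mulrK.
Qed.

End AutomorphismCount.

Lemma PGL_card_gt0 n (F : finFieldType) : (0 < PGL_card n.+1 F)%N.
Proof. exact: cardG_gt0. Qed.

(** * Generating tuples up to isomorphism *)

Section GeneratingTuples.
Variable k : finFieldType.
Local Notation q := #|k|.
Local Notation "''MF' ( n , r )" := 'M[GF (q ^ r.+1)]_n.+1 (format "''MF' ( n ,  r )").

Definition mx_scalars n r : set 'MF(n, r) := [set X | exists c, X = (gf_emb k r c)%:M].

Definition mx_generating n r (t : seq 'MF(n, r)) :=
  subring_gen (@mx_scalars n r `|` [set` t]) = setT.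

Lemma subGF_emb r (c : GF (q ^ r.+1)) : (c \in @subGF q r.+1) = `[< exists x, gf_emb k r x = c >].
Proof. by rewrite inE; apply/gf_emb_fixed/asboolP. Qed.

Lemma mx_generatingE n r (t : seq 'MF(n, r)) :
  generates *:%R (@subGF q r.+1) setT t <-> mx_generating t.
Proof.
rewrite /generates /mx_generating.
suff -> : smallest (is_subalgebra *:%R (@subGF q r.+1)) [set` t] =
    subring_gen (@mx_scalars n r `|` [set` t]) by [].
apply/seteqP; split=> X.
  apply; split; last by move=> Y Yt; apply: subring_gen_in; right.
  split; [exact: subring_gen1|exact: subring_genB|exact: subring_genM|].
  move=> c Y; rewrite subGF_emb => /asboolP[x <-] gY.
  rewrite -mul_scalar_mx; apply: subring_genM => //.
  by apply: subring_gen_in; left; exists x.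
move=> gX S /= [[S1 SB SM SZ] tS]; elim: gX => {X} //.
- move=> X [[c ->]|Xt]; last exact: tS.
  rewrite -scalemx1; apply: SZ => //; rewrite subGF_emb; apply/asboolP.
  by exists c.
- by move=> X Y _ ? _ ?; apply: SB.
- by move=> X Y _ ? _ ?; apply: SM.
Qed.

Definition mx_gen_tuples m n r : {set m.-tuple 'MF(n, r)} :=
  [set t : m.-tuple 'MF(n, r) | `[< mx_generating t >]]%SET.

Lemma num_generating_tuplesE m n r :
  num_generating_tuples m n.+1 q r.+1 = #|mx_gen_tuples m n r|.
Proof.
rewrite /num_generating_tuples; apply: eq_card => t; rewrite !inE.
by apply/asboolP/asboolP => /mx_generatingE.
Qed.

Definition mx_linked m n r n' r' (t : m.-tuple 'MF(n, r)) (t' : m.-tuple 'MF(n', r')) :=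
  exists2 phi : 'MF(n, r) -> 'MF(n', r'), mx_iso phi & map phi t = t'.

Lemma mx_iso_generating n r (phi : 'MF(n, r) -> 'MF(n, r)) (t : seq 'MF(n, r)) :
  mx_iso phi -> mx_generating t -> mx_generating (map phi t).
Proof.
move=> hp gt; apply/seteqP; split=> // Y _.
have [psi [_ phiK psiK]] := mx_iso_inv hp; rewrite -(psiK Y).
have : subring_gen (@mx_scalars n r `|` [set` t]) (psi Y) by rewrite gt.
elim=> {Y} [X [[c ->]|Xt]||X Y _ gX _ gY|X Y _ gX _ gY].
- by rewrite (mx_iso_emb hp); apply: subring_gen_in; left; exists c.
- by apply: subring_gen_in; right; rewrite /= map_f.
- by rewrite (mx_iso1 hp); exact: subring_gen1.
- by rewrite (mx_isoB hp); apply: subring_genB.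
- by rewrite (mx_isoM hp); apply: subring_genM.
Qed.

Lemma mx_iso_eq_on_generators n r n' r' (phi psi : 'MF(n, r) -> 'MF(n', r'))
    (t : seq 'MF(n, r)) : mx_iso phi -> mx_iso psi -> mx_generating t ->
  map phi t = map psi t -> phi =1 psi.
Proof.
move=> hp hq gt /eq_in_map e X.
have : subring_gen (@mx_scalars n r `|` [set` t]) X by rewrite gt.
elim=> {X} [X [[c ->]|/e //]||X Y _ gX _ gY|X Y _ gX _ gY].
- by rewrite (mx_iso_emb hp) (mx_iso_emb hq).
- by rewrite (mx_iso1 hp) (mx_iso1 hq).
- by rewrite (mx_isoB hp) (mx_isoB hq) gX gY.
- by rewrite (mx_isoM hp) (mx_isoM hq) gX gY.
Qed.

(** The map (i, phi) -> phi(T i) into the generating tuples is injective: the orbits of unlinked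
    tuples are disjoint, and an automorphism is determined by its values on generators. *)
Lemma unlinked_tuples_bound m n r N (T : 'I_N -> m.-tuple 'MF(n, r)) :
  (forall i, mx_generating (T i)) -> (forall i j, mx_linked (T i) (T j) -> i = j) ->
  (N * (r.+1 * PGL_card n.+1 (GF (q ^ r.+1))) <= num_generating_tuples m n.+1 q r.+1)%N.
Proof.
move=> Tg Tu; rewrite num_generating_tuplesE -card_mx_aut -{1}(card_ord N) -cardsT -cardsX.
pose G (x : 'I_N * {ffun 'MF(n, r) -> 'MF(n, r)}) := map_tuple x.2 (T x.1).
have Ginj : {in finset.setX [set: 'I_N]%SET (mx_aut k n r) &, injective G}.
  move=> [i f] [j g]; rewrite !inE /= => hf hg /(congr1 val) /= e.
  have [g' [hg' gK g'K]] := mx_iso_inv hg.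
  have ij : i = j.
    apply: Tu; exists (g' \o f); first exact: mx_iso_comp.
    by rewrite map_comp e -map_comp -[RHS]map_id; apply: eq_map.
  congr (_, _) => //; apply/ffunP; apply: (mx_iso_eq_on_generators hf hg (Tg i)).
  by rewrite e ij.
rewrite -(card_in_imset Ginj); apply/subset_leq_card/fintype.subsetP => t /imsetP[[i f]].
rewrite !inE /= => hf ->; apply: mx_iso_generating => //.
Qed.

(** A greedy choice: the orbits of the tuples already chosen do not exhaust the generating tuples,
    and one outside them is linked to none. *)
Lemma choose_unlinked_tuples m n r N :
  (N * (r.+1 * PGL_card n.+1 (GF (q ^ r.+1))) <= num_generating_tuples m n.+1 q r.+1)%N ->
  exists T : 'I_N -> m.-tuple 'MF(n, r),
    (forall i, mx_generating (T i)) /\ forall i j, mx_linked (T i) (T j) -> i = j.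
Proof.
rewrite num_generating_tuplesE -card_mx_aut.
have sym (t t' : m.-tuple 'MF(n, r)) : mx_linked t t' -> mx_linked t' t.
  move=> [f hf ft]; have [g [hg fK gK]] := mx_iso_inv hf; exists g => //.
  by rewrite -ft -map_comp -[RHS]map_id; apply: eq_map.
elim: N => [_|N IH le].
  by exists (fun=> [tuple of nseq m 0]); split; case.
have [|T [Tg Tu]] := IH; first by apply: leq_trans le; rewrite leq_mul2r leqnSn orbT.
pose G (x : 'I_N * {ffun 'MF(n, r) -> 'MF(n, r)}) := map_tuple x.2 (T x.1).
pose X := (G @: finset.setX [set: 'I_N]%SET (mx_aut k n r))%SET.
have cX : (#|X| < #|mx_gen_tuples m n r|)%N.
  apply: leq_trans le; rewrite mulSn -add1n leq_add //.
    rewrite card_mx_aut muln_gt0 /=; exact: PGL_card_gt0.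
  by rewrite (leq_trans (leq_imset_card _ _)) // cardsX cardsT card_ord.
have [t tg tX] : exists2 t, t \in mx_gen_tuples m n r & t \notin X.
  apply: contrapT => /forall2NP H; move: cX; rewrite ltnNge => /negP; apply.
  apply/subset_leq_card/fintype.subsetP => t tg.
  by have [//|/negP/negPn] := H t.
have tT i : ~ mx_linked (T i) t.
  move=> [f hf ft]; move/imsetP: tX; apply; exists (i, [ffun x => f x]).
    rewrite !inE /=; split; case: hf => [hb hB hM he].
    - exact: (eq_bij hb (fun x => esym (ffunE f x))).
    - by move=> x y; rewrite !ffunE hB.
    - by move=> x y; rewrite !ffunE hM.
    - by move=> c; rewrite !ffunE he.
  by apply: val_inj; rewrite /= -ft; apply: eq_map => x; rewrite ffunE.
exists (fun i => if unlift ord_max i is Some j then T j else t); split=> [i|i j].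
  by case: unliftP => [j _|_]; [exact: Tg|move: tg; rewrite !inE].
case: unliftP => [i' ->|->]; case: unliftP => [j' ->|->] //.
- by move/Tu ->.
- by move/tT.
- by move/sym/tT.
Qed.

End GeneratingTuples.

Lemma ncard_seq (T : choiceType) (s : seq T) : uniq s -> ncard [set` s] = size s.
Proof.
move=> us; have -> : [set` s] = [set` [fset x in s]%fset].
  by apply/seteqP; split=> x /=; rewrite !inE.
by rewrite /ncard set_fsetK card_fseq undup_id.
Qed.

(** * Generators of finite semisimple algebras *)

Section Goursat.
Variable k : finFieldType.
Local Notation q := #|k|.
Local Notation "''MF' ( n , r )" := 'M[GF (q ^ r.+1)]_n.+1 (format "''MF' ( n ,  r )").

Variables (A : pzRingType) (S : set A) (I : finType) (n r : I -> nat).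
Variable p : forall i, {additive A -> 'MF(n i, r i)}.
Hypotheses (S1 : S 1) (SB : forall x y, S x -> S y -> S (x - y)).
Hypothesis SM : forall x y, S x -> S y -> S (x * y).
Hypothesis p1 : forall i, p i 1 = 1.
Hypothesis pM : forall i x y, S x -> S y -> p i (x * y) = p i x * p i y.
Hypothesis psurj : forall i X, exists2 x, S x & p i x = X.
Hypothesis pscal : forall c, exists2 x, S x & forall i, p i x = (gf_emb k (r i) c)%:M.
Hypothesis unlinked : forall i j, i != j ->
  ~ exists2 phi, mx_iso phi & forall x, S x -> phi (p i x) = p j x.

Let gS : add_group S.
Proof. by split=> //; rewrite -(subrr 1); apply: SB. Qed.

(** The image under [p i] of the kernel of [p j] on S is an ideal. If it is nonzero, it contains 1.
    Otherwise [p i] factors through [p j], and by simplicity the factor map is an isomorphism,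
    contrary to [unlinked]. The maps are multiplicative only on S so that diagonal entries of
    matrices are covered. *)
Lemma goursat_separate i j : i != j -> exists2 x, S x & p i x = 1 /\ p j x = 0.
Proof.
move=> ij; pose J : set 'MF(n i, r i) := [set X | exists2 x, S x & p i x = X /\ p j x = 0].
have iJ : is_ideal J.
  split; first split.
  - by exists 0; [case: gS|rewrite !raddf0].
  - move=> _ _ [x Sx [<- x0]] [y Sy [<- y0]]; exists (x - y); first exact: SB.
    by rewrite !raddfB x0 y0 subrr.
  - move=> Y _ [x Sx [<- x0]]; have [y Sy <-] := psurj Y.
    by exists (y * x); [exact: SM|rewrite !pM // x0 mulr0].
  - move=> Y _ [x Sx [<- x0]]; have [y Sy <-] := psurj Y.
    by exists (x * y); [exact: SM|rewrite !pM // x0 mul0r].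
have [[x [Sx [xj0 xi0]]]|noker] := pselect (exists x, S x /\ p j x = 0 /\ p i x <> 0).
  by apply: (mx_ideal_full iJ _ xi0); exists x.
have ker x : S x -> p j x = 0 -> p i x = 0.
  by move=> Sx xj0; apply: contrapT => xi0; apply: noker; exists x.
pose phi Y := p i (sval (cid2 (psurj (i := j) Y))).
have phiE x : S x -> phi (p j x) = p i x.
  move=> Sx; rewrite /phi; case: cid2 => y /= Sy yx.
  apply/eqP; rewrite -subr_eq0 -raddfB; apply/eqP/ker; first exact: SB.
  by rewrite raddfB yx subrr.
case: (unlinked (i := j) (j := i)); first by rewrite eq_sym.
exists phi; last exact: phiE.
have phiB : {morph phi : X Y / X - Y}.
  move=> X Y; have [x Sx <-] := psurj X; have [y Sy <-] := psurj Y.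
  by rewrite -raddfB !phiE ?raddfB //; apply: SB.
have phiM : {morph phi : X Y / X * Y}.
  move=> X Y; have [x Sx <-] := psurj X; have [y Sy <-] := psurj Y.
  by rewrite -pM // !phiE ?pM //; apply: SM.
have phi1 : phi 1 = 1 by rewrite -(p1 j) phiE.
have phi0 : phi 0 = 0 by rewrite -(subrr 1) phiB subrr.
have phi_inj : injective phi.
  move=> X Y XY; apply: contrapT => XY0.
  pose K : set 'MF(n j, r j) := [set Z | phi Z = 0].
  have iK : is_ideal K.
    split; first split=> [|U V|U V]; rewrite /K /=.
    - exact: phi0.
    - by rewrite phiB => -> ->; rewrite subrr.
    - by rewrite phiM => ->; rewrite mulr0.
    - by move=> U V; rewrite /K /= phiM => ->; rewrite mul0r.
  have : K 1.
    apply: (mx_ideal_full (X := X - Y)) => //; first by rewrite /K /= phiB XY subrr.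
    by move=> /eqP; rewrite subr_eq0 => /eqP.
  by rewrite /K /= phi1 => /eqP; rewrite oner_eq0.
split=> //; last first.
  by move=> c; have [x Sx xE] := pscal c; rewrite -!xE phiE.
have phi_surj Z : exists Y, phi Y = Z.
  by have [x Sx <-] := psurj Z; exists (p j x); rewrite phiE.
exists (fun Z => sval (cid (phi_surj Z))) => [Y|Z].
  by apply: phi_inj; exact: (svalP (cid (phi_surj (phi Y)))).
exact: (svalP (cid (phi_surj Z))).
Qed.

Lemma goursat (X : forall i, 'MF(n i, r i)) : exists2 x, S x & forall i, p i x = X i.
Proof.
have [e eP] : exists e : I -> A, forall i, S (e i) /\ p i (e i) = 1 /\
    forall j, j != i -> p j (e i) = 0.
  suff H i : exists x, S x /\ p i x = 1 /\ forall j, j != i -> p j x = 0.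
    by exists (fun i => sval (cid (H i))) => i; exact: (svalP (cid (H i))).
  suff [x [Sx x1 x0]] : exists x, [/\ S x, p i x = 1 &
      forall j, j \in enum I -> j != i -> p j x = 0].
    by exists x; split=> //; split=> // j; apply: x0; rewrite mem_enum.
  elim: (enum I) => [|j s [x [Sx x1 x0]]]; first by exists 1; split.
  have [->|ji] := eqVneq j i.
    by exists x; split=> // l; rewrite inE => /predU1P[->|/x0//]; rewrite eqxx.
  have [|y Sy [y1 y0]] := goursat_separate (i := i) (j := j); first by rewrite eq_sym.
  exists (y * x); split; [exact: SM|by rewrite pM // x1 y1 mulr1|].
  move=> l; rewrite inE => /predU1P[->|/x0 h li]; rewrite pM ?y0 ?mul0r //.
  by rewrite h // mulr0.
pose f i := sval (cid2 (psurj (X i))).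
have fS i : S (f i) by rewrite /f; case: cid2.
have fE i : p i (f i) = X i by rewrite /f; case: cid2.
exists (\sum_i e i * f i).
  by apply: add_group_sum => // i _; apply: SM => //; case: (eP i).
move=> i; have [Si [i1 _]] := eP i.
rewrite raddf_sum (bigD1 i) //= pM // i1 mul1r fE big1 ?addr0 // => j ji.
have [Sj [_ j0]] := eP j.
by rewrite pM // j0 ?mul0r // eq_sym.
Qed.

End Goursat.

Section AlgebraGeneration.
Variables (k : finFieldType) (B : pzRingType) (rho : {rmorphism k -> B}).
Local Notation q := #|k|.
Local Notation "''MF' ( n , r )" := 'M[GF (q ^ r.+1)]_n.+1 (format "''MF' ( n ,  r )").

Definition alg_generating (t : seq B) := subring_gen (range rho `|` [set` t]) = setT.

Variable w : wedderburn rho.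
Local Notation z := (@wed_blk _ _ _ w).

Definition wed_mult n r := #|[set j | (blk_n (z j) == n) && (blk_r (z j) == r)]%SET|.

Lemma ideal_blk_unit (J : set B) j b : is_ideal J -> J b -> blk_proj (z j) b <> 0 ->
  J (blk_unit (z j)).
Proof.
move=> iJ Jb pb0; pose I := [set X | exists2 x, J x & blk_proj (z j) x = X].
have iI : is_ideal I.
  split; first split.
  - by exists 0; [case: (ideal_add_group iJ)|rewrite rmorph0].
  - move=> _ _ [x Jx <-] [y Jy <-]; exists (x - y); last by rewrite rmorphB.
    by apply: (ideal_add_group iJ).2.
  - move=> Y _ [x Jx <-]; have [y <-] := blk_surj Y.
    by exists (y * x); [exact: ideal_mull|rewrite rmorphM].
  - move=> Y _ [x Jx <-]; have [y <-] := blk_surj Y.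
    by exists (x * y); [exact: ideal_mulr|rewrite rmorphM].
have [|x Jx x1] := mx_ideal_full iI _ pb0; first by exists b.
suff <- : blk_unit (z j) * x = blk_unit (z j) by apply: ideal_mull.
apply/eqP; rewrite -subr_eq0 -{2}[blk_unit (z j)]mulr1 -mulrBr; apply/eqP/blk_ker.
by rewrite rmorphB x1 rmorph1 subrr.
Qed.

Lemma blk_unit_fixed_proj j b : blk_unit (z j) * b = b -> b <> 0 -> blk_proj (z j) b <> 0.
Proof. by move=> ub b0 /blk_ker; rewrite ub. Qed.

Definition blk_ideal j : set B := [set b | blk_unit (z j) * b = b].

Lemma blk_ideal_is_ideal j : is_ideal (blk_ideal j).
Proof.
split; first split=> [|a b aT bT|a b bT]; rewrite /blk_ideal /=.
- by rewrite mulr0.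
- by rewrite mulrBr aT bT.
- by rewrite mulrA -blk_unitC -mulrA bT.
- by move=> a b bT; rewrite /blk_ideal /= mulrA bT.
Qed.

Lemma blk_ideal_unit j : blk_ideal j (blk_unit (z j)).
Proof. exact: blk_unitK. Qed.

Lemma blk_ideal_sub j J : is_ideal J -> J (blk_unit (z j)) -> blk_ideal j `<=` J.
Proof. by move=> iJ Ju b <-; apply: ideal_mulr. Qed.

Lemma blk_ideal_simple j : is_simple_factor (blk_ideal j).
Proof.
split; first split; first exact: blk_ideal_is_ideal.
- exists [set b | blk_unit (z j) * b = 0]; split.
  + split; first split=> [|a b aT bT|a b bT] /=.
    * by rewrite mulr0.
    * by rewrite mulrBr aT bT subrr.
    * by rewrite mulrA -blk_unitC -mulrA bT mulr0.
    * by move=> a b /= bT; rewrite mulrA bT mul0r.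
  + apply/seteqP; split=> [x []|x ->]; rewrite /blk_ideal /=; first by move=> e1 e2; rewrite -e1.
    by rewrite mulr0.
  + move=> x; exists (blk_unit (z j) * x), (x - blk_unit (z j) * x); split.
    * by rewrite /blk_ideal /= mulrA blk_unitK.
    * by rewrite /= mulrBr mulrA blk_unitK subrr.
    * by rewrite addrC subrK.
- move=> e; have := blk_ideal_unit j; rewrite e /=; exact: blk_unit_neq0.
- move=> J iJ Jsub; have [[x Jx x0]|noJ] := pselect (exists2 x, J x & x <> 0).
    right; apply/seteqP; split=> //; apply: blk_ideal_sub => //.
    by apply: (ideal_blk_unit iJ Jx); apply: blk_unit_fixed_proj => //; exact: (Jsub x Jx).
  left; apply/seteqP; split=> x /=; last by move=> ->; case: (ideal_add_group iJ).
  by move=> Jx; apply: contrapT => x0; apply: noJ; exists x.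
Qed.

Lemma simple_factor_blk J : is_simple_factor J -> exists j, J = blk_ideal j.
Proof.
move=> [[iJ _] J0 Jmin].
have [x Jx x0] : exists2 x, J x & x <> 0.
  apply: contrapT => /forall2NP H; apply: J0; apply/seteqP; split=> y /=.
    by move=> Jy; have [|/contrapT] := H y.
  by move=> ->; case: (ideal_add_group iJ).
have [j ujx] : exists j, blk_proj (z j) x <> 0.
  apply: contrapT => /forallNP H; apply: x0; apply: (wed_inj (w := w)) => j.
  rewrite rmorph0; apply: contrapT; exact: (H j).
exists j; have Ju := ideal_blk_unit iJ Jx ujx.
have sub := blk_ideal_sub iJ Ju.
case: (Jmin _ (blk_ideal_is_ideal j) sub) => // e.
by have := blk_ideal_unit j; rewrite e /= => /blk_unit_neq0.
Qed.

(** An isomorphism of rings need not respect the scalars from k; [mx_mul_bij_dims] compares the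
    shapes by multiplication alone. *)
Lemma blk_ideal_iso j n r : iso_matrix_ring (blk_ideal j) n.+1 (GF (q ^ r.+1)) <->
  blk_n (z j) = n /\ blk_r (z j) = r.
Proof.
split=> [[f [finj frange fD fM]]|].
  have fS X : blk_ideal j (f X) by rewrite -frange; exists X.
  pose g X := blk_proj (z j) (f X).
  have gM : {morph g : X Y / X * Y} by move=> X Y; rewrite /g -mulmxE fM rmorphM.
  have ginj : injective g.
    move=> X Y XY; apply: finj; apply/eqP; rewrite -subr_eq0; apply/eqP.
    have : blk_proj (z j) (f X - f Y) = 0 by rewrite rmorphB -/(g X) -/(g Y) XY subrr.
    by move=> /blk_ker; rewrite mulrBr !fS.
  have gsurj Y : exists X, g X = Y.
    have [b bY] := blk_surj Y.
    have : blk_ideal j (blk_unit (z j) * b) by rewrite /blk_ideal /= mulrA blk_unitK.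
    rewrite -frange => -[X _ fX]; exists X.
    by rewrite /g fX rmorphM blk_proj_unit mul1r.
  have gbij : bijective g.
    exists (fun Y => sval (cid (gsurj Y))) => [X|Y].
      by apply: ginj; exact: (svalP (cid (gsurj (g X)))).
    exact: (svalP (cid (gsurj Y))).
  by have [-> ->] := mx_mul_bij_dims gbij gM.
move=> [<- <-]; pose M := 'MF(blk_n (z j), blk_r (z j)).
pose f (X : M) := blk_unit (z j) * sval (cid (blk_surj X)).
have pf X : blk_proj (z j) (f X) = X.
  by rewrite rmorphM blk_proj_unit mul1r; exact: (svalP (cid (blk_surj X))).
have uf X : blk_ideal j (f X) by rewrite /blk_ideal /= mulrA blk_unitK.
have funiq x y : blk_ideal j x -> blk_ideal j y ->
    blk_proj (z j) x = blk_proj (z j) y -> x = y.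
  move=> jx jy xy; apply/eqP; rewrite -subr_eq0 -jx -jy -mulrBr; apply/eqP/blk_ker.
  by rewrite rmorphB xy subrr.
have gJ := ideal_add_group (blk_ideal_is_ideal j).
exists f; split.
- by move=> X Y XY; rewrite -(pf X) XY pf.
- apply/seteqP; split=> [_ [X _ <-]//|b jb]; exists (blk_proj (z j) b) => //.
  by apply: funiq => //; rewrite pf.
- move=> X Y; apply: funiq => //; first exact: add_groupD.
  by rewrite rmorphD !pf.
- move=> X Y; apply: funiq => //; first by apply: ideal_mull => //; exact: blk_ideal_is_ideal.
  by rewrite rmorphM !pf.
Qed.

Lemma num_simple_factorsE n r :
  num_simple_factors B n.+1 (GF (q ^ r.+1)) = wed_mult n r.
Proof.
pose J := [set j | (blk_n (z j) == n) && (blk_r (z j) == r)]%SET.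
have inj : injective blk_ideal.
  move=> i j ij; apply: contrapT => /eqP nij; apply: (@blk_unit_neq0 _ _ _ (z i)).
  have := blk_ideal_unit i; rewrite ij /blk_ideal /= => <-.
  by rewrite wed_orth // eq_sym.
rewrite /num_simple_factors /wed_mult -/J cardE -(size_map blk_ideal).
rewrite -ncard_seq ?map_inj_uniq ?enum_uniq //; congr ncard.
apply/seteqP; split=> [I [/simple_factor_blk[j ->] /blk_ideal_iso[jn jr]]|I] /=.
  by apply: map_f; rewrite mem_enum !inE jn jr !eqxx.
move=> /mapP[j]; rewrite mem_enum !inE => /andP[/eqP jn /eqP jr] ->.
by split; [exact: blk_ideal_simple|apply/blk_ideal_iso].
Qed.

Lemma alg_generating_of_unlinked m
    (T : forall j, m.-tuple 'MF(blk_n (z j), blk_r (z j))) :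
  (forall j, mx_generating (T j)) -> (forall i j, mx_linked (T i) (T j) -> i = j) ->
  exists t : m.-tuple B, alg_generating t.
Proof.
move=> Tg Tu.
pose b l := sval (cid (wed_surj (w := w) (fun j => tnth (T j) l))).
have bE l j : blk_proj (z j) (b l) = tnth (T j) l.
  exact: (svalP (cid (wed_surj (w := w) (fun j => tnth (T j) l)))).
pose t := [tuple b l | l < m]; exists t.
have tE j : map (blk_proj (z j)) t = T j.
  rewrite -[RHS]map_tnth_enum /= -map_comp.
  by apply: eq_map => l /=; rewrite bE.
pose S := subring_gen (range rho `|` [set` t]).
have psurj j X : exists2 x, S x & blk_proj (z j) x = X.
  have : subring_gen (@mx_scalars k (blk_n (z j)) (blk_r (z j)) `|` [set` T j]) X by rewrite Tg.
  elim=> {X} [X [[c ->]|]||X Y _ [x Sx <-] _ [y Sy <-]|X Y _ [x Sx <-] _ [y Sy <-]].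
  - by exists (rho c); [apply: subring_gen_in; left; exists c|exact: blk_scalar].
  - move=> XT; have : X \in tval (T j) := XT.
    rewrite -tE => /mapP[x tx ->]; exists x => //.
    by apply: subring_gen_in; right.
  - by exists 1; [exact: subring_gen1|rewrite rmorph1].
  - by exists (x - y); [exact: subring_genB|rewrite rmorphB].
  - by exists (x * y); [exact: subring_genM|rewrite rmorphM].
apply/seteqP; split=> // x _.
have [||||||| y Sy yx] := @goursat k B S _ (fun j => blk_n (z j)) (fun j => blk_r (z j))
    (fun j => blk_proj (z j)) _ _ _ _ _ psurj _ _ (fun j => blk_proj (z j) x).
- exact: subring_gen1.
- exact: subring_genB.
- exact: subring_genM.
- by move=> j; rewrite /= rmorph1.
- by move=> j u v _ _; rewrite /= rmorphM.
- move=> c; exists (rho c); last by move=> j; exact: blk_scalar.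
  by apply: subring_gen_in; left; exists c.
- move=> i j /eqP ij [phi hphi phiE]; apply: ij; apply: Tu; exists phi => //.
  rewrite -!tE -map_comp; apply/eq_in_map => u tu /=; apply: phiE.
  by apply: subring_gen_in; right.
by rewrite -(wed_inj (w := w) yx).
Qed.

Lemma alg_generating_of_bound m :
  (forall n r, num_simple_factors B n.+1 (GF (q ^ r.+1)) *
     (r.+1 * PGL_card n.+1 (GF (q ^ r.+1))) <= num_generating_tuples m n.+1 q r.+1)%N ->
  exists t : m.-tuple B, alg_generating t.
Proof.
move=> bound.
pose T n r := sval (cid (choose_unlinked_tuples (bound n r))).
have TP n r : (forall i, mx_generating (T n r i)) /\
    forall i j, mx_linked (T n r i) (T n r j) -> i = j.
  exact: (svalP (cid (choose_unlinked_tuples (bound n r)))).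
pose same i j := (blk_n (z i) == blk_n (z j)) && (blk_r (z i) == blk_r (z j)).
(* Block j receives, from the unlinked family of its shape, the tuple numbered by the count of
   earlier blocks of that shape. *)
pose rk (j : 'I_(wed_s w)) := #|[set i : 'I_(wed_s w) | (i < j)%N && same i j]%SET|.
have rk_lt j : (rk j <
    num_simple_factors B (blk_n (z j)).+1 (GF (q ^ (blk_r (z j)).+1)))%N.
  rewrite num_simple_factorsE; apply: proper_card; apply/properP; split.
    by apply/fintype.subsetP => i; rewrite !inE => /andP[].
  by exists j; rewrite !inE ?eqxx // ltnn.
have rk_inj i j : same i j -> rk i = rk j -> i = j.
  wlog ij : i j / (i <= j)%N => [H|sij].
    case: (leqP i j) => [ij|/ltnW ji]; first exact: (H i j ij).
    move=> sij e; apply/esym/(H j i ji) => //.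
    by rewrite /same eq_sym [X in _ && X]eq_sym.
  move=> e; apply/val_inj/eqP; rewrite eqn_leq ij leqNgt; apply/negP => lt_ij.
  have : (rk i < rk j)%N.
    apply: proper_card; apply/properP; split.
      apply/fintype.subsetP => l; rewrite !inE => /andP[li /andP[/eqP e1 /eqP e2]].
      case/andP: sij => /eqP f1 /eqP f2.
      by rewrite (ltn_trans li) // /same e1 f1 e2 f2 !eqxx.
    by exists i; rewrite !inE ?lt_ij ?sij // ltnn.
  by rewrite e ltnn.
apply: (@alg_generating_of_unlinked m (fun j => T _ _ (Ordinal (rk_lt j)))).
  by move=> j; apply: (TP _ _).1.
move=> i j.
move=> lk; have [e1 e2] : blk_n (z i) = blk_n (z j) /\ blk_r (z i) = blk_r (z j).
  by case: lk => phi hphi _; apply: mx_mul_bij_dims (mx_iso_bij hphi) (mx_isoM hphi).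
apply: rk_inj; first by rewrite /same e1 e2 !eqxx.
suff : val (Ordinal (rk_lt i)) = val (Ordinal (rk_lt j)) by [].
(* Generalizing the two indices allows rewriting with the equal shapes, after which both tuples
   belong to one family. *)
move: lk; move: (Ordinal (rk_lt i)) (Ordinal (rk_lt j)); rewrite e1 e2 => ri rj lk.
by congr val; apply: (TP _ _).2.
Qed.

Lemma bound_of_alg_generating m (t : m.-tuple B) n r : alg_generating t ->
  (num_simple_factors B n.+1 (GF (q ^ r.+1)) *
     (r.+1 * PGL_card n.+1 (GF (q ^ r.+1))) <= num_generating_tuples m n.+1 q r.+1)%N.
Proof.
move=> gt; rewrite num_simple_factorsE.
pose J := [set j | (blk_n (z j) == n) && (blk_r (z j) == r)]%SET.
(* The projections of the blocks of shape (n, r) are restated with one common target type. *)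
have H j : j \in J -> exists p : {rmorphism B -> 'MF(n, r)},
    [/\ forall X, exists x, p x = X, forall c, p (rho c) = (gf_emb k r c)%:M &
     forall i, p (blk_unit (z i)) = (j == i)%:R].
  rewrite inE => /andP[/eqP jn /eqP jr]; move: (wed_proj_unit (w := w) j).
  case: (z j) jn jr => n' r' p u uC uK uker usurj uscal /= jn jr; subst n' r'.
  by move=> pu; exists p; split.
pose j (i : 'I_(wed_mult n r)) : 'I_(wed_s w) := enum_val i.
have Jj i : j i \in J := enum_valP i.
pose p i := sval (cid (H _ (Jj i))).
have pP i := svalP (cid (H _ (Jj i))).
apply: (unlinked_tuples_bound (T := fun i => map_tuple (p i) t)).
  move=> i; have [psurj pscal _] := pP i; apply/seteqP; split=> // X _.
  have [x <-] := psurj X.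
  have : subring_gen (range rho `|` [set` t]) x by rewrite gt.
  move=> /(subring_gen_morph (p i)); apply: subring_genS => _ [y [[c _ <-]|ty] <-].
    by left; exists c; rewrite pscal.
  by right; rewrite /= map_f.
move=> i i' [phi hphi phiE].
(* An isomorphism linking two components intertwines the projections on all of B; but the unit of
   the first block goes to 1 under one and, if the blocks differ, to 0 under the other. *)
have agree x : phi (p i x) = p i' x.
  have : subring_gen (range rho `|` [set` t]) x by rewrite gt.
  elim=> {x} [x [[c _ <-]|tx]||x y _ ex _ ey|x y _ ex _ ey].
  - have [_ pscal _] := pP i; have [_ pscal' _] := pP i'.
    by rewrite pscal pscal' (mx_iso_emb hphi).
  - by move: phiE; rewrite /= -map_comp => /eq_in_map/(_ x tx).
  - by rewrite !rmorph1 (mx_iso1 hphi).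
  - by rewrite !rmorphB (mx_isoB hphi) ex ey.
  - by rewrite !rmorphM (mx_isoM hphi) ex ey.
have [_ _ pu] := pP i; have [_ _ pu'] := pP i'.
apply: enum_val_inj; apply/eqP; rewrite eq_sym; apply: contrapT => /negP/negPf ij.
have := agree (blk_unit (z (j i))).
rewrite pu pu' eqxx (mx_iso1 hphi) ij => /eqP.
by rewrite oner_eq0.
Qed.

End AlgebraGeneration.

Section OneGenerator.
Variable k : finFieldType.
Local Notation q := #|k|.
Local Notation "''MF' ( n , r )" := 'M[GF (q ^ r.+1)]_n.+1 (format "''MF' ( n ,  r )").

Lemma mx_generating1_dim n r (X : 'MF(n, r)) : mx_generating [:: X] -> n = 0%N.
Proof.
move=> gX.
have comm1 (Y : 'MF(n, r)) : Y * X = X * Y.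
  have : subring_gen (@mx_scalars k n r `|` [set` [:: X]]) Y by rewrite gX.
  elim=> {Y} [Y [[c ->]|]||Y Z _ eY _ eZ|Y Z _ eY _ eZ].
  - exact: scalar_mx_comm.
  - by rewrite /= inE => /eqP ->.
  - by rewrite mul1r mulr1.
  - by rewrite mulrBl mulrBr eY eZ.
  - by rewrite -mulrA eZ !mulrA eY.
have comm (Y Z : 'MF(n, r)) : Y * Z = Z * Y.
  have : subring_gen (@mx_scalars k n r `|` [set` [:: X]]) Z by rewrite gX.
  elim=> {Z} [Z [[c ->]|]||Z W _ eZ _ eW|Z W _ eZ _ eW].
  - by rewrite scalar_mx_comm.
  - by rewrite /= inE => /eqP ->.
  - by rewrite mul1r mulr1.
  - by rewrite mulrBl mulrBr eZ eW.
  - by rewrite mulrA eZ -!mulrA eW.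
case: n X {gX} comm1 comm => // n X _ comm.
have := comm (delta_mx ord0 ord_max) (delta_mx ord_max ord_max).
rewrite -!mulmxE mul_delta_mx mul_delta_mx_0 // => /matrixP/(_ ord0 ord_max).
by rewrite !mxE !eqxx => /eqP; rewrite oner_eq0.
Qed.

Lemma num_generating_tuples_gt0_dim n r :
  (0 < num_generating_tuples 1 n.+1 q r.+1)%N -> n = 0%N.
Proof.
rewrite num_generating_tuplesE => /card_gt0P[t]; rewrite !inE.
by case/tupleP: t => X t; rewrite tuple0; exact: mx_generating1_dim.
Qed.

Lemma PGL_card1 (F : finFieldType) : PGL_card 1 F = 1%N.
Proof.
rewrite /PGL_card; suff -> : ('Z('GL_1[F]) = 'GL_1[F])%g by rewrite trivg_quotient cards1.
apply/center_idP/centsP => U _ V _; apply: val_inj.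
rewrite /= -[RHS]/(GLval V * GLval U) -[LHS]/(GLval U * GLval V).
apply/matrixP => i j; rewrite !mxE !big_ord1 mulrC.
by rewrite !ord1.
Qed.

(** If t generates the unit group of the field, the q translates t + c with c in k all generate the
    field over k. *)
Lemma num_generating_tuples11 r : (q <= num_generating_tuples 1 1 q r.+1)%N.
Proof.
rewrite num_generating_tuplesE.
have [t tgen] := finField_generator (GF (q ^ r.+1)).
pose f (c : k) : 1.-tuple 'MF(0, r) := [tuple (t + gf_emb k r c)%:M].
have finj : injective f.
  move=> c d /(congr1 (fun s : 1.-tuple 'MF(0, r) => thead s ord0 ord0)).
  rewrite /f !theadE !mxE !eqxx !mulr1n.
  by move/addrI/fmorph_inj.
apply: leq_trans (_ : #|[set f c | c in k]%SET| <= _)%N; first by rewrite card_imset.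
apply/subset_leq_card/fintype.subsetP => s /imsetP[c _ ->].
rewrite !inE; apply/seteqP; split=> // X _.
have -> : X = (X ord0 ord0)%:M by apply/matrixP => i j; rewrite !ord1 mxE eqxx.
set S := subring_gen _.
have gc : S (gf_emb k r c)%:M by apply: subring_gen_in; left; exists c.
have gt : S t%:M.
  have -> : t%:M = (t + gf_emb k r c)%:M - (gf_emb k r c)%:M :> 'MF(0, r).
    by rewrite -raddfB addrK.
  by apply: subring_genB => //; apply: subring_gen_in; right; rewrite /= inE.
have [->|/tgen[i ->]] := eqVneq (X ord0 ord0) 0.
  by rewrite raddf0; case: (subring_gen_group (@mx_scalars k 0 r `|` [set` f c])).
elim: i => [|i IH]; first by rewrite expr0; exact: subring_gen1.
by rewrite exprS -[(_ * _)%:M]/(_ %:M) scalar_mxM mulmxE; apply: subring_genM.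
Qed.

End OneGenerator.

(** * One or two generators over a large residue field *)

Section LargeField.
Variables (k : finFieldType) (B : pzRingType) (rho : {rmorphism k -> B}).
Local Notation q := #|k|.
Local Notation "''MF' ( n , r )" := 'M[GF (q ^ r.+1)]_n.+1 (format "''MF' ( n ,  r )").
Variable w : wedderburn rho.
Local Notation z := (@wed_blk _ _ _ w).

Lemma wedderburn_comm : (forall j, blk_n (z j) = 0%N) <-> (forall x y : B, x * y = y * x).
Proof.
split=> [n0 x y|BC j].
  apply: (wed_inj (w := w)) => j; rewrite !rmorphM.
  move: (blk_proj (z j) x) (blk_proj (z j) y); rewrite n0 => X Y.
  by apply/matrixP => a b; rewrite !mxE !big_ord1 !ord1 mulrC.
apply/eqP/negPn/negP => nj.
have := blk_surj (delta_mx (ord0 : 'I_(blk_n (z j)).+1) ord_max) => -[x xE].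
have := blk_surj (delta_mx (ord_max : 'I_(blk_n (z j)).+1) ord_max) => -[y yE].
have := congr1 (blk_proj (z j)) (BC x y); rewrite !rmorphM xE yE.
have o : ord_max != ord0 :> 'I_(blk_n (z j)).+1 by rewrite -val_eqE.
rewrite -!mulmxE mul_delta_mx mul_delta_mx_0 // => /matrixP/(_ ord0 ord_max).
by rewrite !mxE !eqxx => /eqP; rewrite oner_eq0.
Qed.

Lemma bound1_comm :
  (forall n r, num_simple_factors B n.+1 (GF (q ^ r.+1)) *
     (r.+1 * PGL_card n.+1 (GF (q ^ r.+1))) <= num_generating_tuples 1 n.+1 q r.+1)%N ->
  forall x y : B, x * y = y * x.
Proof.
move=> bound; apply/wedderburn_comm => j.
apply: (@num_generating_tuples_gt0_dim k _ (blk_r (z j))); apply: leq_trans (bound _ _).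
rewrite !muln_gt0 PGL_card_gt0 /= andbT (num_simple_factorsE w).
by rewrite /wed_mult; apply/card_gt0P; exists j; rewrite inE !eqxx.
Qed.

Variables (D : nat) (g : {ffun 'I_D -> k} -> B).
Hypotheses (gsurj : forall b, exists c, g c = b) (qD : (D ^ 3 <= q)%N).

(** A dimension bound by counting: a set of q^n elements embeds into B, which is an image of k^D. *)
Lemma wed_dim_le (n : nat) (f : {ffun 'I_n -> k} -> B) : injective f -> (n <= D)%N.
Proof.
move=> finj; have q1 : (1 < q)%N := card_finField_gt1 k.
have h b : {c | g c = b} by apply: cid.
have inj : injective (fun c => sval (h (f c))).
  by move=> c d e; apply: finj; rewrite -(svalP (h (f c))) -(svalP (h (f d))) e.
by have := leq_card _ inj; rewrite !card_ffun !card_ord leq_exp2l.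
Qed.

Lemma wed_section j (X : 'MF(blk_n (z j), blk_r (z j))) :
  exists b, blk_proj (z j) b = X /\ forall i, i != j -> blk_proj (z i) b = 0.
Proof.
have [b bX] := blk_surj X; exists (blk_unit (z j) * b).
rewrite rmorphM blk_proj_unit mul1r; split=> // i ij.
by rewrite rmorphM wed_proj_unit (negPf ij) mul0r.
Qed.

Lemma wed_s_le : (wed_s w <= D)%N.
Proof.
pose f (c : {ffun 'I_(wed_s w) -> k}) :=
  sval (cid (wed_surj (w := w) (fun j => (gf_emb k (blk_r (z j)) (c j))%:M))).
have fE c j : blk_proj (z j) (f c) = (gf_emb k (blk_r (z j)) (c j))%:M.
  exact: (svalP (cid (wed_surj (w := w) (fun j => (gf_emb k (blk_r (z j)) (c j))%:M)))).
apply: (@wed_dim_le _ f) => c d cd; apply/ffunP => j.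
have := fE c j; rewrite cd fE => /matrixP/(_ ord0 ord0).
by rewrite !mxE eqxx => /fmorph_inj.
Qed.

Lemma blk_n_lt j : (blk_n (z j) < D)%N.
Proof.
pose f (c : {ffun 'I_(blk_n (z j)).+1 -> k}) := sval (cid (wed_section
  (diag_mx (\row_i gf_emb k (blk_r (z j)) (c i))))).
have fE c : blk_proj (z j) (f c) = diag_mx (\row_i gf_emb k (blk_r (z j)) (c i)).
  exact: (svalP (cid (wed_section (diag_mx (\row_i gf_emb k (blk_r (z j)) (c i)))))).1.
apply: (@wed_dim_le _ f) => c d cd; apply/ffunP => i.
have := fE c; rewrite cd fE => /matrixP/(_ i i).
by rewrite !mxE eqxx => /fmorph_inj.
Qed.

Lemma blk_r_lt j : (blk_r (z j) < D)%N.
Proof.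
have q1 : (1 < q)%N := card_finField_gt1 k.
rewrite -(leq_exp2l _ _ q1) -{1}(card_GF k (ltn0Sn (blk_r (z j)))).
pose f (a : GF (q ^ (blk_r (z j)).+1)) := sval (cid (wed_section (j := j) a%:M)).
have fE a : blk_proj (z j) (f a) = a%:M.
  exact: (svalP (cid (wed_section (j := j) a%:M))).1.
have h b : {c | g c = b} by apply: cid.
have inj : injective (fun a => sval (h (f a))).
  move=> a b e; have : f a = f b by rewrite -(svalP (h (f a))) -(svalP (h (f b))) e.
  move=> fab; have := fE a; rewrite fab fE => /matrixP/(_ ord0 ord0).
  by rewrite !mxE eqxx !mulr1n.
by have := leq_card _ inj; rewrite card_ffun card_ord.
Qed.

Let X := {j : 'I_(wed_s w) & 'I_(blk_n (z j)).+1}.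

Lemma card_diag : (#|{: X}| <= D * D)%N.
Proof.
rewrite card_tagged sumnE big_map.
apply: (@leq_trans (\sum_(j <- enum 'I_(wed_s w)) D)).
  by apply: leq_sum => j _; rewrite card_ord; exact: blk_n_lt.
by rewrite big_enum sum_nat_const card_ord leq_mul2r wed_s_le orbT.
Qed.

(** A matrix of size one, so that [goursat] applies to the family of all diagonal entries. *)
Definition diag_coef (x : X) (b : B) : 'MF(0, blk_r (z (tag x))) :=
  (blk_proj (z (tag x)) b (tagged x) (tagged x))%:M.

Lemma diag_coef_additive x : zmod_morphism (diag_coef x).
Proof. by move=> b c; rewrite /diag_coef rmorphB mxE [X in _ + X]mxE raddfB. Qed.
HB.instance Definition _ x := GRing.isZmodMorphism.Build B _ (diag_coef x) (diag_coef_additive x).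

(* [a] is block diagonal with pairwise unlinked diagonal entries, so that
   k[a] is the algebra of all diagonal elements. *)
Lemma diagonal_generator : exists a, forall (Y : forall x : X, GF (q ^ (blk_r (z (tag x))).+1)),
  exists2 b, subring_gen (range rho `|` [set` [:: a]]) b &
    forall j i i', blk_proj (z j) b i i' = Y (Tagged (fun j => 'I_(blk_n (z j)).+1) i) *+ (i == i').
Proof.
(* The exponent 3 comes from here: at most D^2 diagonal positions, times r.+1 <= D field
   automorphisms, must fit into the q known generators. *)
have H (r : nat) : (r < D)%N -> (#|{: X}| * (r.+1 * PGL_card 1 (GF (q ^ r.+1))) <=
    num_generating_tuples 1 1 q r.+1)%N.
  move=> rD; apply: leq_trans (num_generating_tuples11 k r); apply: leq_trans qD.
  by rewrite PGL_card1 muln1 !expnS expn0 muln1 mulnA leq_mul ?card_diag.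
pose T r (rD : (r < D)%N) := sval (cid (choose_unlinked_tuples (H r rD))).
have TP r (rD : (r < D)%N) : (forall i, mx_generating (T r rD i)) /\
    forall i j, mx_linked (T r rD i) (T r rD j) -> i = j.
  exact: (svalP (cid (choose_unlinked_tuples (H r rD)))).
pose th (x : X) : 'MF(0, blk_r (z (tag x))) := thead (T _ (blk_r_lt (tag x)) (enum_rank x)).
have thg x : mx_generating [:: th x].
  have := (TP _ (blk_r_lt (tag x))).1 (enum_rank x).
  by rewrite /th; case/tupleP: (T _ _ _) => Y t; rewrite theadE (tuple0 t).
have thl x y : (exists2 phi, mx_iso phi & phi (th x) = th y) -> x = y.
  move=> [phi hphi]; have [_] := mx_mul_bij_dims (mx_iso_bij hphi) (mx_isoM hphi).
  rewrite /th => rxy phixy; apply: enum_rank_inj; move: phi hphi phixy.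
  move: (blk_r_lt (tag x)) (blk_r_lt (tag y)); rewrite -rxy => rD rD' phi hphi phixy.
  rewrite (bool_irrelevance rD' rD) in phixy; apply: (TP _ rD).2.
  exists phi => //; move: phixy; case/tupleP: (T _ _ _) => Y t; case/tupleP: (T _ _ _) => Y' t'.
  by rewrite !theadE (tuple0 t) (tuple0 t') /= => ->.
pose e j (i : 'I_(blk_n (z j)).+1) : GF (q ^ (blk_r (z j)).+1) :=
  th (Tagged (fun j => 'I_(blk_n (z j)).+1) i) ord0 ord0.
pose d j : 'rV[GF (q ^ (blk_r (z j)).+1)]_((blk_n (z j)).+1) := \row_i e j i.
have [a aE] := wed_surj (w := w) (fun j => diag_mx (d j)).
exists a; set S := subring_gen _ => Y.
have Sdiag b : S b -> forall j i i', i != i' -> blk_proj (z j) b i i' = 0.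
  elim=> {b} [b [[c _ <-]|ba]||b c _ hb _ hc|b c _ hb _ hc] j i i' ii'.
  - by rewrite blk_scalar mxE (negPf ii').
  - by move: ba; rewrite /= inE => /eqP ->; rewrite aE mxE (negPf ii').
  - by rewrite rmorph1 mxE (negPf ii').
  - by rewrite rmorphB mxE hb // mxE hc // oppr0 addr0.
  - rewrite rmorphM mxE big1 // => l _; have [<-|il] := eqVneq i l.
      by rewrite hc ?mulr0.
    by rewrite hb // mul0r.
(* Diagonal entries are multiplicative on S because all its elements are diagonal by [Sdiag]. *)
have pM x b c : S b -> S c -> diag_coef x (b * c) = diag_coef x b * diag_coef x c.
  move=> Sb Sc; rewrite /diag_coef -mulmxE -scalar_mxM; congr (_%:M).
  rewrite rmorphM mxE (bigD1 (tagged x)) //= big1 ?addr0 // => l lx.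
  by rewrite (Sdiag b) ?mul0r // eq_sym.
have pth x : diag_coef x a = th x.
  case: x => j i; rewrite /diag_coef /= aE; apply/matrixP => l l'.
  by rewrite !ord1 !mxE !eqxx !mulr1n.
have pscal x c : diag_coef x (rho c) = (gf_emb k (blk_r (z (tag x))) c)%:M.
  by rewrite /diag_coef blk_scalar mxE eqxx.
have p1 x : diag_coef x 1 = 1 by rewrite -(rmorph1 rho) pscal !rmorph1.
have psurj x Z : exists2 b, S b & diag_coef x b = Z.
  have : subring_gen (@mx_scalars k 0 (blk_r (z (tag x))) `|` [set` [:: th x]]) Z.
    by rewrite thg.
  elim=> {Z} [Z [[c ->]|]||Z W _ [b Sb <-] _ [c Sc <-]|Z W _ [b Sb <-] _ [c Sc <-]].
  - by exists (rho c); [apply: subring_gen_in; left; exists c|exact: pscal].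
  - rewrite /= inE => /eqP ->; exists a => //.
    by apply: subring_gen_in; right; rewrite /= inE.
  - by exists 1; [exact: subring_gen1|exact: p1].
  - by exists (b - c); [exact: subring_genB|rewrite raddfB].
  - by exists (b * c); [exact: subring_genM|rewrite pM].
have [||||| b Sb bY] := @goursat k B S X (fun=> 0%N) (fun x => blk_r (z (tag x)))
  diag_coef _ _ _ p1 pM psurj _ _ (fun x => (Y x)%:M).
- exact: subring_gen1.
- exact: subring_genB.
- exact: subring_genM.
- move=> c; exists (rho c); last by move=> x; exact: pscal.
  by apply: subring_gen_in; left; exists c.
- move=> x y /eqP xy [phi hphi phiE]; apply: xy; apply: thl; exists phi => //.
  by rewrite -!pth; apply: phiE; apply: subring_gen_in; right; rewrite /= inE.
exists b => // j i i'; have [<-|ii'] := eqVneq i i'; last by rewrite mulr0n Sdiag.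
have := bY (Tagged (fun j => 'I_(blk_n (z j)).+1) i) => /matrixP/(_ ord0 ord0).
by rewrite !mxE !eqxx !mulr1n.
Qed.

Lemma large_field_generator1 : (forall x y : B, x * y = y * x) ->
  exists t : 1.-tuple B, alg_generating rho t.
Proof.
move=> /wedderburn_comm n0; have [a aP] := diagonal_generator.
exists [tuple a]; apply/seteqP; split=> // x _.
have [b Sb bE] := aP (fun u => blk_proj (z (tag u)) x (tagged u) (tagged u)).
suff -> : x = b by [].
apply: (wed_inj (w := w)) => j; apply/matrixP => i i'; rewrite bE.
have : (i < 1)%N by have := ltn_ord i; rewrite {2}n0.
have : (i' < 1)%N by have := ltn_ord i'; rewrite {2}n0.
rewrite !ltnS !leqn0 => /eqP i'0 /eqP i0.
have -> : i' = i by apply: val_inj; rewrite /= i0 i'0.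
by rewrite eqxx.
Qed.

(** The first generator yields all diagonal elements. The second, b, has all entries 1 in every
    block, so that (y E_ii) b E_jj = y E_ij. *)
Lemma large_field_generator2 : exists t : 2.-tuple B, alg_generating rho t.
Proof.
have [a aP] := diagonal_generator.
have [b bE] := wed_surj (w := w) (fun j => const_mx 1).
exists [tuple a; b]; apply/seteqP; split=> // x _; set S := subring_gen _.
have Sa c : subring_gen (range rho `|` [set` [:: a]]) c -> S c.
  apply: subring_genS => u [|]; first by left.
  by rewrite /= inE => /eqP ->; right; rewrite /= !inE eqxx.
have Sb : S b by apply: subring_gen_in; right; rewrite /= !inE eqxx orbT.
have E j (i : 'I_(blk_n (z j)).+1) y : exists2 c, S c &
    blk_proj (z j) c = y *: delta_mx i i /\ forall l, l != j -> blk_proj (z l) c = 0.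
  pose t := Tagged (fun j => 'I_(blk_n (z j)).+1) i.
  pose Y (u : X) : GF (q ^ (blk_r (z (tag u))).+1) :=
    blk_proj (z (tag u)) (sval (cid (wed_section (y *: delta_mx i i)))) (tagged u) (tagged u).
  have [c /Sa Sc cE] := aP Y; exists c => //.
  have [sj so] := svalP (cid (wed_section (y *: delta_mx i i))).
  split=> [|l lj]; apply/matrixP => u v; rewrite cE /Y /=.
    rewrite sj !mxE; case: (u =P v) => [<-|uv]; rewrite ?mulr1n // mulr0n.
    case: (u =P i) => [ui|_] /=; last by rewrite mulr0.
    by case: (v =P i) => [vi|_]; [case: uv; rewrite ui vi|rewrite mulr0].
  by rewrite so // !mxE mul0rn.
have gS : add_group S := subring_gen_group _.
have E2 j i i' y : exists2 c, S c &
    blk_proj (z j) c = y *: delta_mx i i' /\ forall l, l != j -> blk_proj (z l) c = 0.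
  have [c Sc [cj co]] := E j i y; have [d Sd [dj d0]] := E j i' 1.
  exists (c * b * d); first by do 2?[apply: subring_genM => //].
  split=> [|l lj]; last by rewrite !rmorphM co // !mul0r.
  rewrite !rmorphM cj dj bE scale1r -!scalerAl delta_mx_conj mxE scale1r.
  by [].
pose f j i i' := sval (cid2 (E2 j i i' (blk_proj (z j) x i i'))).
suff -> : x = \sum_j \sum_i \sum_i' f j i i'.
  do 3?[apply: add_group_sum => // ? _].
  by rewrite /f; case: cid2.
apply: (wed_inj (w := w)) => j; rewrite rmorph_sum (bigD1 j) //= [X in _ + X]big1 ?addr0.
  rewrite {1}(matrix_sum_delta (blk_proj (z j) x)) rmorph_sum; apply: eq_bigr => i _.
  rewrite rmorph_sum; apply: eq_bigr => i' _.
  by rewrite /f; case: cid2 => c /= _ [->].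
move=> l lj; rewrite rmorph_sum big1 // => i _; rewrite rmorph_sum big1 // => i' _.
by rewrite /f; case: cid2 => c /= _ [_ h]; rewrite h // eq_sym.
Qed.

End LargeField.

(** * Separability of finite semisimple rings *)

Section Casimir.

Lemma morphB_sum (U V : zmodType) (f : U -> V) (I : Type) (s : seq I) (F : I -> U) :
  {morph f : x y / x - y} -> f (\sum_(i <- s) F i) = \sum_(i <- s) f (F i).
Proof.
move=> fB; have f0 : f 0 = 0 by rewrite -(subrr 0) fB subrr.
apply: (big_morph f) => // x y.
by rewrite -{1}[y]opprK fB -[- y in LHS]sub0r fB f0 sub0r opprK.
Qed.

(** A separability idempotent: the sum of u.1 (x) u.2 has product 1 and commutes with B. Biadditive
    maps into arbitrary groups replace the tensor product over the integers. *)
Definition casimir (B : pzRingType) (s : seq (B * B)) :=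
  \sum_(u <- s) u.1 * u.2 = 1 /\
  forall (V : zmodType) (f : B -> B -> V),
    (forall y, {morph f^~ y : x x' / x - x'}) -> (forall x, {morph f x : y y' / y - y'}) ->
    forall b, \sum_(u <- s) f (b * u.1) u.2 = \sum_(u <- s) f u.1 (u.2 * b).

(** The usual element, the sum of E_i0 (x) E_0i, commutes with scalars only over F. As [f] is merely
    biadditive, it is summed over all a (x) a^-1, and multiplication by a nonzero scalar just
    permutes the a. The term a = 0 vanishes since 0^-1 = 0. *)
Lemma mx_casimir (F : finFieldType) n (V : zmodType)
    (f : 'M[F]_n.+1 -> 'M[F]_n.+1 -> V) (Y : 'M[F]_n.+1) :
  (forall y, {morph f^~ y : x x' / x - x'}) -> (forall x, {morph f x : y y' / y - y'}) ->
  \sum_i \sum_a f (Y * (a *: delta_mx i ord0)) (a^-1 *: delta_mx ord0 i) =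
  \sum_i \sum_a f (a *: delta_mx i ord0) ((a^-1 *: delta_mx ord0 i) * Y).
Proof.
move=> fl fr.
have f0l y : f 0 y = 0 by have := fl y 0 0; rewrite /= !subrr.
have f0r x : f x 0 = 0 by have := fr x 0 0; rewrite /= !subrr.
have L i a : Y * (a *: delta_mx i ord0) = \sum_l (Y l i * a) *: delta_mx l ord0.
  rewrite {1}(matrix_sum_delta Y) mulr_suml; apply: eq_bigr => l _.
  rewrite mulr_suml (bigD1 i) //= big1 ?addr0 => [|m mi].
    by rewrite -scalerAl -scalerAr -mulmxE mul_delta_mx scalerA.
  by rewrite -scalerAl -scalerAr -mulmxE mul_delta_mx_0 // !scaler0.
have R i a : (a^-1 *: delta_mx ord0 i) * Y = \sum_m (a^-1 * Y i m) *: delta_mx ord0 m.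
  rewrite {1}(matrix_sum_delta Y) mulr_sumr (bigD1 i) //= [X in _ + X]big1 ?addr0 => [|l li].
    rewrite mulr_sumr; apply: eq_bigr => m _.
    by rewrite -scalerAl -scalerAr -mulmxE mul_delta_mx scalerA.
  rewrite mulr_sumr big1 // => m _.
  by rewrite -scalerAl -scalerAr -mulmxE mul_delta_mx_0 ?scaler0 // eq_sym.
transitivity (\sum_i \sum_l \sum_a
    f ((Y l i * a) *: delta_mx l ord0) (a^-1 *: delta_mx ord0 i)).
  apply: eq_bigr => i _; rewrite exchange_big; apply: eq_bigr => a _ /=.
  by rewrite L (morphB_sum _ _ (fl _)).
transitivity (\sum_l \sum_i \sum_a
    f (a *: delta_mx l ord0) ((a^-1 * Y l i) *: delta_mx ord0 i)); last first.
  apply: eq_bigr => i _; rewrite exchange_big; apply: eq_bigr => a _ /=.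
  by rewrite R (morphB_sum _ _ (fr _)).
rewrite exchange_big; apply: eq_bigr => l _; apply: eq_bigr => i _.
have [->|Y0] := eqVneq (Y l i) 0.
  rewrite !big1 // => a _; first by rewrite mulr0 scale0r f0r.
  by rewrite mul0r scale0r f0l.
rewrite [RHS](reindex (fun a => Y l i * a)) /=; last first.
  by exists (fun a => (Y l i)^-1 * a) => a _; rewrite mulrA ?mulVf ?mulfV ?mul1r.
by apply: eq_bigr => a _; rewrite invfM mulrAC mulVf // mul1r.
Qed.

(** Each E_ii is counted once for every unit of F, that is |F| - 1 = -1 times. This is the reason
    for the minus sign in [exists_casimir]. *)
Lemma mx_casimir_sum (F : finFieldType) n :
  \sum_i \sum_(a : F) (a *: delta_mx i ord0) * (a^-1 *: delta_mx ord0 i) = -1 :> 'M[F]_n.+1.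
Proof.
transitivity (\sum_i (-1 : F) *: (delta_mx i i : 'M[F]_n.+1)); last first.
  by rewrite -scaler_sumr -mx1_sum_delta scaleN1r.
apply: eq_bigr => i _; rewrite (bigD1 0) //= scale0r mul0r add0r.
transitivity (\sum_(a : F | a != 0) (delta_mx i i : 'M[F]_n.+1)).
  apply: eq_bigr => a a0; rewrite -scalerAl -scalerAr scalerA mulfV // scale1r.
  by rewrite -mulmxE mul_delta_mx.
rewrite sumr_const -scaler_nat; congr (_ *: _).
have [p p_pr pF] := finPcharP F.
have FE : #|F|%:R = 0 :> F.
  apply/eqP; rewrite -(dvdn_pcharf pF) (card_pprimeChar pF).
  have : (0 < logn p #|F|)%N.
    rewrite lt0n; apply/eqP => l0; have := card_finField_gt1 F.
    by rewrite (card_pprimeChar pF) l0.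
  by case: (logn p #|F|) => // m _; rewrite expnS dvdn_mulr.
have -> : #|[pred a : F | a != 0]| = #|F|.-1 by rewrite -(cardC1 (0 : F)).
apply/eqP; rewrite -addr_eq0 natr1 prednK; first by rewrite FE.
exact: ltnW (card_finField_gt1 F).
Qed.

Variables (k : finFieldType) (B : pzRingType) (rho : {rmorphism k -> B}).
Local Notation q := #|k|.
Variable w : wedderburn rho.
Local Notation z := (@wed_blk _ _ _ w).

Lemma exists_casimir : exists s : seq (B * B), casimir s.
Proof.
pose M j := 'M[GF (q ^ (blk_r (z j)).+1)]_((blk_n (z j)).+1).
pose f j (X : M j) := sval (cid (wed_section X)).
have fE j X : blk_proj (z j) (f j X) = X := (svalP (cid (wed_section X))).1.
have f0 j X i : i != j -> blk_proj (z i) (f j X) = 0.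
  exact: (svalP (cid (wed_section X))).2.
have fB j : {morph f j : X Y / X - Y}.
  move=> X Y; apply: (wed_inj (w := w)) => i; rewrite rmorphB.
  by have [->|ij] := eqVneq i j; [rewrite !fE|rewrite !f0 // subrr].
have fMl j b X : b * f j X = f j (blk_proj (z j) b * X).
  apply: (wed_inj (w := w)) => i; rewrite rmorphM.
  by have [->|ij] := eqVneq i j; [rewrite !fE|rewrite !f0 // mulr0].
have fMr j b X : f j X * b = f j (X * blk_proj (z j) b).
  apply: (wed_inj (w := w)) => i; rewrite rmorphM.
  by have [->|ij] := eqVneq i j; [rewrite !fE|rewrite !f0 // mul0r].
pose c j i a : B * B := (f j (a *: delta_mx i ord0), - f j (a^-1 *: delta_mx ord0 i)).
pose s := flatten [seq flatten [seq [seq c j i a | a <- enum {: GF (q ^ (blk_r (z j)).+1)}]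
  | i <- enum {: 'I_(blk_n (z j)).+1}] | j <- enum 'I_(wed_s w)].
have sumE (V : zmodType) (G : B * B -> V) :
    \sum_(u <- s) G u = \sum_j \sum_i \sum_a G (c j i a).
  rewrite big_flatten big_map big_enum; apply: eq_bigr => j _.
  rewrite big_flatten big_map big_enum; apply: eq_bigr => i _.
  by rewrite big_map big_enum.
exists s; split=> [|V g gl gr b]; last first.
  rewrite !sumE; apply: eq_bigr => j _.
  pose h X Y := g (f j X) (- f j Y).
  have hl Y : {morph h^~ Y : X X' / X - X'} by move=> X X'; rewrite /h fB gl.
  have hr X : {morph h X : Y Y' / Y - Y'}.
    by move=> Y Y'; rewrite /h fB -gr opprB opprK addrC.
  have := mx_casimir (blk_proj (z j) b) hl hr.
  rewrite /h /c /= => e; transitivity (\sum_i \sum_a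
      g (f j (blk_proj (z j) b * (a *: delta_mx i ord0))) (- f j (a^-1 *: delta_mx ord0 i))).
    by apply: eq_bigr => i _; apply: eq_bigr => a _; rewrite fMl.
  rewrite e; apply: eq_bigr => i _; apply: eq_bigr => a _.
  by rewrite mulNr fMr.
apply: (wed_inj (w := w)) => j; rewrite sumE rmorph_sum (bigD1 j) //= [X in _ + X]big1.
  rewrite addr0 rmorph1 -[RHS]opprK -mx_casimir_sum -sumrN rmorph_sum.
  apply: eq_bigr => i _; rewrite -sumrN rmorph_sum; apply: eq_bigr => a _.
  by rewrite /c /= mulrN rmorphN rmorphM !fE.
move=> i ij; rewrite rmorph_sum big1 // => l _; rewrite rmorph_sum big1 // => a _.
by rewrite /c /= mulrN rmorphN rmorphM f0 1?eq_sym // mul0r oppr0.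
Qed.

End Casimir.

(** * Ideals of maximal orders *)

Section IdealInversion.
Variable L : pzRingType.
Implicit Types (I J M Y : set L) (m n : nat).

Definition multiples n : set L := [set x | exists t, x = t *+ n].

Lemma multiples_ideal n : is_ideal (multiples n).
Proof.
split; first split.
- by exists 0; rewrite mul0rn.
- by move=> _ _ [x ->] [y ->]; exists (x - y); rewrite mulrnBl.
- by move=> a _ [x ->]; exists (a * x); rewrite mulrnAr.
- by move=> a _ [x ->]; exists (x * a); rewrite mulrnAl.
Qed.

(** The ideals of finite index; for an order these are the ideals spanning the algebra. *)
Definition full_ideal I := is_ideal I /\ exists2 m, (0 < m)%N & I m%:R.

Lemma full_ideal_multiples I m : is_ideal I -> I m%:R -> multiples m `<=` I.
Proof. by move=> iI Im _ [t ->]; rewrite -mulr_natr; apply: ideal_mull. Qed.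

Lemma add_group_premuln I n : add_group I -> add_group [set x | I (x *+ n)].
Proof.
move=> [I0 IB]; split=> [|x y] /=; first by rewrite mul0rn.
by move=> Ix Iy; rewrite mulrnBl; apply: IB.
Qed.

Hypothesis torsion_free : forall n (x : L), (0 < n)%N -> x *+ n = 0 -> x = 0.
Hypothesis finite_mod : forall n, (0 < n)%N -> exists l : seq L,
  forall x, exists2 y, y \in l & multiples n (x - y).
(* If [(y / n) I] is contained in [I], then [y / n] is in [L]. *)
Hypothesis left_order : forall I n y, full_ideal I -> (0 < n)%N ->
  (forall z, I z -> exists2 x, I x & y * z = x *+ n) -> multiples n y.

Lemma mulrn_inj n (x y : L) : (0 < n)%N -> x *+ n = y *+ n -> x = y.
Proof.
move=> n0 e; apply/eqP; rewrite -subr_eq0; apply/eqP/(torsion_free n0).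
by rewrite mulrnBl e subrr.
Qed.

(** The number of representatives modulo m outside I stands in for the length of L/I in
    inductions. *)
Lemma exists_colength m : (0 < m)%N -> exists mu : set L -> nat, forall I J,
  is_ideal I -> is_ideal J -> I m%:R -> I `<=` J -> ~ J `<=` I -> (mu J < mu I)%N.
Proof.
move=> m0; have [l lP] := finite_mod m0.
exists (fun I => count (fun y => `[< ~ I y >]) l) => I J iI iJ Im IJ /existsNP[x /not_implyP[Jx nIx]].
have Jm := IJ _ Im; have gI := ideal_add_group iI; have gJ := ideal_add_group iJ.
have [y yl xy] := lP x.
have Jy : J y.
  by rewrite -[y](subKr x); apply: gJ.2 => //; apply: full_ideal_multiples xy.
have nIy : ~ I y.
  move=> Iy; apply: nIx; rewrite -[x](subrK y); apply: add_groupD => //.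
  exact: full_ideal_multiples xy.
elim: l yl {lP} => // a l IH; rewrite inE => /predU1P[<-|/IH lt] /=.
  case: asboolP => // _; case: asboolP => // _; rewrite add1n add0n ltnS.
  by apply: sub_count => b /asboolP nJb; apply/asboolP => Ib; apply: nJb; exact: IJ.
apply: leq_ltn_trans (_ : _ <= `[< ~ I a >] + _)%N _; last by rewrite ltn_add2l; exact: lt.
by rewrite leq_add2r; do 2?case: asboolP => //; move=> nI nJ; case: nI => Ia; apply: nJ; exact: IJ.
Qed.

Lemma finite_full_quotient I (iI : is_ideal I) : (exists2 m, (0 < m)%N & I m%:R) ->
  finite_set [set: quot_ring (Ideal iI)].
Proof.
move=> [m m0 Im]; have [l lP] := finite_mod m0.
apply: (finite_setT_cover (l := [seq to_quot (Ideal iI) y | y <- l])) => v.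
have [x <-] := to_quot_surj v; have [y yl xy] := lP x.
apply/mapP; exists y => //; apply/to_quotP => /=.
exact: full_ideal_multiples xy.
Qed.

Definition max_ideal M :=
  [/\ full_ideal M, ~ M 1 & forall J, is_ideal J -> M `<=` J -> J 1 \/ J `<=` M].

Definition ideal_prods (s : seq (set L)) : set L := foldr (@ideal_prod L) setT s.

Lemma ideal_prods_ideal s : (forall M, M \in s -> is_ideal M) -> is_ideal (ideal_prods s).
Proof.
elim: s => [//|M s IH] sI /=; apply: ideal_prod_ideal => a x.
  by apply: ideal_mull; apply: sI; rewrite inE eqxx.
by apply: ideal_mulr; apply: IH => N Ns; apply: sI; rewrite inE Ns orbT.
Qed.

Lemma ideal_prods_cat s t : (forall M, M \in t -> is_ideal M) ->
  ideal_prods (s ++ t) = ideal_prod (ideal_prods s) (ideal_prods t).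
Proof.
move=> tI; have it := ideal_prods_ideal tI.
elim: s => [|M s IH] /=; last by rewrite IH ideal_prodA.
apply/seteqP; split=> [x tx|]; first by rewrite -[x]mul1r; apply: mem_ideal_prod.
apply: ideal_prod_sub => [|a x _]; first exact: ideal_add_group.
exact: ideal_mull.
Qed.

Lemma full_ideal_prods s : (forall M, M \in s -> full_ideal M) -> full_ideal (ideal_prods s).
Proof.
move=> sF; split; first by apply: ideal_prods_ideal => M /sF[].
elim: s sF => [|M s IH] sF /=; first by exists 1%N.
have [|n n0 sn] := IH; first by move=> N Ns; apply: sF; rewrite inE Ns orbT.
have [_ [m m0 Mm]] : full_ideal M by apply: sF; rewrite inE eqxx.
by exists (m * n)%N; rewrite ?muln_gt0 ?m0 // natrM; apply: mem_ideal_prod.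
Qed.

(** J is I + L x L; the last clause tests inclusions into any additive group on generators. *)
Lemma ideal_addgen I x : is_ideal I ->
  exists J, [/\ is_ideal J, I `<=` J, J x &
    forall Z, add_group Z -> I `<=` Z -> (forall a b, Z (a * x * b)) -> J `<=` Z].
Proof.
move=> iI; exists [set z | forall Z, add_group Z -> I `<=` Z ->
  (forall a b, Z (a * x * b)) -> Z z].
split=> [|z Iz Z _ IZ _|Z _ _ Zx|Z gZ IZ Zx z]; last 3 first.
- exact: IZ.
- by rewrite -[x]mulr1 -[x]mul1r.
- by apply.
split; first split=> [Z []//|u v Hu Hv Z gZ IZ Zx|a u Hu Z gZ IZ Zx].
- by apply: gZ.2; [exact: Hu|exact: Hv].
- apply: (Hu [set t | Z (a * t)]) => [|t It|b c] /=; first exact: add_group_preml.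
    by apply: IZ; apply: ideal_mull.
  by rewrite !mulrA; exact: Zx.
- move=> a u Hu Z gZ IZ Zx.
  apply: (Hu [set t | Z (t * a)]) => [|t It|b c] /=; first exact: add_group_premr.
    by apply: IZ; apply: ideal_mulr.
  by rewrite -mulrA; exact: Zx.
Qed.

(** By induction on the colength it is enough to find two strictly larger ideals with product in I.
    If L/I is not semiprime, some I + L x L has its square in I. If it is semiprime but has a proper
    nonzero ideal, a central idempotent e in that ideal gives I + L e L and I + L (1 - e) L. *)
Lemma ideal_contains_prods I : full_ideal I ->
  exists s, (forall M, M \in s -> max_ideal M) /\ ideal_prods s `<=` I.
Proof.
move=> [iI [m m0 Im]]; have [mu muP] := exists_colength m0.
elim: {I}(mu I) {-2}I (leqnn (mu I)) iI Im => [|N IH] I lemu iI Im.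
  suff I1 : I 1 by exists [::]; split=> // x _; rewrite (ideal_full iI I1).
  apply: contrapT => nI1.
  suff : (mu setT < mu I)%N by rewrite ltnNge (leq_trans lemu).
  by apply: muP => //; move/(_ 1 Logic.I).
have [I1|nI1] := pselect (I 1).
  by exists [::]; split=> // x _; rewrite (ideal_full iI I1).
have IH' J : is_ideal J -> I `<=` J -> ~ J `<=` I ->
    exists s, (forall M, M \in s -> max_ideal M) /\ ideal_prods s `<=` J.
  move=> iJ IJ nJI; apply: IH => //; last exact: IJ.
  by rewrite -ltnS (leq_trans (muP I J iI iJ Im IJ nJI)).
have split_prod A B : is_ideal A -> is_ideal B -> I `<=` A -> I `<=` B ->
    ~ A `<=` I -> ~ B `<=` I -> (forall x y, A x -> B y -> I (x * y)) ->
    exists s, (forall M, M \in s -> max_ideal M) /\ ideal_prods s `<=` I.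
  move=> iA iB IA IB nA nB AB.
  have [s [sM sA]] := IH' A iA IA nA; have [t [tM tB]] := IH' B iB IB nB.
  exists (s ++ t); split=> [M|]; first by rewrite mem_cat => /orP[/sM|/tM].
  rewrite ideal_prods_cat; last by move=> M /tM[[]].
  apply: subset_trans (ideal_prodS sA tB) _.
  by apply: ideal_prod_sub => //; exact: ideal_add_group.
have gI := ideal_add_group iI.
have [sp|nsp] := pselect (forall x, (forall a, I (x * a * x)) -> I x); last first.
  move/existsNP: nsp => [x /not_implyP[xax nIx]].
  have [J [iJ IJ Jx Jgen]] := ideal_addgen x iI.
  have nJ : ~ J `<=` I by move/(_ x Jx).
  apply: (split_prod J J) => // u v Ju; move: v; apply: (Jgen).
  - exact: add_group_preml.
  - by move=> t It /=; apply: ideal_mull.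
  - move=> a b /=; move: u Ju; apply: Jgen.
    + exact: add_group_premr.
    + by move=> t It /=; apply: ideal_mulr.
    + move=> c d /=; rewrite -!mulrA (mulrA d) (mulrA x) (mulrA _ x b) (mulrA c).
      by rewrite -(mulrA c) mulrA; apply: ideal_mulr => //; rewrite -mulrA;
         apply: ideal_mull => //; rewrite mulrA; exact: xax.
pose Q := quot_ring (Ideal iI).
have fQ : finite_set [set: Q] by apply: finite_full_quotient; exists m.
have spQ : semiprime_ring Q.
  move=> y; have [x <-] := to_quot_surj y => xax; apply/to_quot_eq0/sp => a.
  by apply/(@to_quot_eq0 _ (Ideal iI)); rewrite !rmorphM.
have [maxI|] := pselect (forall J, is_ideal J -> I `<=` J -> J 1 \/ J `<=` I).
  exists [:: I]; split=> [M|]; first by rewrite inE => /eqP ->; split=> //; split=> //; exists m.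
  by apply: ideal_prod_sub => // x y Ix _; apply: ideal_mulr.
move=> /existsNP[J /not_implyP[iJ /not_implyP[IJ /not_orP[J1 nJI]]]].
pose J' : set Q := [set y | exists2 x, J x & to_quot (Ideal iI) x = y].
have gJ := ideal_add_group iJ.
have iJ' : is_ideal J'.
  split; first split.
  - by exists 0; [case: gJ|rewrite rmorph0].
  - by move=> _ _ [x Jx <-] [y Jy <-]; exists (x - y); [exact: gJ.2|rewrite rmorphB].
  - move=> a _ [x Jx <-]; have [b <-] := to_quot_surj a.
    by exists (b * x); [exact: ideal_mull|rewrite rmorphM].
  - move=> a _ [x Jx <-]; have [b <-] := to_quot_surj a.
    by exists (x * b); [exact: ideal_mulr|rewrite rmorphM].
have [|eps [[e Je <-] e0 ee eC]] := semiprime_central_idempotent spQ fQ iJ'.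
  move/existsNP: nJI => [x /not_implyP[Jx nIx]].
  by exists (to_quot (Ideal iI) x); [exists x|move/to_quot_eq0].
have [A [iA IA Ae Agen]] := ideal_addgen e iI.
have [C [iC IC Ce Cgen]] := ideal_addgen (1 - e) iI.
have AC x y : A x -> C y -> I (x * y).
  move=> Ax; move: y; apply: Cgen; first exact: add_group_preml.
    by move=> t It /=; apply: ideal_mull.
  move=> a b /=; move: x Ax; apply: Agen; first exact: add_group_premr.
    by move=> t It /=; apply: ideal_mulr.
  move=> c d /=; apply/(@to_quot_eq0 _ (Ideal iI)).
  rewrite !rmorphM rmorphB rmorph1; set E := to_quot _ e in ee eC *.
  rewrite -!mulrA; suff -> : E * (to_quot _ d * (to_quot _ a * ((1 - E) * to_quot _ b))) = 0.
    by rewrite mulr0.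
  rewrite !mulrA -(eC (to_quot _ d)) -(mulrA _ E) -(eC (to_quot _ a)).
  by rewrite mulrA -(mulrA _ E) mulrBr mulr1 ee subrr mulr0 mul0r.
apply: (split_prod A C) => //.
  by move/(_ e Ae) => /(@to_quot_eq0 _ (Ideal iI)).
move/(_ _ Ce)/IJ => J1e; apply: J1; rewrite -[1](subrK e).
exact: add_groupD.
Qed.

Lemma proper_ideal_max I : full_ideal I -> ~ I 1 -> exists2 M, max_ideal M & I `<=` M.
Proof.
move=> [iI [m m0 Im]] nI1; have [mu muP] := exists_colength m0.
have [M [iM IM nM1] Mmin] : exists2 M, [/\ is_ideal M, I `<=` M & ~ M 1] &
    forall J, [/\ is_ideal J, I `<=` J & ~ J 1] -> (mu M <= mu J)%N.
  by apply: (exists_minimal mu); exists I; split.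
exists M => //; split=> //; first by split=> //; exists m => //; apply: IM.
move=> J iJ MJ; have [J1|nJ1] := pselect (J 1); [by left|right].
apply: contrapT => nJM; have := muP M J iM iJ (IM _ Im) MJ nJM.
by rewrite ltnNge Mmin //; split=> //; apply: subset_trans IM MJ.
Qed.

Lemma max_ideal_prime M J K : max_ideal M -> is_ideal J -> is_ideal K ->
  (forall x y, J x -> K y -> M (x * y)) -> J `<=` M \/ K `<=` M.
Proof.
move=> [[iM _] M1 Mmax] iJ iK JK; have gM := ideal_add_group iM.
have [|nJ] := pselect (J `<=` M); [by left|right=> y Ky].
move/existsNP: nJ => [x /not_implyP[Jx nMx]].
have [Z [iZ MZ Zx Zgen]] := ideal_addgen x iM.
have [Z1|ZM] := Mmax Z iZ MZ; last by case: nMx; exact: ZM.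
suff : Z `<=` [set t | M (t * y)] by move=> /(_ _ Z1) /=; rewrite mul1r.
apply: Zgen; first exact: add_group_premr.
  by move=> t Mt /=; apply: ideal_mulr.
by move=> a b /=; rewrite -!mulrA; apply: ideal_mull => //; apply: JK => //; exact: ideal_mull.
Qed.

Lemma max_ideal_contains_factor M s : max_ideal M -> (forall N, N \in s -> is_ideal N) ->
  ideal_prods s `<=` M -> exists2 N, N \in s & N `<=` M.
Proof.
move=> mM; elim: s => [|N s IH] sI sM.
  by case: mM => _ M1 _; case: M1; apply: sM.
have iN : is_ideal N by apply: sI; rewrite inE eqxx.
have sI' N' : N' \in s -> is_ideal N' by move=> N's; apply: sI; rewrite inE N's orbT.
have [|NM|/IH] := max_ideal_prime mM iN (ideal_prods_ideal sI').
- by move=> x y Nx sy; apply: sM; exact: mem_ideal_prod.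
- by exists N => //; rewrite inE eqxx.
- by move=> [//|N' N's N'M]; exists N' => //; rewrite inE N's orbT.
Qed.

(** The inverse of I scaled by m, so that fractional ideals are handled inside L: y stands for the
    fraction y / m, which multiplies I into L. *)
Definition inverse_multiple I m : set L := [set y | forall z, I z -> multiples m (y * z)].

Lemma inverse_multiple_ideal I m : is_ideal I -> is_ideal (inverse_multiple I m).
Proof.
move=> iI; have im := multiples_ideal m; have gm := ideal_add_group im.
split; first split=> [z _|x y Hx Hy z Iz|a x Hx z Iz].
- by rewrite mul0r; case: gm.
- by rewrite mulrBl; apply: gm.2; [exact: Hx|exact: Hy].
- by rewrite -mulrA; apply: ideal_mull => //; exact: Hx.
- by move=> a x Hx z Iz; rewrite -mulrA; apply: Hx; exact: ideal_mull.
Qed.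

Lemma inverse_multiple_nat I m : is_ideal I -> inverse_multiple I m m%:R.
Proof. by move=> iI z Iz; exists z; rewrite mulr_natl. Qed.

(** As y I lies in m L, the element z y maps I into m I, and [left_order] applies to it. The inverse
    thus multiplies I into L from both sides. *)
Lemma inverse_multiple_right I m y z : full_ideal I -> (0 < m)%N ->
  inverse_multiple I m y -> I z -> multiples m (z * y).
Proof.
move=> fI m0 Yy Iz; apply: (left_order fI m0) => z' Iz'.
have [t tE] := Yy z' Iz'; exists (z * t); last by rewrite -mulrA tE mulrnAr.
by apply: ideal_mulr => //; case: fI.
Qed.

(* With a product of maximal ideals of minimal length inside mL, one factor
   may be rotated to the right and dropped. *)
Lemma inverse_multiple_proper I : full_ideal I -> ~ I 1 ->
  exists m y, [/\ (0 < m)%N, inverse_multiple I m y & ~ multiples m y].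
Proof.
move=> fI nI1; have [iI [m m0 Im]] := fI.
have [M mM IM] := proper_ideal_max fI nI1.
have fm : full_ideal (multiples m).
  by split; [exact: multiples_ideal|exists m => //; exists 1].
have [s [sM sm] smin] : exists2 s, (forall M, M \in s -> max_ideal M) /\
      ideal_prods s `<=` multiples m &
    forall t, (forall M, M \in t -> max_ideal M) /\ ideal_prods t `<=` multiples m ->
      (size s <= size t)%N.
  by apply: (exists_minimal size); exact: ideal_contains_prods.
have Mm : multiples m `<=` M.
  by case: mM => -[iM _] _ _; apply: full_ideal_multiples => //; exact: IM.
have [|N Ns NM] := max_ideal_contains_factor mM _ (subset_trans sm Mm).
  by move=> N /sM[[]].
have MN : M `<=` N.
  have [_ _ Nmax] := sM _ Ns; have [[iM _] M1 _] := mM.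
  by have [] := Nmax M iM NM.
case/splitPr: s / Ns sM sm smin => s1 s2 sM sm smin.
have s1M M' : M' \in s1 -> max_ideal M'.
  by move=> h; apply: sM; rewrite mem_cat h.
have s2M M' : M' \in s2 -> max_ideal M'.
  by move=> h; apply: sM; rewrite mem_cat inE h !orbT.
have NM' : max_ideal N by apply: sM; rewrite mem_cat inE eqxx orbT.
have nsub : ~ ideal_prods (s2 ++ s1) `<=` multiples m.
  move=> h; have := smin (s2 ++ s1); rewrite !size_cat /= addnS addnC ltnn => H.
  suff : false by [].
  by apply: H; split=> // M'; rewrite mem_cat => /orP[/s2M|/s1M].
have f2 : full_ideal (ideal_prods s2) by apply: full_ideal_prods => M' /s2M[].
have [y [sy ny]] : exists y, ideal_prods (s2 ++ s1) y /\ ~ multiples m y.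
  by move/existsNP: nsub => [y /not_implyP[? ?]]; exists y.
(* The left order of the product of [s2] is used: y is a sum of c a with c from [s2] and a from
   [s1], and a z w lies in the product of [s1], N and [s2], hence in m L. *)
exists m, y; split=> // z Iz; apply: (left_order f2 m0) => w s2w.
move: y sy {ny}; rewrite ideal_prods_cat; last by move=> M' /s1M[[]].
have [i2 _] := f2; have g2 := ideal_add_group i2.
apply: (@ideal_prod_sub _ _ _ [set y | exists2 x, ideal_prods s2 x & y * z * w = x *+ m]).
  split=> [|u v [u' su' hu] [v' sv' hv]] /=.
    by exists 0; [case: g2|rewrite !mul0r mul0rn].
  by exists (u' - v'); [exact: g2.2|rewrite !mulrBl hu hv mulrnBl].
move=> c a s2c s1a /=; have [t tE] : multiples m (a * (z * w)).
  apply: sm; rewrite ideal_prods_cat /=; last first.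
    by move=> M'; rewrite inE => /predU1P[->|/s2M[[]]//]; case: NM' => -[].
  apply: mem_ideal_prod => //; apply: mem_ideal_prod => //; exact/MN/IM.
exists (c * t); first exact: ideal_mulr.
by rewrite -!mulrA tE mulrnAr.
Qed.

(** Noetherian induction. Dividing Y I by m gives an ideal I' containing I, and strictly: otherwise
    y / m would preserve I and lie in L. If Y' inverts I', then Y' Y inverts I. *)
Lemma left_inverse_exists I : full_ideal I ->
  exists2 m, (0 < m)%N & ideal_prod (inverse_multiple I m) I m%:R.
Proof.
move=> [iI [m0 m00 Im0]]; have [mu muP] := exists_colength m00.
elim: {I}(mu I).+1 {-2}I (ltnSn (mu I)) iI Im0 => // N IH I lemu iI Im0.
have [I1|nI1] := pselect (I 1).
  exists 1%N => //; rewrite -[1%:R]mul1r; apply: mem_ideal_prod => //.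
  by move=> x _; exists (1 * x).
have fI : full_ideal I by split=> //; exists m0.
have [m [y [mpos Yy nmy]]] := inverse_multiple_proper fI nI1.
set Y := inverse_multiple I m in Yy.
have iY : is_ideal Y := inverse_multiple_ideal m iI.
have iP : is_ideal (ideal_prod Y I).
  by apply: ideal_prod_ideal => a x; [exact: ideal_mull|exact: ideal_mulr].
have gP := ideal_add_group iP.
pose I' : set L := [set x | ideal_prod Y I (x *+ m)].
have iI' : is_ideal I'.
  have [h0 hB] := add_group_premuln m gP.
  split; first split; [exact: h0|exact: hB| |].
    by move=> a x; rewrite /I' /= -mulrnAr; exact: ideal_mull.
  by move=> a x; rewrite /I' /= -mulrnAl; exact: ideal_mulr.
have II' : I `<=` I'.
  move=> x Ix; rewrite /I' /= -mulr_natl; apply: mem_ideal_prod => //.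
  exact: inverse_multiple_nat.
have nI'I : ~ I' `<=` I.
  move=> I'I; apply: nmy; apply: (left_order fI mpos) => z Iz.
  have [t tE] := Yy z Iz; exists t => //; apply: I'I.
  by rewrite /I' /= -tE; apply: mem_ideal_prod.
have [|m' m'0] := IH I' _ iI' (II' _ Im0).
  exact: leq_trans (muP I I' iI iI' Im0 II' nI'I) lemu.
set Y' := inverse_multiple I' m' => Ym'.
exists (m' * m)%N; first by rewrite muln_gt0 m'0.
rewrite mulrnA.
have gQ := ideal_prod_group (inverse_multiple I (m' * m)) I.
suff : ideal_prod Y' I' `<=` [set x | ideal_prod (inverse_multiple I (m' * m)) I (x *+ m)].
  by apply.
apply: ideal_prod_sub; first exact: add_group_premuln.
move=> y' x Y'y' I'x /=; rewrite -mulrnAr.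
suff : ideal_prod Y I `<=` [set v | ideal_prod (inverse_multiple I (m' * m)) I (y' * v)].
  by apply.
apply: ideal_prod_sub; first exact: add_group_preml.
move=> v z Yv Iz /=; rewrite mulrA; apply: mem_ideal_prod => // z1 Iz1.
have [t tE] := Yv z1 Iz1.
have [u uE] : multiples m' (y' * t).
  by apply: Y'y'; rewrite /I' /= -tE; apply: mem_ideal_prod.
by exists u; rewrite -mulrA tE mulrnAr uE mulrnA.
Qed.

(** Let Q = I I^-1. Since I^-1 I = L, one has Q I = I, so every element of Q^-1 maps I into I and
    lies in L by [left_order]. The left inverse of Q therefore puts 1 in Q. *)
Lemma inverse_exists I : full_ideal I -> exists m, [/\ (0 < m)%N,
  ideal_prod (inverse_multiple I m) I m%:R & ideal_prod I (inverse_multiple I m) m%:R].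
Proof.
move=> fI; have [iI [a a0 Ia]] := fI; have [m m0 YI] := left_inverse_exists fI.
exists m; split=> //; set Y := inverse_multiple I m in YI *.
have iY : is_ideal Y := inverse_multiple_ideal m iI.
have gI := ideal_add_group iI.
have iP : is_ideal (ideal_prod I Y).
  by apply: ideal_prod_ideal => b x; [exact: ideal_mull|exact: ideal_mulr].
pose Q : set L := [set x | ideal_prod I Y (x *+ m)].
have iQ : is_ideal Q.
  have [h0 hB] := add_group_premuln m (ideal_add_group iP).
  split; first split; [exact: h0|exact: hB| |].
    by move=> b x; rewrite /Q /= -mulrnAr; exact: ideal_mull.
  by move=> b x; rewrite /Q /= -mulrnAl; exact: ideal_mulr.
have gQ := ideal_add_group iQ.
have fQ : full_ideal Q.
  split=> //; exists a => //; rewrite /Q /= -[_ *+ m]mulr_natr; apply: mem_ideal_prod => //.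
  exact: inverse_multiple_nat.
have IQI z : I z -> ideal_prod Q I z.
  move=> Iz; have : exists2 v, ideal_prod Q I v & z * m%:R = v *+ m.
    suff : ideal_prod Y I `<=` [set w | exists2 v, ideal_prod Q I v & z * w = v *+ m].
      by apply.
    apply: ideal_prod_sub.
      have [g0 gB] := ideal_prod_group Q I.
      split=> [|u v [u' su' hu] [v' sv' hv]] /=; first by exists 0; rewrite ?mulr0 ?mul0rn.
      by exists (u' - v'); [exact: gB|rewrite mulrBr hu hv mulrnBl].
    move=> y z1 Yy Iz1 /=; have [x xE] := inverse_multiple_right fI m0 Yy Iz.
    exists (x * z1); last by rewrite mulrA xE mulrnAl.
    by apply: mem_ideal_prod => //; rewrite /Q /= -xE; apply: mem_ideal_prod.
  by move=> [v Qv]; rewrite mulr_natr => /(mulrn_inj m0) ->.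
have [n n0 YQ] := left_inverse_exists fQ.
have Yn y : inverse_multiple Q n y -> multiples n y.
  move=> Yy; apply: (left_order fI n0) => z /IQI.
  apply: (@ideal_prod_sub _ _ _ [set v | exists2 x, I x & y * v = x *+ n]).
    split=> [|u v [u' su' hu] [v' sv' hv]] /=.
      by exists 0; [case: gI|rewrite mulr0 mul0rn].
    by exists (u' - v'); [exact: gI.2|rewrite mulrBr hu hv mulrnBl].
  move=> x z1 Qx Iz1 /=; have [t tE] := Yy x Qx.
  by exists (t * z1); [exact: ideal_mull|rewrite mulrA tE mulrnAl].
have [v Qv] : exists2 v, Q v & n%:R = v *+ n.
  move: YQ; apply: (@ideal_prod_sub _ _ _ [set w | exists2 v, Q v & w = v *+ n]).
    split=> [|_ _ [u Qu ->] [v Qv ->]]; first by exists 0; [case: gQ|rewrite mul0rn].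
    by exists (u - v); [exact: gQ.2|rewrite mulrnBl].
  move=> y x /Yn[t ->] Qx /=; exists (t * x); last by rewrite mulrnAl.
  exact: (ideal_mull t iQ Qx).
by move/(mulrn_inj n0) => e; move: Qv; rewrite -e.
Qed.

(** To contain is to divide: N = J (J^-1 N), and the second factor is an ideal of L consisting of
    elements x with J x inside N. *)
Lemma ideal_left_divide J N : full_ideal J -> is_ideal N -> N `<=` J ->
  N `<=` ideal_prod J [set x | forall j, J j -> N (j * x)].
Proof.
move=> fJ iN NJ; set I := [set x | _].
have [m [m0 YJ JY]] := inverse_exists fJ; set Y := inverse_multiple J m in YJ JY.
have gN := ideal_add_group iN; move=> x Nx.
have : exists2 v, ideal_prod J I v & m%:R * x = v *+ m.
  suff : ideal_prod J Y `<=` [set w | exists2 v, ideal_prod J I v & w * x = v *+ m].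
    by apply.
  apply: ideal_prod_sub.
    have [g0 gB] := ideal_prod_group J I.
    split=> [|u v [u' su' hu] [v' sv' hv]] /=; first by exists 0; rewrite ?mul0r ?mul0rn.
    by exists (u' - v'); [exact: gB|rewrite mulrBl hu hv mulrnBl].
  move=> j y Jj Yy /=; have [t tE] := Yy x (NJ _ Nx).
  exists (j * t); last by rewrite -mulrA tE mulrnAr.
  apply: mem_ideal_prod => // j' Jj'.
  have [u uE] := inverse_multiple_right fJ m0 Yy Jj'.
  have -> : j' * t = u * x.
    by apply: (mulrn_inj m0); rewrite -mulrnAr -tE mulrA uE mulrnAl.
  exact: ideal_mull.
by move=> [v Jv]; rewrite mulr_natl => /(mulrn_inj m0) ->.
Qed.

Lemma ideal_prod_cancel J M : full_ideal J -> is_ideal M ->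
  J `<=` ideal_prod J M -> M 1.
Proof.
move=> fJ iM JM; have [m [m0 YJ JY]] := inverse_exists fJ.
set Y := inverse_multiple J m in YJ JY; have gM := ideal_add_group iM.
have gS : add_group [set w | exists2 v, M v & w = v *+ m].
  split=> [|_ _ [u Mu ->] [v Mv ->]]; first by exists 0; [case: gM|rewrite mul0rn].
  by exists (u - v); [exact: gM.2|rewrite mulrnBl].
have [v Mv] : exists2 v, M v & m%:R = v *+ m.
  move: YJ; apply: (ideal_prod_sub gS) => y j Yy Jj.
  move: j {Jj}(JM j Jj).
  apply: (@ideal_prod_sub _ _ _ [set j | exists2 v, M v & y * j = v *+ m]).
    exact: (add_group_preml y gS).
  move=> j z Jj Mz /=; have [t tE] := Yy j Jj.
  by exists (t * z); [exact: ideal_mull|rewrite mulrA tE mulrnAl].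
by move/(mulrn_inj m0) => e; move: Mv; rewrite -e.
Qed.

End IdealInversion.

(** * Lifting generators modulo a radical *)

Section Lift.
Variables (k : finFieldType) (B : pzRingType) (rho : {rmorphism k -> B}).
Variable w : wedderburn rho.
Local Notation z := (@wed_blk _ _ _ w).
Variables (L : pzRingType) (pi : {rmorphism L -> B}) (Z E : set L).
Hypothesis pi_surj : forall b, exists x, pi x = b.
Hypothesis pi_Z : pi @` Z = range rho.
Hypothesis torsion_free : forall n (x : L), (0 < n)%N -> x *+ n = 0 -> x = 0.
Hypothesis finite_mod : forall n, (0 < n)%N -> exists l : seq L,
  forall x, exists2 y, y \in l & multiples n (x - y).
Hypothesis left_order : forall (I : set L) n y, full_ideal I -> (0 < n)%N ->
  (forall z, I z -> exists2 x, I x & y * z = x *+ n) -> multiples n y.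

(** In the application [Z] is the image of R in Lambda, [E] is P Lambda, and some power of the
    kernel lies in [E]. *)
Definition ker_pi : set L := [set x | pi x = 0].
Local Notation J := ker_pi.
Hypothesis full_ker : full_ideal J.
Hypothesis E_ideal : is_ideal E.
Variable N0 : nat.
Hypothesis ker_nilpotent : forall l : seq L, size l = N0.+1 ->
  (forall x, x \in l -> J x) -> E (\prod_(x <- l) x).

Variable m : nat.
Local Notation gen a := (subring_gen (Z `|` range (a : 'I_m -> L))).

Let iJ : is_ideal J. Proof. by case: full_ker. Qed.
Let gJ : add_group J. Proof. exact: ideal_add_group. Qed.

Lemma lift_gen_congr (I : set L) a a' : is_ideal I -> (forall i, I (a i - a' i)) ->
  forall x, gen a x -> exists2 y, gen a' y & I (x - y).
Proof.
move=> iI aa'; apply: subring_gen_congr => // x [Zx|[i _ <-]].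
  by exists x; [apply: subring_gen_in; left|rewrite subrr; case: (ideal_add_group iI)].
by exists (a' i) => //; apply: subring_gen_in; right; exists i.
Qed.

Variable a : 'I_m -> L.
Hypothesis a_gen : subring_gen (range rho `|` range (pi \o a)) = setT.

Lemma lift_surj v b : (forall i, J (v i)) -> exists2 s, gen (fun i => a i + v i) s & pi s = b.
Proof.
move=> Jv; apply: subring_gen_morph_lift.
have : subring_gen (range rho `|` range (pi \o a)) b by rewrite a_gen.
apply: subring_genS => x [|[i _ <-]].
  by rewrite -pi_Z => -[y Zy <-]; exists y => //; left.
exists (a i + v i); first by right; exists i.
by rewrite rmorphD Jv addr0.
Qed.

Section Block.
Variable j : 'I_(wed_s w).

Definition blk_kernel : set L := [set x | blk_proj (z j) (pi x) = 0].
Local Notation M := blk_kernel.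

Lemma blk_kernel_ideal : is_ideal M.
Proof.
split; first split=> [|x y|b x]; rewrite /blk_kernel /=.
- by rewrite !rmorph0.
- by rewrite !rmorphB => -> ->; rewrite subrr.
- by rewrite !rmorphM => ->; rewrite mulr0.
- by move=> b x; rewrite /blk_kernel /= !rmorphM => ->; rewrite mul0r.
Qed.

(** J / J M is an ideal of square zero in L / J M, and it is nonzero because J can be cancelled. *)
Definition lift_kernel : set L := ideal_prod J M.
Local Notation N := lift_kernel.

Lemma lift_kernel_ideal : is_ideal N.
Proof.
apply: ideal_prod_ideal => b x; first exact: ideal_mull.
exact: (ideal_mulr b blk_kernel_ideal).
Qed.

Lemma lift_kernelJ x y : J x -> J y -> N (x * y).
Proof. by move=> Jx Jy; apply: mem_ideal_prod => //; rewrite /blk_kernel /= Jy rmorph0. Qed.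

Lemma lift_kernel_sub : N `<=` J.
Proof. by apply: ideal_prod_sub => // x y Jx _; apply: ideal_mulr. Qed.

Lemma lift_kernel_proper : exists2 v, J v & ~ N v.
Proof.
apply: contrapT => /forall2NP H.
have /(ideal_prod_cancel torsion_free finite_mod left_order full_ker blk_kernel_ideal) : J `<=` N.
  by move=> x Jx; have [|/contrapT] := H x.
by rewrite /blk_kernel /= !rmorph1 => /eqP; rewrite oner_eq0.
Qed.

Let Q := quot_ring (Ideal lift_kernel_ideal).
Let qt : {rmorphism L -> Q} := @to_quot L (Ideal lift_kernel_ideal).

(* If every lift were bad, each lift of the generators would span a section of
   pi modulo N; the Casimir element makes any two such sections conjugate by an
   element of 1 + J/N, and there are too few of these. *)
Lemma good_block_lift : (1 < m)%N \/ (0 < m)%N /\ (forall x y : L, x * y = y * x) ->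
  exists v, (forall i, J (v i)) /\
    exists s, [/\ gen (fun i => a i + v i) s, J s & ~ N s].
Proof.
move=> hm; apply: contrapT => /forallNP H.
have bad v : (forall i, J (v i)) -> forall s, gen (fun i => a i + v i) s -> J s -> N s.
  by move=> Jv s gs Js; apply: contrapT => nN; apply: (H v); split=> //; exists s.
have [cas [cas1 casE]] := exists_casimir w.
pose T := {v : 'I_m -> L | forall i, J (v i)}.
(* By [bad], elements of the subring with equal image in B agree modulo N, so this is a ring
   section. *)
pose sec (v : T) b := qt (sval (cid2 (lift_surj b (svalP v)))).
have secE (v : T) s : gen (fun i => a i + sval v i) s -> sec v (pi s) = qt s.
  move=> gs; rewrite /sec; case: cid2 => s' /= gs' ss'.
  apply/to_quotP; apply: (bad _ (svalP v)); first exact: subring_genB.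
  by rewrite /ker_pi /= rmorphB ss' subrr.
have lift2 (v : T) b : exists2 s, gen (fun i => a i + sval v i) s & pi s = b.
  exact: lift_surj (svalP v).
have secB v : {morph sec v : b c / b - c}.
  move=> b c; have [s gs <-] := lift2 v b; have [t gt <-] := lift2 v c.
  by rewrite -rmorphB !secE ?rmorphB //; exact: subring_genB.
have secM v : {morph sec v : b c / b * c}.
  move=> b c; have [s gs <-] := lift2 v b; have [t gt <-] := lift2 v c.
  by rewrite -rmorphM !secE ?rmorphM //; exact: subring_genM.
have seca (v : T) i : sec v (pi (a i)) = qt (a i + sval v i).
  rewrite -(secE v); first by rewrite rmorphD (svalP v i) addr0.
  by apply: subring_gen_in; right; exists i.
have J0 (i : 'I_m) : J ((fun=> 0) i) by exact: rmorph0.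
pose v0 : T := exist _ (fun=> 0) J0.
(* The Wedderburn-Malcev conjugation: invariance of the Casimir element makes c v intertwine the two
   sections, and it lies in 1 + J/N, hence is invertible. *)
pose c v := \sum_(u <- cas) sec v u.1 * sec v0 u.2.
have cC v b : sec v b * c v = c v * sec v0 b.
  rewrite mulr_sumr mulr_suml.
  have := casE Q (fun x y => sec v x * sec v0 y) _ _ b.
  rewrite /= => e; transitivity (\sum_(u <- cas) sec v (b * u.1) * sec v0 u.2).
    by apply: eq_bigr => u _; rewrite secM mulrA.
  rewrite e => [|y x x' |x y y'].
  - by apply: eq_bigr => u _; rewrite secM mulrA.
  - by rewrite secB mulrBl.
  - by rewrite secB mulrBr.
have c1 v : exists2 u, J u & c v = 1 + qt u.
  pose s (u : B * B) := sval (cid2 (lift_surj u.1 (svalP v))) *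
    sval (cid2 (lift_surj u.2 (svalP v0))).
  exists (\sum_(u <- cas) s u - 1) ; last first.
    rewrite rmorphB rmorph1 addrC subrK rmorph_sum.
    by apply: eq_bigr => u _; rewrite rmorphM.
  rewrite /ker_pi /= rmorphB rmorph1 -cas1 rmorph_sum -sumrB big1 // => u _.
  by rewrite rmorphM /s; case: cid2 => x /= _ ->; case: cid2 => y /= _ ->; rewrite subrr.
have cinv v : exists d, c v * d = 1.
  have [u Ju ->] := c1 v; exists (1 - qt u).
  have -> : (1 + qt u) * (1 - qt u) = 1 - qt (u * u).
    by rewrite mulrDl mul1r mulrBr mulr1 rmorphM addrA subrK.
  suff -> : qt (u * u) = 0 by rewrite subr0.
  by apply/to_quot_eq0; exact: lift_kernelJ.
have ceq v v' : c v = c v' -> forall i, N (sval v i - sval v' i).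
  move=> cc i; have [d cd] := cinv v.
  have : sec v (pi (a i)) = sec v' (pi (a i)).
    by rewrite -[LHS]mulr1 -[RHS]mulr1 -cd !mulrA cC cc cC.
  rewrite !seca => /to_quotP /=.
  by rewrite opprD addrACA subrr add0r.
have [y Jy nNy] := lift_kernel_proper.
have gN := ideal_add_group lift_kernel_ideal.
(* In the commutative case all sections coincide, although changing a lift by y outside N changes
   its class. *)
case: hm => [m1|[mpos comm]]; last first.
  have J1 (i : 'I_m) : J ((fun=> y) i) by [].
  have := seca (exist _ (fun=> y) J1) (Ordinal mpos).
  have -> : sec (exist _ (fun=> y) J1) (pi (a (Ordinal mpos))) = sec v0 (pi (a (Ordinal mpos))).
    have QC (x x' : Q) : x * x' = x' * x.
      have [t <-] := to_quot_surj x; have [t' <-] := to_quot_surj x'.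
      by rewrite -!to_quotM comm.
    have [d cd] := cinv (exist _ (fun=> y) J1).
    by rewrite -[LHS]mulr1 -[RHS]mulr1 -cd !mulrA cC [c _ * _]QC.
  rewrite seca /= addr0 => /esym/to_quotP /=.
  by rewrite addrC addKr; apply: nNy.
have fQ : finite_set [set: Q].
  apply: finite_full_quotient => //; have [_ [n n0 Jn]] := full_ker.
  by exists (n * n)%N; rewrite ?muln_gt0 ?n0 // natrM; exact: lift_kernelJ.
have [n [g [g' gK g'K]]] := finite_set_enum fQ.
pose S := [set i : 'I_n | `[< exists2 u, J u & qt u = g i >]]%SET.
have SP i : i \in S -> exists2 u, J u & qt u = g i by rewrite !inE.
pose lift i := if pselect (exists2 u, J u & qt u = g i) is left h then sval (cid2 h) else 0.
have liftJ i : J (lift i).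
  by rewrite /lift; case: pselect => [h|_]; [case: cid2|exact: rmorph0].
have liftE i : i \in S -> qt (lift i) = g i.
  by move=> /SP h; rewrite /lift; case: pselect => // h'; case: cid2.
pose i0 : 'I_m := Ordinal (ltnW m1); pose i1 : 'I_m := Ordinal m1.
(* Varying two coordinates suffices: it gives |J/N|^2 lifts with distinct conjugators, which all lie
   in 1 + J/N. *)
pose v2 (x : 'I_n * 'I_n) (i : 'I_m) :=
  if i == i0 then lift x.1 else if i == i1 then lift x.2 else 0.
have Jv2 x i : J (v2 x i).
  by rewrite /v2; case: ifP => // _; case: ifP => // _; exact: rmorph0.
pose V x : T := exist _ (v2 x) (Jv2 x).
have FS x : g' (c (V x) - 1) \in S.
  have [u Ju ->] := c1 (V x); rewrite !inE g'K.
  by exists u => //; rewrite addrC addKr.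
have Finj : {in finset.setX S S &, injective (fun x => g' (c (V x) - 1))}.
  move=> [x1 x2] [y1 y2]; rewrite !finset.in_setX => /andP[/= Sx1 Sx2] /andP[/= Sy1 Sy2].
  move=> /(can_inj g'K)/(@addIr Q) cc.
  have eqS (u v : 'I_n) : u \in S -> v \in S -> N (lift u - lift v) -> u = v.
    by move=> Su Sv /(to_quotP (Ideal lift_kernel_ideal))/= e; apply: (can_inj gK);
       rewrite -!liftE.
  have e0 := ceq _ _ cc i0; have e1 := ceq _ _ cc i1.
  rewrite /= /v2 eqxx in e0; rewrite /= /v2 eqxx -val_eqE /= in e1.
  by rewrite (eqS _ _ Sx1 Sy1 e0) (eqS _ _ Sx2 Sy2 e1).
have cS : (1 < #|S|)%N.
  apply/card_gt1P; exists (g' 0), (g' (qt y)); split; rewrite ?inE ?g'K.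
  - by exists 0; [exact: rmorph0|rewrite rmorph0].
  - by exists y.
  - apply/eqP => /(can_inj g'K)/esym/to_quot_eq0; exact: nNy.
have : (#|S| * #|S| <= #|S|)%N.
  rewrite -cardsX -(card_in_imset Finj); apply/subset_leq_card/fintype.subsetP.
  by move=> _ /imsetP[x _ ->]; exact: FS.
by rewrite -{3}[#|S|]muln1 leq_pmul2l ?(ltnW cS) // leqNgt cS.
Qed.

End Block.

(** This is J^(n+1); the shift avoids the power L. *)
Definition ker_pow n : set L := iter n (ideal_prod J) J.

Lemma ker_pow_group n : add_group (ker_pow n).
Proof. by case: n => [//|n]; exact: ideal_prod_group. Qed.

Lemma ker_pow_prods n (X : set L) : add_group X ->
  (forall l : seq L, size l = n.+1 -> (forall x, x \in l -> J x) -> X (\prod_(x <- l) x)) ->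
  ker_pow n `<=` X.
Proof.
elim: n X => [|n IH] X gX HX.
  move=> x Jx; have := HX [:: x] erefl; rewrite big_seq1; apply=> y.
  by rewrite inE => /eqP ->.
apply: ideal_prod_sub => // x y Jx; move: y; apply: (IH [set y | X (x * y)]).
  exact: add_group_preml.
move=> l sl lJ /=; have := HX (x :: l); rewrite big_cons; apply; first by rewrite /= sl.
by move=> y; rewrite inE => /predU1P[->|/lJ].
Qed.

(** If the subring covers L/J and its part in J covers J/J^2, products show that it covers every
    J^n/J^(n+1). Successive approximation stops at J^(N0+1), inside [E]. *)
Lemma lift_nakayama a' : (forall x, exists2 s, gen a' s & J (x - s)) ->
  (forall x, J x -> exists2 s, gen a' s /\ J s & ideal_prod J J (x - s)) ->
  forall x, exists2 s, gen a' s & E (x - s).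
Proof.
move=> LS JS; set S := gen a' in LS JS *; have gS : add_group S := subring_gen_group _.
have step n x : ker_pow n x -> exists2 s, S s /\ ker_pow n s & ker_pow n.+1 (x - s).
  elim: n x => [|n IH]; first exact: JS.
  have [g0 gB] := ker_pow_group n.+1; have [h0 hB] := ker_pow_group n.+2.
  apply: (@ideal_prod_sub _ _ _ [set x | exists2 s, S s /\ ker_pow n.+1 s & ker_pow n.+2 (x - s)]).
    split=> [|x y [s [Ss ks] xs] [t [St kt] yt]].
      by exists 0; [split=> //; case: gS|rewrite subrr].
    exists (s - t); first by split; [exact: gS.2|exact: gB].
    have -> : x - y - (s - t) = (x - s) - (y - t) by rewrite opprD opprK addrACA opprB [t - y]addrC.
    exact: hB.
  move=> x y Jx ny; have [s [Ss Js] xs] := JS x Jx; have [t [St kt] yt] := IH y ny.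
  exists (s * t); first by split; [exact: subring_genM|exact: mem_ideal_prod].
  have -> : x * y - s * t = (x - s) * y + s * (y - t).
    by rewrite mulrBl mulrBr addrA subrK.
  apply: (add_groupD (ker_pow_group n.+2)).
    suff : ideal_prod J (ideal_prod J (ker_pow n)) ((x - s) * y) by [].
    by rewrite ideal_prodA; apply: mem_ideal_prod.
  exact: mem_ideal_prod.
have JSn n x : J x -> exists2 s, S s & ker_pow n (x - s).
  move=> Jx; elim: n => [|n [s Ss ns]].
    by exists 0; [case: gS|rewrite subr0].
  have [t [St _] nt] := step n _ ns.
  by exists (s + t); [exact: add_groupD|rewrite opprD addrA].
move=> x; have [s Ss Jxs] := LS x; have [t St nt] := JSn N0 _ Jxs.
exists (s + t); first exact: add_groupD.
rewrite opprD addrA; apply: (ker_pow_prods (ideal_add_group E_ideal) ker_nilpotent) nt.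
Qed.

Lemma lift_generators : (1 < m)%N \/ (0 < m)%N /\ (forall x y : L, x * y = y * x) ->
  exists a' : 'I_m -> L, forall x, exists2 s, gen a' s & E (x - s).
Proof.
move=> hm.
have [v vP] : exists v : 'I_(wed_s w) -> 'I_m -> L, forall j, (forall i, J (v j i)) /\
    exists s, [/\ gen (fun i => a i + v j i) s, J s & ~ lift_kernel j s].
  exists (fun j => sval (cid (good_block_lift j hm))) => j.
  exact: (svalP (cid (good_block_lift j hm))).
have [c cP] : exists c : 'I_(wed_s w) -> L, forall j, pi (c j) = blk_unit (z j).
  exists (fun j => sval (cid (pi_surj (blk_unit (z j))))) => j.
  exact: (svalP (cid (pi_surj (blk_unit (z j))))).
(* Weighting by lifts of the block units makes the new tuple congruent, modulo each J M_j, to the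
   lift chosen for block j. *)
pose d i := \sum_j v j i * c j.
have Jd i : J (d i).
  by apply: add_group_sum => // j _; apply: ideal_mulr => //; case: (vP j).
pose a' i := a i + d i; exists a'.
have near j i : lift_kernel j (a i + v j i - a' i).
  have [Jv _] := vP j; have gN := ideal_add_group (lift_kernel_ideal j).
  rewrite /a' opprD addrACA subrr add0r /d (bigD1 j) //= opprD addrA.
  apply: gN.2.
    rewrite -{1}[v j i]mulr1 -mulrBr; apply: mem_ideal_prod => //.
    by rewrite /blk_kernel /= rmorphB rmorph1 cP rmorphB rmorph1 blk_proj_unit subrr.
  apply: add_group_sum => // l lj; apply: mem_ideal_prod; first by case: (vP l).
  by rewrite /blk_kernel /= cP wed_proj_unit eq_sym (negPf lj).
set S := gen a'; have gS : add_group S := subring_gen_group _.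
have bigS j : exists2 s, S s /\ J s & ~ lift_kernel j s.
  have [_ [s [gs Js nNs]]] := vP j; have iN := lift_kernel_ideal j.
  have gN := ideal_add_group iN.
  have [s' gs' ss'] := lift_gen_congr iN (near j) gs.
  exists s'; last first.
    by move=> Ns'; apply: nNs; rewrite -[s](subrK s'); apply: (add_groupD gN).
  by split=> //; rewrite -[s'](subKr s); apply: gJ.2 => //; exact: lift_kernel_sub ss'.
have LS x : exists2 s, S s & J (x - s).
  have [s gs xs] := lift_surj (pi x) Jd; exists s => //.
  by rewrite /ker_pi /= rmorphB xs subrr.
have iJJ : is_ideal (ideal_prod J J).
  by apply: ideal_prod_ideal => b x; [exact: ideal_mull|exact: ideal_mulr].
have gJJ := ideal_add_group iJJ.
have JJ : ideal_prod J J `<=` J by apply: ideal_prod_sub => // x y Jx _; exact: ideal_mulr.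
pose N := [set x | exists2 s, S s /\ J s & ideal_prod J J (x - s)].
have NJ : N `<=` J.
  by move=> x [s [_ Js] /JJ xs]; rewrite -[x](subrK s); apply: (add_groupD gJ).
have gN : add_group N.
  split=> [|x y [s [Ss Js] xs] [t [St Jt] yt]].
    by exists 0; [split; [case: gS|case: gJ]|rewrite subrr; case: gJJ].
  exists (s - t); first by split; [exact: gS.2|exact: gJ.2].
  have -> : x - y - (s - t) = (x - s) - (y - t) by rewrite opprD opprK addrACA opprB [t - y]addrC.
  exact: gJJ.2.
have iN : is_ideal N.
  split; first split; [by case: gN|by case: gN|move=> b x|move=> b x];
    move=> [s [Ss Js] xs]; have [t St bt] := LS b.
  - exists (t * s); first by split; [exact: subring_genM|exact: ideal_mull].
    have -> : b * x - t * s = b * (x - s) + (b - t) * s by rewrite mulrBr mulrBl addrA subrK.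
    by apply: (add_groupD gJJ); [exact: (ideal_mull b iJJ xs)|exact: mem_ideal_prod].
  - exists (s * t); first by split; [exact: subring_genM|exact: ideal_mulr].
    have -> : x * b - s * t = (x - s) * b + s * (b - t) by rewrite mulrBr mulrBl addrA subrK.
    by apply: (add_groupD gJJ); [exact: (ideal_mulr b iJJ xs)|exact: mem_ideal_prod].
(* By division N = J I, and I contains J. If I vanished in block j, then N would lie in J M_j,
   against [bigS]; so I maps onto B, whence I = L and N = J. *)
pose I := [set x | forall y, J y -> N (y * x)].
have iI : is_ideal I.
  split; first split=> [y Jy|x y Ix Iy u Ju|b x Ix y Jy].
  - by rewrite mulr0; case: gN.
  - by rewrite mulrBr; apply: gN.2; [exact: Ix|exact: Iy].
  - by rewrite mulrA; apply: Ix; exact: ideal_mulr.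
  - by move=> b x Ix y Jy; rewrite mulrA; exact: (ideal_mulr b iN (Ix y Jy)).
have gI := ideal_add_group iI.
have JI : J `<=` I.
  move=> x Jx y Jy; exists 0; first by split; [case: gS|case: gJ].
  by rewrite subr0; exact: mem_ideal_prod.
have NI := ideal_left_divide torsion_free finite_mod left_order full_ker iN NJ.
have I1 : I 1.
  have proj j : exists2 x, I x & blk_proj (z j) (pi x) <> 0.
    apply: contrapT => /forall2NP H; have [s [Ss Js] nNs] := bigS j; apply: nNs.
    have /NI : N s by exists s => //; rewrite subrr; case: gJJ.
    apply: ideal_prodS => // x Ix; rewrite /blk_kernel /=; apply: contrapT => px.
    by have [] := H x.
  pose I' := [set b | exists2 x, I x & pi x = b].
  have iI' : is_ideal I'.
    split; first split.
    - by exists 0; [case: gI|rewrite rmorph0].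
    - by move=> _ _ [x Ix <-] [y Iy <-]; exists (x - y); [exact: gI.2|rewrite rmorphB].
    - move=> b _ [x Ix <-]; have [y <-] := pi_surj b.
      by exists (y * x); [exact: (ideal_mull y iI Ix)|rewrite rmorphM].
    - move=> b _ [x Ix <-]; have [y <-] := pi_surj b.
      by exists (x * y); [exact: (ideal_mulr y iI Ix)|rewrite rmorphM].
  have [x Ix x1] : I' 1.
    rewrite -(wed_sum w); apply: add_group_sum => [|j _]; first exact: ideal_add_group.
    have [x Ix px] := proj j.
    by apply: (ideal_blk_unit iI' _ px); exists x.
  rewrite -[1](subrK x); apply: (add_groupD gI) => //; apply: JI.
  by rewrite /ker_pi /= rmorphB x1 rmorph1 subrr.
apply: lift_nakayama => // x Jx.
by have := I1 x Jx; rewrite mulr1.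
Qed.

End Lift.

(** * Rings of integers and their maximal ideals *)

Section Integers.
Import Order.TTheory Num.Theory.
Variable K : fieldExtType rat.
Local Notation R := (ring_of_integers K).
Local Notation rval := (@subring_val K (integers K)).

Lemma rval_inj : injective rval.
Proof. exact: val_inj. Qed.

Lemma ring_of_integers_comm (x y : R) : x * y = y * x.
Proof. by apply: rval_inj; rewrite !rmorphM mulrC. Qed.

Lemma integersP (x : K) : reflect (exists y : R, rval y = x) (x \in integers K).
Proof. by apply: (iffP idP) => [Kx|[y <-]]; [exists (Sub x Kx)|exact: valP y]. Qed.

Lemma charK : [pchar K] =i pred0.
Proof. by move=> p; rewrite pchar_lalg pchar_num. Qed.

Lemma natK_eq0 n : (n%:R == 0 :> K) = (n == 0)%N.
Proof. by move: n; apply/pcharf0P; exact: charK. Qed.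

Lemma intK_eq0 (m : int) : (m%:~R == 0 :> K) = (m == 0).
Proof. by rewrite -(rmorph_int (GRing.in_alg K)) fmorph_eq0 intr_eq0. Qed.

Lemma ring_of_integers_torsion_free n (x : R) : (0 < n)%N -> x *+ n = 0 -> x = 0.
Proof.
move=> n0 /(congr1 rval); rewrite rmorphMn rmorph0 -mulr_natl => /eqP.
rewrite mulf_eq0 natK_eq0 eqn0Ngt n0 /= => /eqP x0.
by apply: rval_inj; rewrite x0 rmorph0.
Qed.

(** Multiplying a monic equation of degree n for 1/p by p^n would make p divide 1. *)
Lemma prime_inv_not_integer p (x : R) : prime p -> 1 <> x *+ p.
Proof.
move=> pp /(congr1 rval); rewrite rmorph1 rmorphMn; set u := rval x => u1.
have [f fmon /rootP] : integralOver (intr : int -> K) u.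
  by have /asboolP : rval x \in integers K by apply/integersP; exists x.
rewrite horner_coef size_map_poly_id0; last by rewrite (monicP fmon) oner_eq0.
case E: (size f) => [|n] fu.
  by move/eqP: E; rewrite size_poly_eq0 => /eqP f0; move: fmon; rewrite f0 monicE lead_coef0 eq_sym oner_eq0.
have fn : f`_n = 1 by move/monicP: fmon; rewrite lead_coefE E.
have pu i : (p%:R * u) ^+ i = 1 by rewrite mulr_natl -u1 expr1n.
have : (\sum_(i < n.+1) f`_i * (p%:Z) ^+ (n - i)) = 0.
  apply/eqP; rewrite -intK_eq0 rmorph_sum /=; apply/eqP.
  transitivity ((p%:R : K) ^+ n * \sum_(i < n.+1) (map_poly (intr : int -> K) f)`_i * u ^+ i).
    rewrite mulr_sumr; apply: eq_bigr => i _; rewrite coef_map rmorphM rmorphXn /=.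
    rewrite mulrCA; congr (_ * _).
    have -> : p%:R ^+ n = p%:R ^+ (n - i) * p%:R ^+ i :> K.
      by rewrite -exprD subnK // -ltnS ltn_ord.
    by rewrite -mulrA -exprMn pu mulr1.
  by rewrite fu mulr0.
rewrite big_ord_recr /= subnn expr0 mulr1 fn => /eqP; rewrite addrC addr_eq0 => /eqP e.
have : (p%:Z %| (1 : int)%R)%Z.
  rewrite e rpredN; apply: rpred_sum => i _.
  apply: dvdz_mull; rewrite -(prednK (_ : 0 < n - i)%N) ?subn_gt0 //.
  by rewrite exprS dvdz_mulr.
by rewrite dvdzE /= dvdn1 => /eqP p1; rewrite p1 in pp.
Qed.

(** x divides the constant term of a monic integer polynomial vanishing at x; for least degree this
    term is nonzero. *)
Lemma integer_divides_nat (x : R) : x <> 0 -> exists m s, (0 < m)%N /\ s * x = m%:R.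
Proof.
move=> x0; set u := rval x.
have u0 : u != 0.
  by apply/eqP => u0; apply: x0; apply: rval_inj; rewrite -/u u0 rmorph0.
have [f [fmon fu] fmin] : exists2 f : {poly int}, f \is monic /\ root (map_poly intr f) u &
    forall g : {poly int}, g \is monic /\ root (map_poly intr g) u -> (size f <= size g)%N.
  apply: (exists_minimal (fun g : {poly int} => size g)).
  have /asboolP[g gm gu] : u \in integers K by apply/integersP; exists x.
  by exists g.
have [c [g fE]] : exists c g, f = g * 'X + c%:P.
  have /factor_theorem[g gE] : root (f - (f`_0)%:P) 0.
    by rewrite /root hornerD hornerN hornerC horner_coef0 subrr.
  by exists f`_0, g; rewrite -[LHS](subrK (f`_0)%:P) gE subr0.
have gu : (map_poly (intr : int -> K) g).[u] * u = - c%:~R.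
  apply/eqP; rewrite -addr_eq0; move: fu; rewrite /root fE.
  by rewrite rmorphD rmorphM /= map_polyX map_polyC !hornerE.
have [c0|c0] := eqVneq c 0.
  move: fmon fmin; rewrite fE c0 addr0 => gm /(_ g).
  have gmon : g \is monic by move: gm; rewrite monicMr ?monicX.
  have g0 : g != 0 by apply: monic_neq0.
  rewrite size_mulX // ltnn => H; suff : false by [].
  apply: H; split=> //; apply/rootP/eqP.
  by move/eqP: gu; rewrite c0 oppr0 mulf_eq0 (negPf u0) orbF.
have /integersP[s sE] : (map_poly (intr : int -> K) g).[u] \in integers K.
  rewrite horner_coef; apply: rpred_sum => i _; apply: rpredM.
    by rewrite coef_map /=; apply: rpred_int.
  by apply: rpredX; apply/integersP; exists x.
exists `|c|%N, (if 0 <= c then - s else s); split; first by rewrite absz_gt0.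
apply: rval_inj; rewrite rmorphM rmorph_nat /= -/u.
case: ifP => [cge|clt].
  by rewrite rmorphN /= sE mulNr gu opprK -{1}(gez0_abs cge).
rewrite sE gu -rmorphN /= -[_%:R]/(`|c|%N%:Z%:~R : K) ltz0_abs //.
by rewrite ltNge clt.
Qed.

Lemma integral_multiple (x : K) : exists2 m, (0 < m)%N & m%:R * x \in integers K.
Proof.
have /polyOver1P[q qE] := minPolyOver 1%AS x.
have qmon : q \is monic by rewrite -(map_monic (GRing.in_alg K)) -qE monic_minPoly.
have [f [a a0 qf]] := rat_poly_scale q.
have fx : (map_poly (intr : int -> K) f).[x] = 0.
  have fq : map_poly intr f = a%:~R *: q by rewrite qf scalerA mulfV ?intr_eq0 // scale1r.
  have -> : map_poly (intr : int -> K) f = map_poly (GRing.in_alg K) (map_poly intr f).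
    by rewrite -map_poly_comp; apply: eq_map_poly => m; exact/esym/(rmorph_int (GRing.in_alg K)).
  rewrite fq map_polyZ -qE hornerZ.
  by have /rootP -> := root_minPoly 1%AS x; rewrite mulr0.
have [n fn lf] : exists2 n, size f = n.+2 & f`_n.+1 = a.
  have sq : size q = size f.
    rewrite qf size_scale ?invr_eq0 ?intr_eq0 // size_map_inj_poly //.
    exact: intr_inj.
  have := size_minPoly 1%AS x; rewrite qE size_map_poly sq => sf.
  have d0 : (0 < adjoin_degree 1%AS x)%N by [].
  case: (adjoin_degree 1%AS x) sf d0 => // n sf _; exists n; first exact: sf.
  move/monicP: qmon; rewrite lead_coefE sq sf /= qf coefZ coef_map /= => h.
  apply: (@intr_inj rat); rewrite -[RHS]mulr1 -[X in _ * X]h mulrA mulfV ?intr_eq0 // mul1r.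
  by [].
have ax : a%:~R * x \in integers K.
  apply/asboolP.
  (* The lower part of a^n f(X / a), which is monic as f has degree n.+1 and leading coefficient
     a. *)
  pose lo : {poly K} := \poly_(i < n.+1) ((f`_i)%:~R * a%:~R ^+ (n - i)).
  pose G : {poly K} := 'X^(n.+1) + lo.
  have szG : (size lo < size ('X^(n.+1) : {poly K}))%N.
    by rewrite size_polyXn ltnS size_poly.
  have Gmon : G \is monic by rewrite monicE lead_coefDl // lead_coefXn.
  apply: (integral_root_monic (RtoK := intr : int -> K) Gmon).
    apply/rootP; rewrite /G hornerD hornerXn /lo horner_poly.
    move: fx; rewrite horner_coef size_map_poly_id0; last first.
      by rewrite intK_eq0 lead_coef_eq0 -size_poly_eq0 fn.
    rewrite fn big_ord_recr /= coef_map /= lf => fx0.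
    transitivity ((a%:~R : K) ^+ n * 0); last by rewrite mulr0.
    rewrite -[X in _ = _ * X]fx0 addrC mulrDr mulr_sumr; congr (_ + _).
      by rewrite mulrA -exprSr exprMn.
    apply: eq_bigr => i _; rewrite coef_map /= -mulrA [RHS]mulrCA; congr (_ * _).
    by rewrite exprMn mulrA -exprD subnK // -ltnS ltn_ord.
  apply/integral_poly => i; rewrite /G coefD coefXn /lo coef_poly.
  have int_in (m : int) : integralOver (intr : int -> K) m%:~R by exact: integral_id.
  apply: integral_add; first exact: integral_nat.
  case: ifP => _; last exact: integral0.
  by rewrite -rmorphXn -rmorphM; exact: int_in.
exists `|a|%N; first by rewrite absz_gt0.
have [age|alt] := boolP (0 <= a).
  by rewrite -[_%:R]/(`|a|%N%:Z%:~R : K) gez0_abs.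
rewrite -[_%:R]/(`|a|%N%:Z%:~R : K) ltz0_abs ?ltNge //.
by rewrite rmorphN mulNr rpredN.
Qed.

Definition indep_mod p n (x : 'I_n -> R) := forall (c : 'I_n -> int) (y : R),
  \sum_i x i *~ c i = y *+ p -> forall i, (p%:Z %| c i)%Z.

(** Descent: more than dim K elements satisfy an integer relation. Independence modulo p makes all
    its coefficients divisible by p, and dividing gives a smaller relation. *)
Lemma indep_mod_bound p n (x : 'I_n -> R) : prime p -> indep_mod p x ->
  (n <= \dim {:K})%N.
Proof.
move=> pp xi; rewrite leqNgt; apply/negP => dn.
pose X := [tuple rval (x i) | i < n].
have Xnf : ~~ free X.
  rewrite /free size_tuple neq_ltn; apply/orP; left.
  by apply: leq_ltn_trans dn; apply: dimvS; exact: subvf.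
have [c [c0 cX]] : exists c : 'I_n -> rat, (exists i, c i != 0) /\ \sum_i c i *: rval (x i) = 0.
  have : ~ forall c : 'I_n -> rat, \sum_(i < n) c i *: X`_i = 0 -> forall i, c i = 0.
    by move/freeP => fX; rewrite fX in Xnf.
  move/existsNP => [c /not_implyP[cX /existsNP[i ci]]]; exists c; split; first by exists i; apply/eqP.
  rewrite -[RHS]cX; apply: eq_bigr => l _; congr (_ *: _).
  by rewrite -tnth_nth tnth_mktuple.
have [d [d0 dX]] : exists d : 'I_n -> int, (exists i, d i != 0) /\ \sum_i x i *~ d i = 0.
  pose P : {poly rat} := \poly_(i < n) (if insub i is Some j then c j else 0).
  have [f [a a0 Pf]] := rat_poly_scale P.
  have Pc (i : 'I_n) : P`_i = c i by rewrite coef_poly ltn_ord valK.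
  have fc (i : 'I_n) : (f`_i)%:~R = a%:~R * c i :> rat.
    by rewrite -Pc Pf coefZ coef_map /= mulrA mulfV ?intr_eq0 // mul1r.
  exists (fun i => f`_i); split.
    have [i ci] := c0; exists i; rewrite -(intr_eq0 rat) fc mulf_neq0 //.
    by rewrite intr_eq0.
  apply: rval_inj; rewrite rmorph_sum rmorph0 -[RHS](scaler0 _ (a%:~R : rat)).
  rewrite -[X in _ = _ *: X]cX scaler_sumr; apply: eq_bigr => i _.
  by rewrite rmorphMz scalerA -fc scaler_int.
have [e [e0 eX] emin] : exists2 e : 'I_n -> int, (exists i, e i != 0) /\ \sum_i x i *~ e i = 0 &
    forall e' : 'I_n -> int, (exists i, e' i != 0) /\ \sum_i x i *~ e' i = 0 ->
      (\sum_i `|e i|%N <= \sum_i `|e' i|%N)%N.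
  by apply: (exists_minimal (fun e : 'I_n -> int => \sum_i `|e i|%N)%N); exists d.
have pe i : (p%:Z %| e i)%Z by apply: (xi e 0); rewrite mul0rn.
have [e' eE] : exists e' : 'I_n -> int, forall i, e i = e' i * p%:Z.
  by exists (fun i => (e i %/ p%:Z)%Z) => i; rewrite divzK.
have [i ei] := e0; have p1 := prime_gt1 pp.
have := emin e'; rewrite leqNgt.
have -> : (\sum_i `|e' i|%N < \sum_i `|e i|%N)%N.
  have le l : (`|e' l| <= `|e l|)%N by rewrite (eE l) abszM leq_pmulr // ltnW.
  rewrite (bigD1 i) //= [X in (_ < X)%N](bigD1 i) //= -addSn leq_add ?leq_sum //.
  rewrite (eE i) abszM -[X in (X < _)%N]muln1 ltn_pmul2l //.
  by rewrite absz_gt0; apply: contra ei => /eqP e'0; rewrite eE e'0 mul0r.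
move=> H; suff : false by [].
apply: H; split.
  by exists i; apply: contra ei => /eqP e'0; rewrite eE e'0 mul0r.
apply: (@ring_of_integers_torsion_free p); first exact: ltnW.
rewrite -[RHS]eX -sumrMnl; apply: eq_bigr => l _.
by rewrite (eE l) mulrzA -pmulrn.
Qed.

(** Finiteness of R/pR without an integral basis: a longest family independent modulo p exists by
    the bound above, and it spans R/pR. *)
Lemma integers_finite_mod_prime p : prime p -> exists l : seq R,
  forall x, exists2 y, y \in l & multiples p (x - y).
Proof.
move=> pp; pose Q n := `[< exists x : 'I_n -> R, indep_mod p x >].
have Q0 : exists n, Q n.
  by exists 0%N; apply/asboolP; exists (fun=> 0) => c y _ [].
have QN n : Q n -> (n <= \dim {:K})%N by move=> /asboolP[x]; exact: indep_mod_bound.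
case: (ex_maxnP Q0 QN) => n /asboolP[x xi] nmax.
exists [seq \sum_i x i *+ ((c : {ffun 'I_n -> 'I_p}) i : nat) | c <- enum {: {ffun 'I_n -> 'I_p}}] => y.
pose x' (i : 'I_n.+1) := if unlift ord_max i is Some j then x j else y.
have : ~ indep_mod p x'.
  by move=> h; have /nmax : Q n.+1; [apply/asboolP; exists x'|rewrite ltnn].
move=> /existsNP[c /existsNP[u /not_implyP[cu /existsNP[i0 pci]]]].
have lw (j : 'I_n) : widen_ord (leqnSn n) j = lift ord_max j.
  by apply: val_inj; rewrite /= /bump leqNgt ltn_ord.
have cu' : \sum_j x j *~ c (lift ord_max j) + y *~ c ord_max = u *+ p.
  rewrite -cu big_ord_recr /= /x' unlift_none; congr (_ + _).
  by apply: eq_bigr => j _; rewrite lw liftK.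
have pc : ~~ (p%:Z %| c ord_max)%Z.
  apply/negP => /dvdzP[b bE].
  have pcj : forall j, (p%:Z %| c (lift ord_max j))%Z.
    apply: (xi (fun j => c (lift ord_max j)) (u - y *~ b)).
    rewrite mulrnBl -cu' bE mulrzA pmulrn addrK.
    by [].
  apply: pci; case: (unliftP ord_max i0) => [j ->|->]; first exact: pcj.
  by rewrite bE dvdz_mull.
have [a [b ab]] : exists a b : int, a * c ord_max = 1 + b * p%:Z.
  have : coprimez (c ord_max) p%:Z.
    by rewrite coprimezE coprime_sym prime_coprime // -dvdzE.
  move=> /coprimezP[[a b] /= e]; exists a, (- b).
  by rewrite -e mulNr addrK.
pose S := \sum_j x j *~ (c (lift ord_max j) * a).
have e1 : y *~ (c ord_max * a) = y + (y *~ b) *+ p.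
  by rewrite mulrC ab mulrzDr mulr1z mulrzA pmulrn.
have e2 : S + y *~ (c ord_max * a) = (u *~ a) *+ p.
  have -> : (u *~ a) *+ p = (u *+ p) *~ a.
    by rewrite !pmulrn -!mulrzA mulrC.
  rewrite -cu' mulrzDl -mulrzA; congr (_ + _).
  by rewrite mulrz_suml; apply: eq_bigr => j _; rewrite mulrzA.
have yE : y = (u *~ a - y *~ b) *+ p - S.
  by rewrite mulrnBl -e2 e1 addrA addrK addrAC subrr add0r.
have p0 : p%:Z != 0 by rewrite eqz_nat -lt0n prime_gt0.
have modlt (m : int) : (`|(m %% p%:Z)%Z|%N < p)%N.
  by rewrite -ltz_nat gez0_abs ?modz_ge0 // ltz_pmod // ltz_nat prime_gt0.
pose d := [ffun j => Ordinal (modlt (- (c (lift ord_max j) * a)))].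
exists (\sum_j x j *+ (d j : nat)); first by apply/mapP; exists d => //; rewrite mem_enum.
pose v j := (- (c (lift ord_max j) * a) %/ p%:Z)%Z.
exists (u *~ a - y *~ b + \sum_j x j *~ v j).
rewrite [RHS]mulrnDl {1}yE -addrA; congr (_ + _).
rewrite -sumrMnl -sumrN -sumrB; apply: eq_bigr => j _.
rewrite ffunE /= -mulrNz {1}(divz_eq (- (c (lift ord_max j) * a)) p%:Z) mulrzDr.
rewrite -/(v j) mulrzA -pmulrn; have := modz_ge0 (- (c (lift ord_max j) * a)) p0.
by move: (_ %% _)%Z => z z0; rewrite [X in _ - X]pmulrn gez0_abs // addrK.
Qed.

Lemma ring_of_integers_finite_mod n : (0 < n)%N -> exists l : seq R,
  forall x, exists2 y, y \in l & multiples n (x - y).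
Proof.
elim: n {-2}n (leqnn n) => [|N IH] n; first by rewrite leqn0 => /eqP ->.
rewrite leq_eqVlt => /predU1P[->|/IH//] _ {n}.
case: N IH => [|N] IH.
  by exists [:: 0] => x; exists 0; rewrite ?inE // subr0; exists x; rewrite mulr1n.
pose p := pdiv N.+2; have pp : prime p by rewrite pdiv_prime.
have [m nE] : exists m, N.+2 = (m * p)%N by apply/dvdnP; exact: pdiv_dvd.
have m0 : (0 < m)%N by case: m nE.
have mN : (m <= N.+1)%N.
  by rewrite -ltnS nE -[X in (X < _)%N]muln1 ltn_pmul2l // prime_gt1.
have [l lP] := integers_finite_mod_prime pp; have [l' l'P] := IH m mN m0.
exists [seq y + z *+ p | y <- l, z <- l'] => x.
have [y yl [t xy]] := lP x; have [z zl [s tz]] := l'P t.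
exists (y + z *+ p); first exact: allpairs_f.
by exists s; rewrite opprD addrA xy -mulrnBl tz nE mulrnA.
Qed.

End Integers.

Section MaximalIdeals.
Variable R : pzRingType.
Hypothesis R_comm : forall x y : R, x * y = y * x.
Hypothesis divides_nat : forall x : R, x <> 0 -> exists m s, (0 < m)%N /\ s * x = m%:R.
Hypothesis R_finite_mod : forall n, (0 < n)%N -> exists l : seq R,
  forall x, exists2 y, y \in l & multiples n (x - y).
Hypothesis prime_not_unit : forall p (x : R), prime p -> 1 <> x *+ p.

Lemma maximal_idealP (P : set R) : is_maximal_ideal P -> is_ideal P /\ ~ P 1.
Proof. by move=> [iP PT _]; split=> // P1; apply: PT; exact: ideal_full. Qed.

Lemma proper_ideal_maximal (I : set R) : full_ideal I -> ~ I 1 ->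
  exists2 P, is_maximal_ideal P & I `<=` P.
Proof.
move=> fI I1; have [P [[iP _] P1 Pmax] IP] := proper_ideal_max R_finite_mod fI I1.
exists P => //; split=> // [PT|J iJ PJ]; first by apply: P1; rewrite PT.
by have [/(ideal_full iJ)|JP] := Pmax J iJ PJ; [right|left; apply/seteqP].
Qed.

Lemma prime_in_maximal_ideal p : prime p -> exists2 P : set R, is_maximal_ideal P & P p%:R.
Proof.
move=> pp; have pI := multiples_ideal R p.
have [||P mP pP] := @proper_ideal_maximal (multiples p).
- split=> //; exists p; first exact: prime_gt0.
  by exists 1.
- by move=> [x]; exact: prime_not_unit.
by exists P => //; apply: pP; exists 1.
Qed.

Lemma maximal_ideal_inv (P : set R) x : is_maximal_ideal P -> ~ P x ->
  exists y, P (1 - y * x).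
Proof.
move=> [iP PT Pmax] Px; have gP := ideal_add_group iP.
pose J : set R := [set z | exists y, P (z - y * x)].
have iJ : is_ideal J.
  have JM a z : J z -> J (a * z).
    by move=> [y Hy]; exists (a * y); rewrite -mulrA -mulrBr; apply: ideal_mull.
  split; last by move=> a z Jz; rewrite R_comm; exact: JM.
  split=> //; first by exists 0; rewrite mul0r subr0; case: gP.
  move=> z z' [y Hy] [y' Hy']; exists (y - y').
  have -> : z - z' - (y - y') * x = (z - y * x) - (z' - y' * x).
    by rewrite mulrBl opprD opprK addrACA opprB [- z' + _]addrC.
  exact: gP.2.
have [|JP|JT] := Pmax J iJ.
- by move=> z Pz; exists 0; rewrite mul0r subr0.
- case: Px; rewrite -JP; exists 1; rewrite mul1r subrr; by case: gP.
by have : J 1 by rewrite JT.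
Qed.

(** P is nonzero: it contains 2 or some 1 - 2 y, and the latter is nonzero as 2 is not a unit. If 2
    were 0 in R, a maximal ideal containing 3 would contain 1. *)
Lemma maximal_ideal_nat (P : set R) : is_maximal_ideal P ->
  exists2 m, (0 < m)%N & P m%:R.
Proof.
move=> mP; have [iP _] := maximal_idealP mP.
suff [x x0 Px] : exists2 x, x <> 0 & P x.
  by have [m [s [m0 sx]]] := divides_nat x0; exists m => //; rewrite -sx; exact: ideal_mull.
have n20 (y : R) : 1 - y * 2 <> 0.
  by move/eqP; rewrite subr_eq0 mulr_natr => /eqP; exact: prime_not_unit.
have [P2|/(maximal_ideal_inv mP)[y Py]] := pselect (P 2); last by exists (1 - y * 2).
exists 2 => // R2; have [Q /maximal_idealP[iQ Q1] Q3] := prime_in_maximal_ideal (isT : prime 3).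
by apply: Q1; move: Q3; rewrite -[3%N]/(2 + 1)%N natrD R2 add0r.
Qed.

Lemma maximal_ideal_prime (P : set R) x y : is_maximal_ideal P -> P (x * y) -> P x \/ P y.
Proof.
move=> mP Pxy; have [iP _] := maximal_idealP mP.
have [?|Px] := pselect (P x); first by left.
have [z Hz] := maximal_ideal_inv mP Px; right.
rewrite -[y](subrK (z * x * y)); apply: (add_groupD (ideal_add_group iP)).
  by rewrite -[X in X - _]mul1r -mulrBl; exact: ideal_mulr.
by rewrite -mulrA; exact: ideal_mull.
Qed.

(** Such ideals contain a fixed integer m > 0, so each is determined by which of the finitely many
    representatives modulo m it contains. *)
Lemma maximal_ideals_containing (x : R) : x <> 0 -> exists l : seq (set R),
  forall P, is_maximal_ideal P -> P x -> P \in l.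
Proof.
move=> /divides_nat[m [s [m0 sx]]]; have [r rP] := R_finite_mod m0.
pose f (b : (size r).-tuple bool) : set R :=
  [set z | exists2 y, y \in mask b r & multiples m (z - y)].
exists [seq f b | b <- enum {: (size r).-tuple bool}] => P /maximal_idealP[iP _] Px.
have gP := ideal_add_group iP.
have mP : multiples m `<=` P.
  by apply: full_ideal_multiples => //; rewrite -sx; exact: ideal_mull.
apply/mapP; exists [tuple of map (fun y => `[< P y >]) (in_tuple r)]; first by rewrite mem_enum.
apply/seteqP; split=> [z Pz|z [y]] /=.
  have [y yr zy] := rP z; exists y => //; rewrite -filter_mask mem_filter yr andbT.
  apply/asboolP; rewrite -[y](subKr z); apply: gP.2 => //; exact: mP.
rewrite -filter_mask mem_filter => /andP[/asboolP Py _] /mP zy.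
by rewrite -[z](subrK y); exact: add_groupD.
Qed.

Lemma maximal_ideal_outside n : (0 < n)%N ->
  exists2 P : set R, is_maximal_ideal P & ~ P n%:R.
Proof.
move=> n0; have [p np pp] := prime_above n.
have [P mP Pp] := prime_in_maximal_ideal pp; exists P => // Pn.
have [iP P1] := maximal_idealP mP; apply: P1; have gP := ideal_add_group iP.
have := prime_coprime n pp; rewrite gtnNdvd //= coprime_sym => /eqP ncp.
have [a b e _] := egcdnP p n0; move: e; rewrite ncp => e.
have <- : a%:R * n%:R - b%:R * p%:R = 1 :> R.
  by rewrite -!natrM e natrD addrAC subrr add0r.
by apply: gP.2; exact: ideal_mull.
Qed.

Lemma maximal_ideal_sep (P Q : set R) : is_maximal_ideal P -> is_maximal_ideal Q ->
  P <> Q -> exists2 c, Q c & P (1 - c).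
Proof.
move=> mP mQ PQ; have [iQ Q1] := maximal_idealP mQ.
have [QP|/existsNP[x /not_implyP[Qx Px]]] := pselect (Q `<=` P).
  case: mP => iP PT _; case: mQ => _ _ /(_ P iP QP)[|] //.
have [y Hy] := maximal_ideal_inv mP Px; exists (y * x) => //; exact: ideal_mull.
Qed.

Lemma maximal_ideals_crt (l : seq (set R)) P : is_maximal_ideal P ->
  (forall Q, Q \in l -> is_maximal_ideal Q) ->
  exists2 e, P (1 - e) & forall Q, Q \in l -> Q <> P -> Q e.
Proof.
move=> mP; have [iP _] := maximal_idealP mP; have gP := ideal_add_group iP.
elim: l => [|Q l IH] lm; first by exists 1; rewrite ?subrr //; case: gP.
have [Q' Q'l|e Pe le] := IH; first by apply: lm; rewrite inE Q'l orbT.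
have mQ : is_maximal_ideal Q by apply: lm; rewrite inE eqxx.
have [<-|QP] := pselect (P = Q).
  by exists e => // Q'; rewrite in_cons => /predU1P[->|/le].
have [c Qc Pc] := maximal_ideal_sep mP mQ QP; exists (e * c).
  by rewrite -[X in P (X - _)](mulr1 1); exact: ideal_mul_congr.
move=> Q'; rewrite in_cons => /predU1P[->|Q'l] Q'P.
  by apply: ideal_mull => //; case: mQ.
by apply: ideal_mulr; [case: (lm Q' _); rewrite ?inE ?Q'l ?orbT|exact: le].
Qed.

End MaximalIdeals.

(** * From local to global generation *)

Section Algebra.
Variables (R L : pzRingType) (iota : {rmorphism R -> L}).
Hypothesis iotaC : forall c x, iota c * x = x * iota c.
Hypothesis R_comm : forall x y : R, x * y = y * x.
Variables (D : nat) (sg : 'I_D -> L).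
Hypothesis sg_span : forall x, exists c : 'I_D -> R, x = \sum_i iota (c i) * sg i.

(** This is P L, written on fixed module generators so that Nakayama's lemma can eliminate them one
    by one. *)
Definition extension (P : set R) : set L :=
  [set x | exists2 c : 'I_D -> R, forall i, P (c i) & x = \sum_i iota (c i) * sg i].

Section Ideal.
Variable P : set R.
Hypothesis iP : is_ideal P.
Let gP := ideal_add_group iP.

Lemma extension_group : add_group (extension P).
Proof.
split=> [|_ _ [c Pc ->] [d Pd ->]].
  exists (fun=> 0) => [_|]; first by case: gP.
  by rewrite big1 // => i _; rewrite rmorph0 mul0r.
exists (fun i => c i - d i) => [i|]; first exact: gP.2.
by rewrite -sumrB; apply: eq_bigr => i _; rewrite rmorphB mulrBl.
Qed.

Lemma mem_extension p x : P p -> extension P (iota p * x).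
Proof.
move=> Pp; have [c ->] := sg_span x; exists (fun i => p * c i) => [i|].
  exact: ideal_mulr.
by rewrite mulr_sumr; apply: eq_bigr => i _; rewrite mulrA rmorphM.
Qed.

Lemma extension_ideal : is_ideal (extension P).
Proof.
have [E0 EB] := extension_group; split; first split=> //.
  move=> a _ [c Pc ->]; rewrite mulr_sumr; apply: add_group_sum extension_group _ => i _.
  by rewrite mulrA -iotaC -mulrA; exact: mem_extension.
move=> a _ [c Pc ->]; rewrite mulr_suml; apply: add_group_sum extension_group _ => i _.
by rewrite -mulrA; exact: mem_extension.
Qed.

(** [T m] is S plus the combinations of the first m generators with coefficients in P. Eliminating
    generators one at a time takes the place of the determinant trick. *)
Lemma nakayama (S : set L) : add_group S -> (forall c x, S x -> S (iota c * x)) ->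
  (forall x, exists2 s, S s & extension P (x - s)) ->
  exists2 r, P (1 - r) & forall x, S (iota r * x).
Proof.
move=> gS SM LS.
pose T m : set L := [set x | exists2 s, S s & exists2 c : 'I_D -> R, forall i, P (c i) &
  x = s + \sum_(i < D | (i < m)%N) iota (c i) * sg i].
have TM m c x : T m x -> T m (iota c * x).
  move=> [s Ss [d Pd ->]]; exists (iota c * s); first exact: SM.
  exists (fun i => c * d i) => [i|]; first exact: ideal_mull.
  by rewrite mulrDr mulr_sumr; congr (_ + _); apply: eq_bigr => i _; rewrite mulrA rmorphM.
have gT m : add_group (T m).
  split=> [|_ _ [s Ss [c Pc ->]] [s' Ss' [c' Pc' ->]]].
    exists 0; first by case: gS.
    exists (fun=> 0) => [_|]; first by case: gP.
    by rewrite add0r big1 // => i _; rewrite rmorph0 mul0r.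
  exists (s - s'); first exact: gS.2.
  exists (fun i => c i - c' i) => [i|]; first exact: gP.2.
  rewrite opprD addrACA -sumrB; congr (_ + _).
  by apply: eq_bigr => i _; rewrite rmorphB mulrBl.
have TL m : exists2 r, P (1 - r) & forall x, T (D - m)%N (iota r * x).
  elim: m => [|m [r Pr rT]].
    exists 1 => [|x]; first by rewrite subrr; case: gP.
    have [s Ss [c Pc xs]] := LS x; exists s => //; exists c => //.
    rewrite rmorph1 mul1r subn0 -[LHS](subrK s) addrC xs; congr (_ + _).
    by apply: eq_bigl => i; rewrite ltn_ord.
  have [Dm|mD] := leqP D m.
    exists r => // x; have := rT x; have /eqP -> : (D - m == 0)%N by rewrite subn_eq0.
    by have /eqP -> : (D - m.+1 == 0)%N by rewrite subn_eq0 leqW.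
  have jP : (D - m.+1 < D)%N by rewrite subnSK // leq_subr.
  pose j := Ordinal jP.
  have Tj x : T (D - m)%N x -> exists2 p, P p & T (D - m.+1)%N (x - iota p * sg j).
    move=> [s Ss [c Pc ->]]; exists (c j) => //; exists s => //; exists c => //.
    rewrite (bigD1 j) /=; last by rewrite subnSK.
    rewrite addrCA [_ + (s + _)]addrC addrK; congr (_ + _); apply: eq_bigl => i.
    by rewrite -(subnSK mD) ltnS ltn_neqAle andbC.
  have [p Pp Tp] := Tj _ (rT (sg j)).
  (* Modulo the smaller T, r [sg j] is p [sg j] and r x is q [sg j]; so (r - p) kills [sg j], and
     then (r - p) r kills x. *)
  exists ((r - p) * r).
    rewrite -[X in P (X - _)](mulr1 1); apply: ideal_mul_congr => //.
    by rewrite opprB addrCA; apply: add_groupD => //.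
  move=> x; have [q Pq Tq] := Tj _ (rT x).
  rewrite rmorphM -mulrA -[iota r * x](subrK (iota q * sg j)) mulrDr.
  apply: (add_groupD (gT _)); first exact: TM.
  rewrite mulrA iotaC -!mulrA; apply: (TM).
  by rewrite rmorphB mulrBl.
have [r Pr rT] := TL D; exists r => // x; have [s Ss [c _ ->]] := rT x.
by rewrite subnn big_pred0 // addr0.
Qed.

End Ideal.

Definition generating_mod (P : set R) (s : seq L) := forall x,
  exists2 y, subring_gen (range iota `|` [set` s]) y & extension P (x - y).

Lemma subring_gen_scale (Z : set L) c x :
  subring_gen (range iota `|` Z) x -> subring_gen (range iota `|` Z) (iota c * x).
Proof. by move=> Sx; apply: subring_genM => //; apply: subring_gen_in; left; exists c. Qed.

Lemma generating_modS P s s' : {subset s <= s'} ->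
  generating_mod P s -> generating_mod P s'.
Proof.
move=> ss H x; have [y Sy xy] := H x; exists y => //; apply: subring_genS Sy.
by apply: setUS => z /= /ss.
Qed.

Lemma generating_mod_congr P s s' : is_ideal P -> size s = size s' ->
  (forall i, (i < size s)%N -> extension P (s`_i - s'`_i)) ->
  generating_mod P s' -> generating_mod P s.
Proof.
move=> iP ss sE H x; have [y Sy xy] := H x; have iE := extension_ideal iP.
have [|y' Sy' yy'] := subring_gen_congr iE _ Sy (Z' := range iota `|` [set` s]).
  move=> z [Zz|/= /(nthP 0)[i]].
    by exists z; [apply: subring_gen_in; left|rewrite subrr; case: (extension_group iP)].
  rewrite -ss => lti <-; exists s`_i; first by apply: subring_gen_in; right; exact: mem_nth.
  by rewrite -opprB; apply: add_groupN; [exact: extension_group|exact: sE].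
exists y' => //; rewrite -[x](subrK y) -addrA; exact: (add_groupD (extension_group iP)).
Qed.

Hypothesis divides_nat : forall x : R, x <> 0 -> exists m s, (0 < m)%N /\ s * x = m%:R.
Hypothesis R_finite_mod : forall n, (0 < n)%N -> exists l : seq R,
  forall x, exists2 y, y \in l & multiples n (x - y).
Hypothesis prime_not_unit : forall p (x : R), prime p -> 1 <> x *+ p.

Local Notation gen s := (subring_gen (range iota `|` [set` s])).

Lemma generating_mod_conductor P s : is_maximal_ideal P -> generating_mod P s ->
  exists2 r, r <> 0 & forall x, gen s (iota r * x).
Proof.
move=> mP; have [iP P1] := maximal_idealP mP => Ps.
have [|r Pr rS] := nakayama iP (@subring_gen_group _ _) _ Ps.
  by move=> c x; exact: subring_gen_scale.
by exists r => // r0; apply: P1; rewrite r0 subr0 in Pr.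
Qed.

Lemma generating_mod_outside P s r : is_maximal_ideal P -> ~ P r ->
  (forall x, gen s (iota r * x)) -> generating_mod P s.
Proof.
move=> mP Pr rS x; have [iP _] := maximal_idealP mP.
have [t Pt] := maximal_ideal_inv R_comm mP Pr.
exists (iota t * (iota r * x)); first exact: subring_gen_scale.
by rewrite mulrA -rmorphM -{1}[x]mul1r -(rmorph1 iota) -mulrBl -rmorphB; exact: mem_extension.
Qed.

Lemma generating_of_local s : (forall P, is_maximal_ideal P -> generating_mod P s) ->
  gen s = setT.
Proof.
move=> loc; pose I : set R := [set r | forall x, gen s (iota r * x)].
have gS : add_group (gen s) := subring_gen_group _.
have iI : is_ideal I.
  have IM a r : I r -> I (a * r).
    by move=> Ir x; rewrite rmorphM -mulrA; apply: subring_gen_scale.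
  split; last by move=> a r /IM Ir; rewrite R_comm.
  split=> // [x|r r' Ir Ir' x]; first by rewrite rmorph0 mul0r; case: gS.
  by rewrite rmorphB mulrBl; apply: gS.2.
suff I1 : I 1.
  by apply/seteqP; split=> // x _; rewrite -[x]mul1r -(rmorph1 iota); exact: I1.
apply: contrapT => I1.
have fI : full_ideal I.
  split=> //; have [P mP _] := prime_in_maximal_ideal R_finite_mod prime_not_unit (isT : prime 2).
  have [r /divides_nat[m [t [m0 tr]]] rS] := generating_mod_conductor mP (loc P mP).
  by exists m => //; rewrite -tr; exact: (ideal_mull t iI rS).
have [P mP IP] := proper_ideal_maximal R_finite_mod fI I1.
have [iP P1] := maximal_idealP mP.
have [|r Pr rS] := nakayama iP gS _ (loc P mP).
  by move=> c x; exact: subring_gen_scale.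
apply: P1; rewrite -[1](subrK r); apply: (add_groupD (ideal_add_group iP)) => //.
exact: IP.
Qed.

Lemma extension_crt (l : seq (set R)) (x : set R -> L) :
  (forall P, P \in l -> is_maximal_ideal P) ->
  exists y, forall P, P \in l -> extension P (y - x P).
Proof.
move=> lm.
have /choice[e eP] : forall P, exists e : R, P \in l ->
    P (1 - e) /\ forall Q, Q \in l -> Q <> P -> Q e.
  move=> P; have [Pl|_] := boolP (P \in l); last by exists 0.
  by have [e] := maximal_ideals_crt R_comm (lm P Pl) lm; exists e.
exists (\sum_(Q <- undup l) iota (e Q) * x Q) => P Pl.
have [Pe _] := eP P Pl; have [iP _] := maximal_idealP (lm P Pl).
have gE := extension_group iP.
rewrite (bigD1_seq P) ?undup_uniq ?mem_undup //= addrAC.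
apply: (add_groupD gE).
  rewrite -opprB; apply: add_groupN => //.
  by rewrite -{1}[x P]mul1r -(rmorph1 iota) -mulrBl -rmorphB; exact: mem_extension.
rewrite big_seq_cond; apply: add_group_sum => // Q; rewrite mem_undup => /andP[Ql QP].
by apply: mem_extension => //; apply: (eP Q Ql).2 => // PQ; rewrite PQ eqxx in QP.
Qed.

(* The first [t] generators are chosen along a generating sequence modulo an
   auxiliary maximal ideal [P0]; by Nakayama this leaves, at each step, only
   finitely many maximal ideals at which the next generator is constrained. *)
Lemma local_global_generation (C t k : nat) : (0 < C)%N -> (t < k)%N ->
  (forall P, is_maximal_ideal P -> exists2 s : seq L, size s = k & generating_mod P s) ->
  (forall P, is_maximal_ideal P -> ~ P C%:R ->
     exists2 s : seq L, size s = t & generating_mod P s) ->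
  exists2 s : seq L, size s = k & gen s = setT.
Proof.
move=> C0 tk genk gent.
have C0R : (C%:R : R) <> 0.
  have [P /maximal_idealP[iP _] PC] :=
    maximal_ideal_outside R_finite_mod prime_not_unit C0.
  by move=> C00; apply: PC; rewrite C00; case: (ideal_add_group iP).
have [S0' S0'P] := maximal_ideals_containing divides_nat R_finite_mod C0R.
pose S0 := [seq P <- S0' | `[< is_maximal_ideal P /\ P C%:R >]].
have S0P P : P \in S0 <-> is_maximal_ideal P /\ P C%:R.
  rewrite mem_filter; split=> [/andP[/asboolP]//|[mP PC]].
  by rewrite S0'P // andbT; exact/asboolP.
have /choice[X XP] : forall P : set R, exists s : seq L, is_maximal_ideal P ->
    size s = k /\ generating_mod P s.
  move=> P; have [mP|nP] := pselect (is_maximal_ideal P); last by exists [::].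
  by have [s ? ?] := genk P mP; exists s.
have [P0 mP0 P0C] := maximal_ideal_outside R_finite_mod prime_not_unit C0.
have P0S0 : P0 \notin S0 by apply/negP => /S0P[].
have outside P : is_maximal_ideal P -> P \notin S0 -> ~ P C%:R.
  by move=> mP /negP PS PC; apply: PS; apply/S0P.
(* n choices remain. At P0 the completion [ys] is one shorter than elsewhere; this slack, paid for
   by the generator beyond t, is what lets the induction run. *)
pose Inv n (s : seq L) := [/\ size s = (t.+1 - n)%N,
  forall P, P \in S0 -> forall i, (i < size s)%N -> extension P (s`_i - (X P)`_i),
  exists2 ys : seq L, size ys = n.-1 & generating_mod P0 (s ++ ys) &
  forall P, is_maximal_ideal P -> P \notin S0 ->
    exists2 xs : seq L, size xs = n & generating_mod P (s ++ xs)].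
have step n s : (n < t.+1)%N -> Inv n.+1 s -> exists s', Inv n s'.
  move=> nt [ss sX [ys /= szy ysP] sx].
  have [r /(maximal_ideals_containing divides_nat R_finite_mod)[bad' badP] rS] :=
    generating_mod_conductor mP0 ysP.
  (* By Nakayama at P0, [s ++ ys] generates at every P not containing r, so only finitely many P
     constrain the next element. *)
  pose bad := [seq P <- bad' | `[< is_maximal_ideal P /\ P r >] & (P \notin S0) && (P != P0)].
  have badm P : P \in bad -> is_maximal_ideal P.
    by rewrite mem_filter => /andP[/andP[/asboolP[]]].
  have /choice[xs xsP] : forall P : set R, exists x : seq L, P \in bad ->
      size x = n.+1 /\ generating_mod P (s ++ x).
    move=> P; have [Pb|nP] := boolP (P \in bad); last by exists [::].
    have [||x ? ?] := sx P; [exact: badm| |by exists x].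
    by move: Pb; rewrite mem_filter => /andP[/and3P[]].
  pose x P := if P \in S0 then (X P)`_(size s) else if P == P0 then head 0 ys
    else head 0 (xs P).
  have [|a aP] := @extension_crt (P0 :: S0 ++ bad) x.
    by move=> P; rewrite in_cons mem_cat => /predU1P[->//|/orP[/S0P[]|/badm]].
  have congr_a P (l : seq L) : is_ideal P -> extension P (a - head 0 l) -> (0 < size l)%N ->
      generating_mod P (s ++ l) -> generating_mod P (rcons s a ++ behead l).
    case: l => //= b l iP ab _; apply: generating_mod_congr => //.
      by rewrite cat_rcons !size_cat.
    move=> i _; rewrite cat_rcons !nth_cat; case: ifP => _.
      by rewrite subrr; case: (extension_group iP).
    by case: (i - _)%N => [|j] //=; rewrite subrr; case: (extension_group iP).
  exists (rcons s a); split.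
  - by rewrite size_rcons ss subSS subSn.
  - move=> P PS i; rewrite size_rcons ltnS leq_eqVlt nth_rcons.
    move=> /predU1P[->|si]; last by rewrite si; exact: sX.
    rewrite ltnn eqxx; have := aP P; rewrite /x PS; apply.
    by rewrite in_cons mem_cat PS orbT.
  - exists (behead ys); first by rewrite size_behead szy.
    have : extension P0 (a - head 0 ys).
      by have := aP P0; rewrite /x (negPf P0S0) eqxx; apply; rewrite inE eqxx.
    have [iP0 _] := maximal_idealP mP0.
    case: (ys) ysP => [|y l] ysP yP.
      move: ysP; rewrite !cats0; apply: generating_modS => z zs.
      by rewrite mem_rcons inE zs orbT.
    exact: congr_a ysP.
  move=> P mP PS; have [iP _] := maximal_idealP mP.
  have [Pb|Pb] := boolP (P \in bad).
    have [sz xg] := xsP P Pb; exists (behead (xs P)); first by rewrite size_behead sz.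
    apply: congr_a; rewrite ?sz //; have := aP P; rewrite /x (negPf PS).
    have -> : P == P0 = false.
      by move: Pb; rewrite mem_filter => /andP[/and3P[_ _ /negPf]].
    by apply; rewrite in_cons mem_cat Pb !orbT.
  (* Away from [bad] the old [ys] completes s, whatever the new element is; its length n is just
     what is allowed outside P0. *)
  exists ys => //.
  apply: (generating_modS (s := s ++ ys)).
    by move=> z; rewrite !mem_cat mem_rcons inE => /orP[->|->]; rewrite !orbT.
  have [->//|PP0] := eqVneq P P0.
  apply: generating_mod_outside rS => // Pr; move/negP: Pb; apply.
  by rewrite mem_filter badP // PS PP0 !andbT; apply/asboolP.
have InvE n : (n <= t.+1)%N -> exists s, Inv (t.+1 - n)%N s.
  elim: n => [_|n IH nt].
    rewrite subn0; exists [::]; split=> //; first by rewrite subnn.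
      by have [ys szy ysP] := gent P0 mP0 P0C; exists ys.
    move=> P mP /(outside P mP)/(gent P mP)[xs szx xsP].
    exists (rcons xs 0); first by rewrite size_rcons szx.
    by apply: generating_modS xsP => z; rewrite mem_rcons inE orbC => ->.
  have [s sI] := IH (ltnW nt); apply: (step _ s); first by rewrite ltnS subSS leq_subr.
  by rewrite -subSn // subSS in sI *.
have [s] := InvE t.+1 (leqnn _); rewrite subnn => -[]; rewrite subn0 => ss sX _ sP.
have /choice[y yP] : forall j, exists y, forall P, P \in S0 -> extension P (y - (X P)`_j).
  by move=> j; apply: (extension_crt (fun P => (X P)`_j)) => P /S0P[].
(* The generators beyond the first t.+1 are needed only at the ideals of [S0]. *)
pose s' := s ++ [seq y j | j <- seq.iota t.+1 (k - t.+1)].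
have szs' : size s' = k by rewrite size_cat size_map size_iota ss subnKC.
exists s' => //; apply: generating_of_local => P mP.
have [iP _] := maximal_idealP mP.
have [PS|PS] := boolP (P \in S0); last first.
  have [xs /size0nil -> xsP] := sP P mP PS; apply: generating_modS xsP => z.
  by rewrite cats0 mem_cat => ->.
have [szX XPg] := XP P mP; apply: generating_mod_congr XPg => //; first by rewrite szX.
move=> i; rewrite szs' => ik; rewrite nth_cat; case: ltnP => [si|si].
  exact: sX.
have ik' : (i - size s < k - t.+1)%N by rewrite ss ltn_sub2r //; rewrite ss in si; exact: leq_ltn_trans si ik.
rewrite (nth_map 0%N) ?size_iota // nth_iota // -ss subnKC //; exact: yP.
Qed.

End Algebra.

(** * Maximal orders *)

Section RSpan.
Variables (K : fieldExtType rat) (H : falgType K).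
Local Notation R := (integers K).

Definition rspan (s : seq H) (x : H) :=
  exists2 c : 'I_(size s) -> K, forall i, c i \in R & x = \sum_(i < size s) c i *: s`_i.

Lemma rspan_sub (M : set H) s : add_group M ->
  (forall c x, c \in R -> M x -> M (c *: x)) -> (forall x, x \in s -> M x) -> rspan s `<=` M.
Proof.
move=> gM MR sM _ [c cR ->]; apply: add_group_sum => // i _.
by apply: MR => //; apply: sM; exact: mem_nth.
Qed.

Lemma rspan_group s : add_group (rspan s).
Proof.
split=> [|_ _ [c cR ->] [d dR ->]].
  by exists (fun=> 0) => [_|]; rewrite ?rpred0 // big1 // => i _; rewrite scale0r.
exists (fun i => c i - d i) => [i|]; first by rewrite rpredB.
by rewrite -sumrB; apply: eq_bigr => i _; rewrite scalerBl.
Qed.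

Lemma rspan_scale s c x : c \in R -> rspan s x -> rspan s (c *: x).
Proof.
move=> cR [d dR ->]; exists (fun i => c * d i) => [i|]; first by rewrite rpredM.
by rewrite scaler_sumr; apply: eq_bigr => i _; rewrite scalerA.
Qed.

Lemma mem_rspan s x : x \in s -> rspan s x.
Proof.
move=> xs; have xi : (index x s < size s)%N by rewrite index_mem.
exists (fun i => (i == Ordinal xi)%:R) => [i|]; first by rewrite rpred_nat.
rewrite (bigD1 (Ordinal xi)) //= eqxx scale1r nth_index // big1 ?addr0 // => i /negPf ->.
by rewrite scale0r.
Qed.

End RSpan.

Section Order.
Variables (K : fieldExtType rat) (H : falgType K) (L : subringClosed H).
Local Notation R := (ring_of_integers K).
Local Notation Lam := (subring_type L).
Local Notation rval := (@subring_val K (integers K)).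
Local Notation lval := (@subring_val H L).
Hypothesis ord : is_order L.

Lemma lval_inj : injective lval.
Proof. exact: val_inj. Qed.

Lemma lvalP (x : H) : reflect (exists y : Lam, lval y = x) (x \in L).
Proof. by apply: (iffP idP) => [Lx|[y <-]]; [exists (Sub x Lx)|exact: valP y]. Qed.

Lemma order_rspan : exists s : seq H, forall x, x \in L <-> rspan s x.
Proof. by have [[s sP] _] := ord; exists s. Qed.

Lemma order_scale c x : c \in integers K -> x \in L -> c *: x \in L.
Proof.
have [s sP] := order_rspan.
by move=> cR /sP xs; apply/sP; exact: rspan_scale.
Qed.

Fact order_scalar_in (c : R) : rval c *: 1 \in L.
Proof. by apply: order_scale; [exact: valP c|exact: rpred1]. Qed.

Definition order_scalar (c : R) : Lam := Sub (rval c *: 1) (order_scalar_in c).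

Lemma lval_order_scalar c : lval (order_scalar c) = rval c *: 1.
Proof. by []. Qed.

Fact order_scalar_zmod_morphism : zmod_morphism order_scalar.
Proof.
by move=> c d; apply: lval_inj; rewrite rmorphB /= !lval_order_scalar rmorphB scalerBl.
Qed.
HB.instance Definition _ :=
  GRing.isZmodMorphism.Build R Lam order_scalar order_scalar_zmod_morphism.

Fact order_scalar_monoid_morphism : monoid_morphism order_scalar.
Proof.
split=> [|c d]; apply: lval_inj.
  by rewrite lval_order_scalar !rmorph1 scale1r.
by rewrite rmorphM /= !lval_order_scalar rmorphM -scalerAl mul1r scalerA.
Qed.
HB.instance Definition _ :=
  GRing.isMonoidMorphism.Build R Lam order_scalar order_scalar_monoid_morphism.

Local Notation iota := order_scalar.

Lemma lval_scalarM c x : lval (iota c * x) = rval c *: lval x.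
Proof. by rewrite rmorphM /= lval_order_scalar -scalerAl mul1r. Qed.

Lemma order_scalarC c x : iota c * x = x * iota c.
Proof.
by apply: lval_inj; rewrite lval_scalarM rmorphM /= lval_order_scalar -scalerAr mulr1.
Qed.

Lemma order_span : exists D (sg : 'I_D -> Lam),
  forall x, exists c : 'I_D -> R, x = \sum_i iota (c i) * sg i.
Proof.
have [s sP] := order_rspan.
have sL (i : 'I_(size s)) : s`_i \in L by apply/sP/mem_rspan/mem_nth.
exists (size s), (fun i : 'I_(size s) => Sub s`_i (sL i)) => x.
have /sP[c cR xc] := valP x; exists (fun i => Sub (c i) (cR i)).
apply: lval_inj; rewrite rmorph_sum /= -[LHS]/(val x) xc; apply: eq_bigr => i _.
by rewrite lval_scalarM.
Qed.

Lemma order_torsion_free n (x : Lam) : (0 < n)%N -> x *+ n = 0 -> x = 0.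
Proof.
move=> n0 /(congr1 lval); rewrite rmorphMn rmorph0 /= -scaler_nat => /eqP.
rewrite scaler_eq0 natK_eq0 eqn0Ngt n0 /= => /eqP x0.
by apply: lval_inj; rewrite x0 rmorph0.
Qed.

Lemma order_finite_mod n : (0 < n)%N -> exists l : seq Lam,
  forall x, exists2 y, y \in l & multiples n (x - y).
Proof.
move=> n0; have [D [sg sgP]] := order_span.
have [l lP] := ring_of_integers_finite_mod K n0.
exists [seq \sum_i iota (l`_((c : {ffun 'I_D -> 'I_(size l)}) i)) * sg i | c <- enum {: {ffun 'I_D -> 'I_(size l)}}] => x.
have [c ->] := sgP x.
have /choice[d dP] : forall i, exists d : 'I_(size l), multiples n (c i - l`_d).
  move=> i; have [y yl h] := lP (c i).
  have yi : (index y l < size l)%N by rewrite index_mem.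
  by exists (Ordinal yi); rewrite /= nth_index.
have /choice[t tP] : forall i, exists t, c i - l`_(d i) = t *+ n by move=> i; exact: dP.
exists (\sum_i iota l`_([ffun i => d i] i) * sg i).
  by apply/mapP; exists [ffun i => d i] => //; rewrite mem_enum.
exists (\sum_i iota (t i) * sg i); rewrite -sumrB -sumrMnl; apply: eq_bigr => i _.
by rewrite ffunE -mulrBl -rmorphB tP rmorphMn mulrnAl.
Qed.

Lemma order_multiple (x : H) : exists2 m, (0 < m)%N & x *+ m \in L.
Proof.
have [s sP] := order_rspan; have [_ Lfull] := ord.
have sL y : y \in s -> y \in L by move=> ys; apply/sP/mem_rspan.
have : x \in <<s>>%VS.
  rewrite (Lfull <<s>>%VS) ?memvf // => y /sP[c _ ->].
  by apply: rpred_sum => i _; apply/rpredZ/memv_span/mem_nth.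
move/(coord_span (X := in_tuple s)) => ->.
elim/big_ind : _ => [|y z [m m0 my] [n n0 nz]|i _].
- by exists 1%N; rewrite ?rpred0.
- exists (m * n)%N; first by rewrite muln_gt0 m0.
  by rewrite mulrnDl mulrnA mulnC mulrnA rpredD // rpredMn.
have [m m0 mc] := integral_multiple (coord (in_tuple s) i x); exists m => //.
by rewrite -scaler_nat scalerA; apply: order_scale => //; apply/sL/mem_nth.
Qed.

Hypothesis max_ord : forall G : subringClosed H, is_order G -> {subset L <= G} -> G =i L.

(** The left order G of I contains L and lies in m^-1 L for an integer m > 0 in I, so it is an
    order, and G = L by maximality. *)
Lemma order_left_order (I : set Lam) n y : full_ideal I -> (0 < n)%N ->
  (forall z, I z -> exists2 x, I x & y * z = x *+ n) -> multiples n y.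
Proof.
move=> [iI [m m0 Im]] n0 yI; have gI := ideal_add_group iI.
pose Gset : set H := [set g | forall z, I z -> exists2 x, I x & g * lval z = lval x].
pose Gpred : {pred H} := [pred g | `[< Gset g >]].
have Gclosed : subring_closed Gpred.
  split=> [|g g' /asboolP Hg /asboolP Hg'|g g' /asboolP Hg /asboolP Hg']; apply/asboolP => z Iz.
  - by exists z; rewrite ?mul1r.
  - have [x Ix gx] := Hg z Iz; have [x' Ix' gx'] := Hg' z Iz.
    by exists (x - x'); [exact: gI.2|rewrite mulrBl gx gx' rmorphB].
  - have [x Ix gx] := Hg' z Iz; have [x' Ix' gx'] := Hg x Ix.
    by exists x' => //; rewrite -mulrA gx gx'.
pose G : subringClosed H := HB.pack Gpred
  (GRing.isSubringClosed.Build H Gpred Gclosed).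
have GP g : g \in G <-> Gset g by split=> /asboolP.
have LG : {subset L <= G}.
  by move=> _ /lvalP[a <-]; apply/GP => z Iz; exists (a * z); [exact: ideal_mull|rewrite rmorphM].
have GR c g : c \in integers K -> g \in G -> c *: g \in G.
  by move=> cR gG; rewrite -[g]mul1r scalerAl rpredM // LG // order_scale ?rpred1.
have nK : (m%:R : K) != 0 by rewrite natK_eq0 -lt0n.
have mG g : g \in G -> exists x, m%:R *: g = lval x.
  by move=> /GP/(_ _ Im)[x _]; rewrite rmorph_nat mulr_natr -scaler_nat; exists x.
have [s sP] := order_rspan; have [l lP] := order_finite_mod m0.
have ordG : is_order G.
  split; last first.
    by have [_ Lf] := ord; move=> V GV; apply: Lf => x /LG/GV.
  (* G is spanned by generators of L and by those m^-1 a lying in G, for a in the finite list of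
     representatives of L modulo m. *)
  exists (s ++ [seq g <- [seq m%:R^-1 *: lval a | a <- l] | g \in G]) => x.
  rewrite -/(rspan _ x); split=> [Gx|].
    have [a xa] := mG x Gx; have [b bl [t abt]] := lP a.
    have xE : x = lval t + m%:R^-1 *: lval b.
      apply: (scalerI nK); rewrite xa scalerDr scalerA mulfV // scale1r.
      by rewrite scaler_nat -rmorphMn /= -abt rmorphB subrK.
    have bG : m%:R^-1 *: lval b \in G.
      have -> : m%:R^-1 *: lval b = x - lval t by rewrite xE [lval t + _]addrC addrK.
      by rewrite rpredB // LG //; apply/lvalP; exists t.
    have gX := rspan_group (s ++ [seq g <- [seq m%:R^-1 *: lval a | a <- l] | g \in G]).
    rewrite xE; apply: (add_groupD gX).
      have /sP : lval t \in L by apply/lvalP; exists t.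
      apply: rspan_sub => // [c z cR|z zs]; first exact: rspan_scale.
      by apply: mem_rspan; rewrite mem_cat zs.
    apply: mem_rspan; rewrite mem_cat mem_filter bG orbC /=.
    by apply/orP; left; apply/mapP; exists b.
  apply: (rspan_sub (M := [set` G])) => /= [|c z|z].
  - have G0 : 0 \in G by exact: rpred0.
    have GB z z' : z \in G -> z' \in G -> z - z' \in G by exact: rpredB.
    by split=> [|z z']; [exact: G0|exact: GB].
  - exact: GR.
  rewrite mem_cat mem_filter => /orP[zs|/andP[]//].
  by apply/LG/sP; exact: mem_rspan.
have nK' : (n%:R : K) != 0 by rewrite natK_eq0 -lt0n.
have : n%:R^-1 *: lval y \in G.
  apply/GP => z /yI[x Ix yz]; exists x => //.
  by rewrite -scalerAl -rmorphM yz rmorphMn /= -[lval x *+ n]scaler_nat scalerA mulVf // scale1r.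
rewrite (max_ord ordG LG) => /lvalP[x xE]; exists x; apply: lval_inj.
by rewrite rmorphMn /= xE -[_ *+ n]scaler_nat scalerA mulfV // scale1r.
Qed.

End Order.

Lemma card_finField_nat (k : finFieldType) : (#|k|%:R : k) = 0.
Proof.
have /eqP : \sum_(x : k) x = \sum_(x : k) (x + 1).
  by rewrite (reindex_inj (addIr (1 : k))).
by rewrite big_split /= sumr_const -subr_eq0 opprD addNKr oppr_eq0 => /eqP.
Qed.

(** * Residue rings *)

Section ResidueField.
Variables (K : fieldExtType rat) (P : ideal (ring_of_integers K)).
Local Notation R := (ring_of_integers K).
Hypothesis mP : is_maximal_ideal (ideal_set P).

Lemma ring_of_integers_maximal_nat : exists2 m, (0 < m)%N & ideal_set P m%:R.
Proof.
apply: (maximal_ideal_nat (@ring_of_integers_comm K) _ _ _ mP).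
- exact: integer_divides_nat.
- exact: ring_of_integers_finite_mod.
- exact: prime_inv_not_integer.
Qed.

Lemma residue_field : exists (k : finFieldType) (la : {rmorphism R -> k}),
  [/\ forall c, exists r, la r = c, forall r, la r = 0 <-> ideal_set P r &
      #|k| = ideal_norm P].
Proof.
case: P mP => I iI /= mI; set Q := Ideal iI.
have fQ : finite_set [set: quot_ring Q].
  apply: (finite_full_quotient (@ring_of_integers_finite_mod K) iI).
  apply: (maximal_ideal_nat (@ring_of_integers_comm K) _ _ _ mI).
  - exact: integer_divides_nat.
  - exact: ring_of_integers_finite_mod.
  - exact: prime_inv_not_integer.
have [_ I1] := maximal_idealP mI.
have [||k [psi [psi' psiK psi'K]]] := finite_division_ring_field fQ.
- by rewrite -(rmorph1 (to_quot Q)) => /to_quot_eq0.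
- move=> x; have [r <-] := to_quot_surj x => /to_quot_eq0 /= Ir.
  have [y Iy] := maximal_ideal_inv (@ring_of_integers_comm K) mI Ir.
  exists (to_quot Q y); rewrite -rmorphM -(rmorph1 (to_quot Q)); apply/esym/to_quotP.
  exact: Iy.
exists k, (psi \o to_quot Q : {rmorphism R -> k}); split=> /= [c|r|].
- by have [r rc] := to_quot_surj (psi' c); exists r; rewrite rc psi'K.
- split=> [h|/(to_quot_eq0 Q) ->]; last exact: rmorph0.
  by apply/(to_quot_eq0 Q)/(can_inj psiK); rewrite h rmorph0.
rewrite /ideal_norm; have -> : [set: quot_ring Q] = [set` [seq psi' c | c <- enum k]].
  apply/seteqP; split=> // x _ /=; apply/mapP; exists (psi x); first by rewrite mem_enum.
  by rewrite psiK.
rewrite ncard_seq; first by rewrite size_map -cardE.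
by rewrite map_inj_uniq ?enum_uniq //; exact: can_inj psi'K.
Qed.

(** If N(P) < D, then N(P) divides D!, and N(P) is zero in R/P. *)
Lemma ideal_norm_lower D : ~ ideal_set P (D`!)%:R -> (D <= ideal_norm P)%N.
Proof.
have [k [la [las laP <-]]] := residue_field; move=> nP; rewrite leqNgt; apply/negP => kD.
apply/nP/laP; have /dvdnP[m ->] : (#|k| %| D`!)%N.
  by apply: dvdn_fact; rewrite (ltnW kD) andbT; apply/card_gt0P; exists 0.
by rewrite rmorph_nat natrM card_finField_nat mulr0.
Qed.

End ResidueField.

Section Residue.
Variables (K : fieldExtType rat) (H : falgType K) (L : subringClosed H).
Local Notation R := (ring_of_integers K).
Local Notation Lam := (subring_type L).
Local Notation rval := (@subring_val K (integers K)).
Local Notation lval := (@subring_val H L).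
Hypothesis ord : is_order L.
Local Notation iota := (order_scalar ord).
Local Notation extended P := (@extended_set K H L P).
Variables (D : nat) (sg : 'I_D -> Lam).
Hypothesis sg_span : forall x, exists c : 'I_D -> R, x = \sum_i iota (c i) * sg i.

Lemma extension_extended (P : ideal R) : extension iota sg (ideal_set P) = extended P.
Proof.
have iP := idealP P; have gE := extension_group iota sg iP.
apply/seteqP; split=> [_ [c Pc ->]|x [s [sP xE]]].
  exists [seq (c i, sg i) | i <- enum 'I_D]; split=> [u /mapP[i _ ->]|]; first exact: Pc.
  rewrite rmorph_sum big_map big_enum /=; apply: eq_bigr => i _.
  exact: lval_scalarM.
have -> : x = \sum_(u <- s) iota u.1 * u.2.
  apply: lval_inj; rewrite xE rmorph_sum /=; apply: eq_bigr => u _.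
  by rewrite lval_scalarM.
rewrite big_seq; apply: add_group_sum => // u us.
by apply: mem_extension => //; exact: sP.
Qed.

Variable P : ideal R.
Hypothesis mP : is_maximal_ideal (ideal_set P).
Local Notation B := (semisimple_residue_ring L P).

Definition residue_map : {rmorphism Lam -> B} :=
  to_quot (jacobson (residue_ring L P)) \o to_quot (extended_ideal L P).

Lemma residue_map_surj b : exists x, residue_map x = b.
Proof.
have [y <-] := to_quot_surj b; have [x <-] := to_quot_surj y.
by exists x.
Qed.

Lemma residue_map_extended x : extended P x -> residue_map x = 0.
Proof. by move=> /(to_quot_eq0 (extended_ideal L P)) /= ->; rewrite rmorph0. Qed.

Lemma extended_nat : exists2 m, (0 < m)%N & extended P m%:R.
Proof.
have [m m0 Pm] := ring_of_integers_maximal_nat mP; exists m => //.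
rewrite -extension_extended -(mulr1 m%:R) -(rmorph_nat iota).
by apply: mem_extension => //; exact: idealP.
Qed.

Lemma finite_residue_ring : finite_set [set: residue_ring L P].
Proof.
exact: (finite_full_quotient (order_finite_mod ord) (extended_is_ideal L P) extended_nat).
Qed.

Lemma finite_semisimple_residue_ring : finite_set [set: B].
Proof. exact: finite_setT_image finite_residue_ring (@to_quot_surj _ _). Qed.

Lemma residue_map_nilpotent : exists N, forall l : seq Lam, size l = N.+1 ->
  (forall x, x \in l -> ker_pi residue_map x) -> extended P (\prod_(x <- l) x).
Proof.
have [N NP] := jacobson_nilpotent finite_residue_ring; exists N => -[//|x l] [szl] lk.
(* One factor beyond the nilpotency exponent is absorbed, to reach the successor form expected by
   the lifting section. *)
rewrite big_cons; apply: ideal_mull; first exact: extended_is_ideal.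
apply/(to_quot_eq0 (extended_ideal L P)); rewrite rmorph_prod.
rewrite -(big_map (to_quot (extended_ideal L P)) xpredT id); apply: NP; first by rewrite size_map.
move=> _ /mapP[y yl ->]; apply/(to_quot_eq0 (jacobson _)).
by apply: (lk y); rewrite inE yl orbT.
Qed.

Lemma residue_data : exists (k : finFieldType) (rho : {rmorphism k -> B}) (la : {rmorphism R -> k}),
  [/\ forall c, exists r, la r = c, forall r, rho (la r) = residue_map (iota r),
      #|k| = ideal_norm P & exists w : wedderburn rho, True].
Proof.
have [k [la [las laP kN]]] := residue_field mP.
pose rep c := sval (cid (las c)); have repK c : la (rep c) = c by exact: (svalP (cid (las c))).
pose f c : B := residue_map (iota (rep c)).
have fE r : f (la r) = residue_map (iota r).
  apply/eqP; rewrite -subr_eq0 /f -!rmorphB; apply/eqP/residue_map_extended.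
  rewrite -extension_extended -[X in extension _ _ _ X]mulr1; apply: mem_extension => //; first exact: idealP.
  by apply/laP; rewrite rmorphB repK subrr.
have fB : zmod_morphism f.
  move=> c d; have [r <-] := las c; have [s <-] := las d.
  by rewrite -rmorphB !fE !rmorphB.
have fM : monoid_morphism f.
  split=> [|c d]; first by rewrite -(rmorph1 la) fE !rmorph1.
  have [r <-] := las c; have [s <-] := las d.
  by rewrite -rmorphM !fE !rmorphM.
pose rho : {rmorphism k -> B} := HB.pack f (GRing.isZmodMorphism.Build _ _ _ fB)
  (GRing.isMonoidMorphism.Build _ _ _ fM).
exists k, rho, la; split=> //; apply: wedderburn_artin.
- move=> c b; have [r <-] := las c; have [x <-] := residue_map_surj b.
  by rewrite -[rho _]/(f _) fE -!rmorphM order_scalarC.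
- exact: finite_semisimple_residue_ring.
exact: jacobson_quot_semiprime.
Qed.

Definition bound_at m := forall n r,
  (num_simple_factors B n.+1 (GF (ideal_norm P ^ r.+1)) *
     (r.+1 * PGL_card n.+1 (GF (ideal_norm P ^ r.+1))) <=
   num_generating_tuples m n.+1 (ideal_norm P) r.+1)%N.

Lemma bound_at_generated m (s : seq Lam) : size s = m ->
  subring_gen (range iota `|` [set` s]) = setT -> bound_at m.
Proof.
move=> ss sgen n r; have [k [rho [la [las rhoE <- [w _]]]]] := residue_data.
have sz : size [seq residue_map x | x <- s] == m by rewrite size_map ss.
apply: (bound_of_alg_generating w (t := Tuple sz)).
apply/seteqP; split=> // b _; have [x <-] := residue_map_surj b.
have : subring_gen (range iota `|` [set` s]) x by rewrite sgen.
move/(subring_gen_morph residue_map); apply: subring_genS => _ [y [[r' _ <-]|ys] <-].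
  by left; exists (la r'); rewrite // rhoE.
by right; exact: map_f.
Qed.

Lemma bound_at1_comm : bound_at 1 -> forall x y : B, x * y = y * x.
Proof.
have [k [rho [la [las rhoE kN [w _]]]]] := residue_data.
by rewrite /bound_at -kN; exact: (bound1_comm w).
Qed.

Hypothesis max_ord : forall G : subringClosed H, is_order G -> {subset L <= G} -> G =i L.

Lemma generating_mod_lift (k : finFieldType) (rho : {rmorphism k -> B}) (la : {rmorphism R -> k})
    (w : wedderburn rho) m (t : m.-tuple B) :
  (forall c, exists r, la r = c) -> (forall r, rho (la r) = residue_map (iota r)) ->
  (1 < m)%N \/ (0 < m)%N /\ (forall x y : Lam, x * y = y * x) ->
  alg_generating rho t ->
  exists2 s : seq Lam, size s = m & generating_mod iota sg (ideal_set P) s.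
Proof.
move=> las rhoE hm tg.
have /choice[a aP] : forall i, exists x, residue_map x = tnth t i.
  by move=> i; exact: residue_map_surj.
have [N NP] := residue_map_nilpotent.
have rangeE : residue_map @` range iota = range rho.
  apply/seteqP; split=> [_ [_ [r _ <-] <-]|_ [c _ <-]].
    by exists (la r); rewrite // rhoE.
  by have [r <-] := las c; exists (iota r); [exists r|rewrite rhoE].
have fker : full_ideal (ker_pi residue_map).
  split; last first.
    by have [m' m'0 Em'] := extended_nat; exists m' => //; exact: residue_map_extended.
  split; first split; first exact: (rmorph0 residue_map).
  - by move=> x y x0 y0; rewrite /ker_pi /mkset rmorphB [X in X - _]x0 y0 subr0.
  - by move=> x y y0; rewrite /ker_pi /mkset rmorphM y0 mulr0.
  - by move=> x y y0; rewrite /ker_pi /mkset rmorphM y0 mul0r.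
have [|a' a'P] := lift_generators w residue_map_surj rangeE (order_torsion_free (L := L))
  (order_finite_mod ord) (order_left_order ord max_ord) fker (extended_is_ideal L P) NP _ hm (a := a).
  rewrite -[RHS]tg; congr (subring_gen (_ `|` _)); apply/seteqP; split=> [_ [i _ <-]|b /=].
    by rewrite [(_ \o _) i]aP /=; exact: mem_tnth.
  by move=> /tnthP[i ->]; exists i => //; exact: aP.
exists [seq a' i | i <- enum 'I_m]; first by rewrite size_map -cardE card_ord.
move=> x; rewrite extension_extended; have [s Ss xs] := a'P x; exists s => //.
apply: subring_genS Ss; apply: setUS => _ [i _ <-] /=.
by apply: map_f; rewrite mem_enum.
Qed.

Lemma bound_at_generating_mod m : bound_at m ->
  (1 < m)%N \/ (0 < m)%N /\ (forall x y : Lam, x * y = y * x) ->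
  exists2 s : seq Lam, size s = m & generating_mod iota sg (ideal_set P) s.
Proof.
have [k [rho [la [las rhoE kN [w _]]]]] := residue_data.
rewrite /bound_at -kN => /(alg_generating_of_bound w)[t tg] hm.
exact: (generating_mod_lift w las rhoE hm tg).
Qed.

Lemma large_norm_generating_mod m : (D ^ 3 <= ideal_norm P)%N ->
  m = 2%N \/ m = 1%N /\ (forall x y : Lam, x * y = y * x) ->
  exists2 s : seq Lam, size s = m & generating_mod iota sg (ideal_set P) s.
Proof.
have [k [rho [la [las rhoE <- [w _]]]]] := residue_data => Dk hm.
pose g (c : {ffun 'I_D -> k}) := \sum_i rho (c i) * residue_map (sg i).
have gs b : exists c, g c = b.
  have [x <-] := residue_map_surj b; have [c ->] := sg_span x.
  exists [ffun i => la (c i)]; rewrite rmorph_sum; apply: eq_bigr => i _.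
  by rewrite ffunE rhoE -rmorphM.
case: hm => [->|[-> LC]].
  have [t tg] := large_field_generator2 w gs Dk.
  by apply: (generating_mod_lift w las rhoE _ tg); left.
have BC (x y : B) : x * y = y * x.
  have [x' <-] := residue_map_surj x; have [y' <-] := residue_map_surj y.
  by rewrite -!rmorphM LC.
have [t tg] := large_field_generator1 w gs Dk BC.
by apply: (generating_mod_lift w las rhoE _ tg); right.
Qed.

End Residue.

(** * The theorem *)

Section Commutativity.
Variables (K : fieldExtType rat) (H : falgType K).

(** Let x A x = 0 and u lie in a minimal left ideal. If x u were nonzero it would generate that
    ideal, so u = h x u and x u = x h x u = 0. Hence x kills all minimal left ideals, and 1. *)
Lemma semisimple_semiprime (A : pzRingType) : semisimple A -> semiprime_ring A.
Proof.
move=> [m [I [Imin Idec]]] x xax.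
have xI i u : I i u -> x * u = 0.
  move=> Iu; apply: contrapT => xu; have [[I0 IB IM] _ Imax] := Imin i.
  pose J : set A := [set z | exists h, z = h * (x * u)].
  have [||J0|JI] := Imax J.
  - split=> [|_ _ [h ->] [h' ->]|a _ [h ->]].
    + by exists 0; rewrite mul0r.
    + by exists (h - h'); rewrite mulrBl.
    + by exists (a * h); rewrite mulrA.
  - by move=> _ [h ->]; rewrite mulrA; exact: IM.
  - have : J (x * u) by exists 1; rewrite mul1r.
    by rewrite J0 => /xu.
  have [h uE] : J u by rewrite JI.
  by apply: xu; rewrite uE !mulrA xax mul0r.
have [t [[tI t1] _]] := Idec 1; rewrite -[x]mulr1 t1 mulr_sumr big1 // => i _.
exact: xI (tI i).
Qed.

Lemma falg_left_divide (x a : H) :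
  (\dim (limg (amulr x)) <= \dim (limg (amulr (a * x)%R)))%N -> exists b, x = b * (a * x).
Proof.
have sub : (limg (amulr (a * x)%R) <= limg (amulr x))%VS.
  apply/subvP => _ /memv_imgP[y _ ->]; apply/memv_imgP.
  by exists (y * a); rewrite ?memvf // !lfunE /= mulrA.
move=> le; have /eqP e : limg (amulr (a * x)%R) == limg (amulr x) by rewrite eqEdim sub.
have : x \in limg (amulr x).
  by apply/memv_imgP; exists 1; rewrite ?memvf // lfunE /= mul1r.
by rewrite -e => /memv_imgP[b _ xE]; exists b; rewrite {1}xE lfunE.
Qed.

Variable L : subringClosed H.
Local Notation R := (ring_of_integers K).
Local Notation Lam := (subring_type L).
Local Notation rval := (@subring_val K (integers K)).
Local Notation lval := (@subring_val H L).
Hypothesis ord : is_order L.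
Local Notation iota := (order_scalar ord).

(* A functional [phi] with [phi z <> 0] maps [P Lam] into [P / n] for a fixed
   denominator [n]. *)
Lemma extended_inter (z : Lam) m : (0 < m)%N ->
  (forall P : ideal R, is_maximal_ideal (ideal_set P) -> ~ ideal_set P m%:R ->
     extended_set P z) -> z = 0.
Proof.
move=> m0 zP; apply: contrapT => z0.
have [D [sg sg_span]] := order_span ord.
pose phi i (x : H) : K := coord (vbasis {:H}) i x.
have [i zi] : exists i, phi i (lval z) != 0.
  apply: contrapT => /forallNP zi; apply/z0/lval_inj; rewrite rmorph0.
  rewrite (coord_vbasis (memvf (lval z))) big1 // => i _.
  by have /negP := zi i; rewrite negbK => /eqP; rewrite /phi => ->; rewrite scale0r.
have [n n0 nR] : exists2 n, (0 < n)%N & forall j, n%:R * phi i (lval (sg j)) \in integers K.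
  have /choice[d dP] : forall j, exists d : nat,
      (0 < d)%N /\ d%:R * phi i (lval (sg j)) \in integers K.
    by move=> j; have [d ? ?] := integral_multiple (phi i (lval (sg j))); exists d.
  exists (\prod_j d j)%N; first by apply: prodn_gt0 => j; exact: (dP j).1.
  move=> j; rewrite (bigD1 j) //= natrM mulrAC mulrC.
  by rewrite rpredM ?rpred_nat //; exact: (dP j).2.
pose a j : R := Sub (n%:R * phi i (lval (sg j))) (nR j).
have phi_sum (c : 'I_D -> R) : n%:R * phi i (lval (\sum_j iota (c j) * sg j)) =
    rval (\sum_j c j * a j).
  rewrite !rmorph_sum /= /phi linear_sum mulr_sumr; apply: eq_bigr => j _ /=.
  by rewrite lval_scalarM linearZ /= mulrCA rmorphM.
have [c zE] := sg_span z; pose w := \sum_j c j * a j.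
have wE : n%:R * phi i (lval z) = rval w by rewrite {1}zE phi_sum.
have w0 : w <> 0.
  move=> w0; move/eqP: wE; rewrite w0 rmorph0 mulf_eq0 natK_eq0 (negPf zi) orbF.
  by rewrite eqn0Ngt n0.
have [M [s [M0 sw]]] := integer_divides_nat w0.
have Mm0 : (0 < M * m)%N by rewrite muln_gt0 M0.
have [P mP] := maximal_ideal_outside (@ring_of_integers_finite_mod K)
  (@prime_inv_not_integer K) Mm0.
have [iP _] := maximal_idealP mP; apply.
rewrite natrM; have [Pm|Pm] := pselect (P m%:R); first exact: ideal_mull.
apply: ideal_mulr => //; rewrite -sw; apply: ideal_mull => //.
have := zP (Ideal iP) mP Pm; rewrite -(extension_extended sg_span) => -[d Pd zd].
suff -> : w = \sum_j d j * a j.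
  by apply: add_group_sum (ideal_add_group iP) _ => j _; apply: ideal_mulr => //; exact: Pd.
by apply: rval_inj; rewrite -wE -phi_sum -zd.
Qed.

Hypothesis H_semisimple : semisimple H.

(** The elements of H with a positive multiple in all the kernels form a left ideal; if it is
    nonzero it contains an idempotent e, and z = m e lies in all kernels. Then m^N z = z^(N+1) is in
    P Lambda, and m is invertible modulo P unless P contains m. *)
Lemma residue_separates (x : Lam) : (forall P : ideal R,
  is_maximal_ideal (ideal_set P) -> residue_map L P x = 0) -> x = 0.
Proof.
move=> x0; apply: contrapT => xn0.
pose T0 (y : Lam) := forall P : ideal R, is_maximal_ideal (ideal_set P) -> residue_map L P y = 0.
pose T : set H := [set h | exists2 m, (0 < m)%N & exists2 y, T0 y & h *+ m = lval y].
have [||e [[e0 _] ee [m m0 [z T0z ez]]]] := left_ideal_idempotent (T := T)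
    (semisimple_semiprime H_semisimple) falg_left_divide.
- move=> a h [m m0 [y T0y hy]]; have [n n0 /lvalP[b bE]] := order_multiple ord a.
  exists (n * m)%N; first by rewrite muln_gt0 n0.
  exists (b * y); first by move=> P mP; rewrite rmorphM T0y // mulr0.
  by rewrite rmorphM /= bE -hy mulrnAl mulrnAr mulnC mulrnA.
- exists (lval x); first by exists 1%N => //; exists x.
  by move=> x00; apply: xn0; apply: lval_inj; rewrite x00 rmorph0.
have zz N : z ^+ N.+1 = z *+ m ^ N.
  elim: N => [|N IH]; first by rewrite expr1 expn0.
  rewrite exprS IH mulrnAr expnS mulrnA; congr (_ *+ _); apply: lval_inj.
  by rewrite rmorphM rmorphMn /= -ez mulrnAl mulrnAr ee.
apply: e0; have : z = 0.
  apply: (extended_inter m0) => P mP Pm; have [iP P1] := maximal_idealP mP.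
  have [D [sg sg_span]] := order_span ord.
  have [N NP] := residue_map_nilpotent sg_span mP.
  have : extended_set P (z *+ m ^ N).
    have <- : \prod_(y <- nseq N.+1 z) y = z *+ m ^ N.
      by rewrite big_nseq -Monoid.iteropE -[iterop _ _ _ _]/(z ^+ N.+1) zz.
    apply: NP => [|y]; first by rewrite size_nseq.
    by rewrite mem_nseq => /andP[_ /eqP ->]; exact: T0z.
  have PmN : ~ ideal_set P (m%:R ^+ N).
    elim: N {NP} => [|N IH] //; rewrite exprS.
    by move=> /(maximal_ideal_prime (@ring_of_integers_comm K) mP)[|].
  have [t Pt] := maximal_ideal_inv (@ring_of_integers_comm K) mP PmN.
  rewrite -!(extension_extended sg_span) => Ez; have gE := extension_group iota sg iP.
  have -> : z = iota (1 - t * m%:R ^+ N) * z + iota t * (z *+ m ^ N).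
    rewrite rmorphB rmorph1 mulrBl mul1r rmorphM rmorphXn rmorph_nat -natrX.
    by rewrite -mulrA mulr_natl subrK.
  apply: (add_groupD gE); first exact: mem_extension.
  by apply: ideal_mull => //; apply: extension_ideal => //; exact: order_scalarC.
move=> z0; move/eqP: ez; rewrite z0 rmorph0 -scaler_nat scaler_eq0 natK_eq0 eqn0Ngt m0 /=.
by move/eqP.
Qed.

Lemma order_comm : (forall P : ideal R, is_maximal_ideal (ideal_set P) -> bound_at L P 1) ->
  forall x y : Lam, x * y = y * x.
Proof.
move=> bound x y; apply/eqP; rewrite -subr_eq0; apply/eqP/residue_separates => P mP.
have [D [sg sg_span]] := order_span ord.
rewrite rmorphB !rmorphM; apply/eqP; rewrite subr_eq0; apply/eqP.
exact: (bound_at1_comm sg_span mP (bound P mP)).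
Qed.

End Commutativity.

Section Main.
Import Num.Theory.
Variables (K : fieldExtType rat) (H : falgType K) (L : subringClosed H).
Local Notation R := (ring_of_integers K).
Local Notation Lam := (subring_type L).
Local Notation lval := (@subring_val H L).
Hypothesis ord : is_order L.
Local Notation iota := (order_scalar ord).
Local Notation gen s := (subring_gen (range iota `|` [set` s])).

Lemma multiplicity_boundP m : multiplicity_bound L m <->
  forall P : ideal R, is_maximal_ideal (ideal_set P) -> bound_at L P m.
Proof.
have E P n r : ((residue_multiplicity L P n.+1 r.+1)%:R <=
     (num_generating_tuples m n.+1 (ideal_norm P) r.+1)%:R /
       (r.+1%:R * (PGL_card n.+1 (GF (ideal_norm P ^ r.+1)))%:R) :> rat)%R =
   (residue_multiplicity L P n.+1 r.+1 * (r.+1 * PGL_card n.+1 (GF (ideal_norm P ^ r.+1))) <=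
     num_generating_tuples m n.+1 (ideal_norm P) r.+1)%N.
  rewrite -natrM ler_pdivlMr; first by rewrite -natrM ler_nat.
  by rewrite ltr0n muln_gt0 PGL_card_gt0.
split=> [h P mP n r|h P mP [//|n] [//|r] _ _]; last by rewrite /= E; exact: h.
by have := h P mP n.+1 r.+1 isT isT; rewrite /= E.
Qed.

Lemma order_generated_byP k : order_generated_by L k <->
  exists2 s : seq Lam, size s = k & gen s = setT.
Proof.
split=> [[a]|[s szs sgen]].
  rewrite /generates => aL.
  have aP x : x \in a -> x \in L.
    move=> xa; suff : [set` L] x by []. rewrite -aL; apply: sub_gen_smallest; exact: xa.
  pose s : seq Lam := [seq insubd (0 : Lam) x | x <- a].
  have sa : [seq lval x | x <- s] = a.
    rewrite -map_comp -[RHS]map_id; apply/eq_in_map => x xa.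
    by rewrite /= -[lval _]/(val _) val_insubd aP.
  exists s; first by rewrite -(size_map lval) sa size_tuple.
  apply/seteqP; split=> // x _.
  have : smallest (is_subalgebra *:%R (integers K)) [set` a] (lval x).
    by rewrite aL /=; exact: valP x.
  pose M : set H := [set y | exists2 z, gen s z & lval z = y].
  move=> /(_ M) xM; have [|z Sz /lval_inj <- //] := xM; split=> [|y].
    split=> [|_ _ [y Sy <-] [z Sz <-]|_ _ [y Sy <-] [z Sz <-]|c _ cR [y Sy <-]].
    - by exists 1; [exact: subring_gen1|rewrite rmorph1].
    - by exists (y - z); [exact: subring_genB|rewrite rmorphB].
    - by exists (y * z); [exact: subring_genM|rewrite rmorphM].
    - exists (iota (Sub c cR) * y); first exact: subring_gen_scale.
      by rewrite lval_scalarM.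
  move=> ya; have : y \in tval a by exact: ya.
  rewrite -sa => /mapP[z zs ->]; exists z => //.
  by apply: subring_gen_in; right.
have sz : size [seq lval x | x <- s] == k by rewrite size_map szs.
exists (Tuple sz); apply/seteqP; split.
  apply: smallest_sub => [|x /= /mapP[y _ ->]]; last exact: valP y.
  split=> [|x y|x y|c x cR] /=; [exact: rpred1|exact: rpredB|exact: rpredM|].
  by move=> Lx; exact: order_scale.
move=> _ /lvalP[x <-] M [[M1 MB MM MR] sM].
have : gen s x by rewrite sgen.
elim=> {x} [x [[c _ <-]|xs]|||].
- by rewrite lval_order_scalar; apply: MR => //; exact: valP c.
- by apply: sM; exact: map_f.
- by rewrite rmorph1.
- by move=> x y _ Mx _ My; rewrite rmorphB; exact: MB.
- by move=> x y _ Mx _ My; rewrite rmorphM; exact: MM.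
Qed.

Lemma generated_multiplicity_bound k : order_generated_by L k -> multiplicity_bound L k.
Proof.
move=> /order_generated_byP[s szs sgen]; apply/multiplicity_boundP => P mP.
have [D [sg sg_span]] := order_span ord.
exact: (bound_at_generated sg_span mP szs sgen).
Qed.

Hypothesis max_ord : forall G : subringClosed H, is_order G -> {subset L <= G} -> G =i L.

(** By the bound, h generators suffice at every P. With D module generators of Lambda, t suffice
    where N(P) >= D^3, in particular at every P not containing (D^3)!. Zeros pad the h generators to
    k. *)
Lemma order_generated_of_bound h t k : multiplicity_bound L h ->
  (1 < h)%N \/ (0 < h)%N /\ (forall x y : Lam, x * y = y * x) ->
  t = 2%N \/ t = 1%N /\ (forall x y : Lam, x * y = y * x) ->
  (t < k)%N -> (h <= k)%N -> order_generated_by L k.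
Proof.
move=> /multiplicity_boundP bound hh ht tk hk; apply/order_generated_byP.
have [D [sg sg_span]] := order_span ord.
apply: (local_global_generation (order_scalarC ord) (@ring_of_integers_comm K) sg_span
  (@integer_divides_nat K) (@ring_of_integers_finite_mod K) (@prime_inv_not_integer K)
  (fact_gt0 (D ^ 3)) tk) => [P mP|P mP PD]; have [iP _] := maximal_idealP mP.
  have [s szs sgen] :=
    bound_at_generating_mod (P := Ideal iP) sg_span mP max_ord (bound (Ideal iP) mP) hh.
  exists (s ++ nseq (k - h) 0); first by rewrite size_cat size_nseq szs subnKC.
  by apply: generating_modS sgen => x xs; rewrite mem_cat xs.
have := large_norm_generating_mod (P := Ideal iP) sg_span mP max_ord _ ht.
by apply; exact: ideal_norm_lower.
Qed.

End Main.

Theorem theorem5p8 (K : fieldExtType rat) (H : falgType K)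
    (Lambda : subringClosed H) (h : nat)
    (H_semisimple : semisimple H)
    (Lambda_maximal : is_maximal_order Lambda)
    (h_smallest : smallest_positive (multiplicity_bound Lambda) h) :
  [/\ (3 <= h)%N -> smallest_positive (order_generated_by Lambda) h,
      h = 2%N ->
        smallest_positive (order_generated_by Lambda) 2%N \/
        smallest_positive (order_generated_by Lambda) 3%N &
      h = 1%N ->
        (forall x y : H, x \in Lambda -> y \in Lambda -> (x * y = y * x)%R) /\
        (smallest_positive (order_generated_by Lambda) 1%N \/
         smallest_positive (order_generated_by Lambda) 2%N)].
Proof.
have [ord max_ord] := Lambda_maximal; have [h0 hb hmin] := h_smallest.
have lower j : (0 < j)%N -> order_generated_by Lambda j -> (h <= j)%N.
  by move=> j0 /(generated_multiplicity_bound ord); exact: hmin.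
have alternative : order_generated_by Lambda h.+1 ->
    smallest_positive (order_generated_by Lambda) h \/
    smallest_positive (order_generated_by Lambda) h.+1.
  move=> gen; have [genh|ngenh] := pselect (order_generated_by Lambda h); [left|right] => //.
  split=> // j j0 genj; rewrite ltn_neqAle lower // andbT.
  by apply/eqP => hj; apply: ngenh; rewrite hj.
split=> [h3|h2|h1].
- split=> //; apply: (order_generated_of_bound ord max_ord hb _ (or_introl erefl) h3) => //.
  by left; exact: leq_trans h3.
(* Two generators may be needed at infinitely many P, so t = 2 and k = 3. *)
- rewrite -h2; apply: alternative.
  by apply: (order_generated_of_bound ord max_ord hb _ (or_introl erefl)); rewrite h2 //; left.
have LC : forall x y : subring_type Lambda, x * y = y * x.
  by apply: (order_comm ord H_semisimple); apply/multiplicity_boundP; rewrite -h1.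
split; first by move=> _ _ /lvalP[x <-] /lvalP[y <-]; rewrite -!rmorphM LC.
rewrite -h1; apply: alternative.
by apply: (order_generated_of_bound ord max_ord hb (t := 1%N)); rewrite ?h1 //; right.
Qed.
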